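(* Let $\mathcal{H}$ be a separable infinite-dimensional Hilbert space and let $\mathfrak{A}$ be a unital subalgebra of $\mathcal{B}(\mathcal{H})$ that is closed in the weak operator topology. If $\mathfrak{A}$ has the left (resp. right) partial factorization property, then $\mathfrak{A}=\operatorname{Alg}\operatorname{Lat}\mathfrak{A}$. In particular, $\mathfrak{A}$ is reflexive.
   Context: $\mathcal{B}(\mathcal{H})$ is the algebra of all bounded linear operators on $\mathcal{H}$; unital means containing the identity $I$ of $\mathcal{H}$. The algebra $\mathfrak{A}$ is not assumed self-adjoint. A unital subalgebra $\mathfrak{A}\subseteq\mathcal{B}(\mathcal{H})$ has the left (resp. right) partial factorization property if for every invertible $S\in\mathcal{B}(\mathcal{H})$ there exists an isometry (resp. a co-isometry) $U\in\mathcal{B}(\mathcal{H})$ such that $U^*S\in\mathfrak{A}$ and $S^{-1}U\in\mathfrak{A}$. Closed subspaces are identified with the orthogonal projections onto them, and $E^\perp=I-E$. The invariant subspace lattice is $\operatorname{Lat}\mathfrak{A}=\{E\in\mathcal{B}(\mathcal{H}) \text{ a projection}: E^{\perp}AE=0 \text{ for all } A\in\mathfrak{A}\}$, and $\operatorname{Alg}\operatorname{Lat}\mathfrak{A}=\{A\in\mathcal{B}(\mathcal{H}): E^{\perp}AE=0 \text{ for all } E\in\operatorname{Lat}\mathfrak{A}\}$. The algebra $\mathfrak{A}$ is reflexive if $\mathfrak{A}=\operatorname{Alg}\operatorname{Lat}\mathfrak{A}$. *)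

(* Defs.v *)
From HB Require Import structures.
From mathcomp Require Import all_boot all_order all_algebra complex.
From mathcomp Require Import all_classical all_reals topology normedtype.

Set Implicit Arguments.
Unset Strict Implicit.
Unset Printing Implicit Defensive.

Import Order.TTheory GRing.Theory Num.Theory.
Import numFieldNormedType.Exports.

Local Open Scope classical_set_scope.
Local Open Scope ring_scope.

(* [{dot H for Num.conj}] is linear in the first argument and conjugate-linear in
   the second. *)
HB.mixin Record isHilbert (R : realType) H & CompleteNormedModule R[i] H := {
  hdot : {dot H for (@Num.conj R[i])};
  hdot_norm : forall x : H, `|x| ^+ 2 = hdot x x
}.

#[short(type="hilbertType")]
HB.structure Definition Hilbert (R : realType) :=
  {H of CompleteNormedModule R[i] H & isHilbert R H}.

Reserved Notation "''[' u , v ]" (format "''[' u ,  v ]").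
Notation "''[' u , v ]" := (hdot u v) : ring_scope.

Definition separable (T : topologicalType) : Prop :=
  exists D : set T, countable D /\ dense D.

Definition finite_dimensional (K : pzRingType) (V : lmodType K) : Prop :=
  exists (n : nat) (b : 'I_n -> V), forall v : V,
    exists c : 'I_n -> K, v = \sum_(i < n) c i *: b i.

Section BoundedOperators.
Variables (R : realType) (H : hilbertType R).

Definition bounded_linear (f : H -> H) : Prop :=
  linear f /\ exists M : R[i], forall x : H, `|f x| <= M * `|x|.

Definition bounded_linear_pred : {pred H -> H} := fun f => `[< bounded_linear f >].

Record bounded_operator := BoundedOperator {
  bop_fun :> H -> H;
  bop_funP : bop_fun \in bounded_linear_pred
}.

HB.instance Definition _ := [isSub for bop_fun].
HB.instance Definition _ := [Choice of bounded_operator by <:].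

Lemma bounded_linear_ge0 f : bounded_linear f ->
  exists2 M : R[i], 0 <= M & forall x : H, `|f x| <= M * `|x|.
Proof.
case=> _ [M fM].
have [[x x0]|H0] := pselect (exists x : H, x != 0).
  exists M => //.
  by rewrite -(pmulr_lge0 _ (_ : 0 < `|x|)) ?normr_gt0// (le_trans _ (fM x)).
exists 0 => // x; rewrite mul0r.
have -> : f x = 0 by apply/eqP/negPn/negP => fx0; apply: H0; exists (f x).
by rewrite normr0.
Qed.

Lemma bounded_linear_submod : submod_closed bounded_linear_pred.
Proof.
split.
  apply/asboolP; split; first by move=> a u v; rewrite /= scaler0 addr0.
  by exists 0 => x; rewrite normr0 mul0r.
move=> a f g /asboolP bf /asboolP bg; apply/asboolP; split.
  move=> k u v; have [lf _] := bf; have [lg _] := bg.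
  by rewrite !fctE lf lg !scalerDr !scalerA (mulrC a) addrACA.
have [M M0 fM] := bounded_linear_ge0 bf.
have [N N0 gN] := bounded_linear_ge0 bg.
exists (`|a| * M + N) => x; rewrite !fctE.
rewrite (le_trans (ler_normD _ _))// mulrDl lerD// normrZ -mulrA.
by rewrite ler_wpM2l.
Qed.

HB.instance Definition _ :=
  GRing.isSubmodClosed.Build R[i] (H -> H) bounded_linear_pred
    bounded_linear_submod.
HB.instance Definition _ := [SubChoice_isSubLmodule of bounded_operator by <:].

Lemma bounded_linear_id : idfun \in bounded_linear_pred.
Proof. by apply/asboolP; split=> //; exists 1 => x; rewrite mul1r. Qed.

Lemma bounded_linear_comp (A B : bounded_operator) :
  A \o B \in bounded_linear_pred.
Proof.
case: A B => [f /= /asboolP bf] [g /= /asboolP bg]; apply/asboolP; split.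
  by move=> a u v /=; rewrite bg.1 bf.1.
have [M M0 fM] := bounded_linear_ge0 bf.
have [N N0 gN] := bounded_linear_ge0 bg.
exists (M * N) => x /=.
by rewrite (le_trans (fM _))// -mulrA ler_wpM2l.
Qed.

Definition bop_one : bounded_operator := BoundedOperator bounded_linear_id.
Definition bop_mul (A B : bounded_operator) : bounded_operator :=
  BoundedOperator (bounded_linear_comp A B).

Lemma bop_eqP (A B : bounded_operator) : A = B <-> A =1 B.
Proof. by split=> [->//|AB]; apply/val_inj/funext. Qed.

Fact bop_mulA : associative bop_mul.
Proof. by move=> A B C; apply/bop_eqP. Qed.
Fact bop_mul1 : left_id bop_one bop_mul.
Proof. by move=> A; apply/bop_eqP. Qed.
Fact bop_mulr1 : right_id bop_one bop_mul.
Proof. by move=> A; apply/bop_eqP. Qed.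
Fact bop_mulDl : left_distributive bop_mul +%R.
Proof. by move=> A B C; apply/bop_eqP. Qed.
Fact bop_mulDr : right_distributive bop_mul +%R.
Proof.
move=> A B C; apply/bop_eqP => x /=.
have /asboolP[lA _] := bop_funP A.
have /= := lA 1 (B x) (C x); rewrite !scale1r; exact.
Qed.

HB.instance Definition _ := GRing.Zmodule_isPzRing.Build bounded_operator
  bop_mulA bop_mul1 bop_mulr1 bop_mulDl bop_mulDr.

End BoundedOperators.

Notation "''B' ( H )" := (bounded_operator H)
  (at level 8, format "''B' ( H )") : type_scope.

Section Operators.
Variables (R : realType) (H : hilbertType R).
Implicit Types (A E S T U : 'B(H)) (L : set 'B(H)).

(* By the Riesz representation theorem the defining set is a singleton, so the
   default value [0] is never used. *)
Definition adjoint A : 'B(H) :=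
  xget 0 [set B : 'B(H) | forall x y : H, '[A x, y] = '[x, B y]].

Definition isometry U : Prop := forall x : H, `|U x| = `|x|.

Definition coisometry U : Prop := isometry (adjoint U).

Definition orthogonal_projection E : Prop := E * E = E /\ adjoint E = E.

Definition wot_coef A : {ptws (H * H)%type -> R[i]^o} :=
  fun p => '[A p.1, p.2].

(* B(H) with the coarsest topology making every [A |-> '[A x, y]] continuous *)
Definition wot : Type := 'B(H).
HB.instance Definition _ := Topological.copy wot (initial_topology wot_coef).

Definition wot_closed (AA : set 'B(H)) : Prop := closed (AA : set wot).

(* [GRing.subalg_closed] spelt out: the latter is only available over
   nontrivial rings, and B(H) is trivial for H = 0. *)
Definition unital_subalgebra (AA : set 'B(H)) : Prop :=
  [/\ AA 1,
      forall (a : R[i]) A B, AA A -> AA B -> AA (a *: A + B)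
    & forall A B, AA A -> AA B -> AA (A * B)].

Definition partial_factorization (isom : 'B(H) -> Prop)
    (AA : set 'B(H)) : Prop :=
  forall S S' : 'B(H), S * S' = 1 -> S' * S = 1 ->
    exists U : 'B(H), [/\ isom U, AA (adjoint U * S) & AA (S' * U)].

Definition left_partial_factorization := partial_factorization isometry.
Definition right_partial_factorization := partial_factorization coisometry.

Definition Lat (AA : set 'B(H)) : set 'B(H) :=
  [set E | orthogonal_projection E /\
           forall A, AA A -> (1 - E) * A * E = 0].

Definition Alg (L : set 'B(H)) : set 'B(H) :=
  [set A | forall E, L E -> (1 - E) * A * E = 0].

Definition reflexive_algebra (AA : set 'B(H)) : Prop := AA = Alg (Lat AA).

End Operators.

(* Main.v *)
(* A weakly closed unital algebra contains [T] as soon as [T] preserves every closed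
   invariant subspace [M] of every finite power [H^n].  A factorization of an invertible [S]
   transports such an [M]: in the left case an isometry [U] satisfies [S^-1 U M <= M] and
   [S^* U M^perp <= M^perp]; in the right case [W = U^*] satisfies [W S M <= M] and
   [W (S^-1)^* M^perp <= M^perp].  Let [Q] be the projection onto [M].

   Right case.  If [m] in [M] and [y] in [M^perp] satisfy [<m_i, y_j> = nu_i delta_ij] with
   some [nu_i > 0], choosing [S] with [S m_i] proportional to [(S^-1)^* y_i], with any ratio [g > 0],
   yields one nonzero vector for each [g], pairwise orthogonal, contradicting separability.
   Diagonalising [<Q(h e_j), h e_i>] then produces a basis [v_j] of C^n with
   [Q(h (x) v_j) = h_j (x) v_j], so [M] is spanned by elementary tensors and reduces to [n = 1].

   Left case.  A matrix [P] is a type of [M] if [Q (h (x) w)] is close to [h (x) P w] for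
   suitable unit vectors [h].  Taking [S = 1 - t a], near-maximisers of a convex function of the
   [|Q (h (x) w)|^2] turn out to be such vectors, so maximal types exist.  Two types are comparable
   projections: a type incomparable with another one lives on weakly null vectors [r_k], and
   [S = 1 + Y] with [Y t_k = r_k] for a completing orthonormal sequence [t_k] leaves no room for [U h].
   The identity is not a type on the complement of [{h | h (x) C^n <= M}].  Hence some [u <> 0]
   is killed by all types there, so [sum_k conj(u_k) m_k] lies in that set for all [m] in [M],
   and one coordinate can be split off. *)
Require Import Defs.
From HB Require Import structures.
From mathcomp Require Import all_boot all_order all_algebra complex.
From mathcomp Require Import all_classical all_reals topology normedtype.
From mathcomp Require Import sequences measure lebesgue_measure.
From mathcomp Require Import spectral sesquilinear.
From mathcomp Require Import ring lra.

Set Implicit Arguments.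
Unset Strict Implicit.
Unset Printing Implicit Defensive.

Import Order.TTheory GRing.Theory Num.Theory.
Import numFieldNormedType.Exports.

Local Open Scope classical_set_scope.
Local Open Scope ring_scope.
Local Notation Re := complex.Re.
Local Notation Im := complex.Im.
Local Notation "x %:C" := (real_complex _ x) (format "x %:C") : ring_scope.
Local Notation isometry := Defs.isometry.

(** The factor [U] is arbitrary apart from being isometric or co-isometric, and the algebra is not
    assumed self-adjoint, so each factorisation yields just two one-sided constraints, one on [M]
    and one on its complement. Every test operator is designed so that these two constraints already
    restrict where a chosen vector can go. In the right case they can be solved exactly, and the
    ratio is a free real parameter, whence an uncountable family. In the left case [U] need not be
    onto and suprema over the unit sphere need not be attained, so only approximate eigenvectors are
    available and the order of quantifiers carries the proof: constants depend on [M] and on the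
    matrices, tolerances are chosen afterwards. Optimality up to [t^2] is asked for a perturbation
    of size [t], because the gain is of first order and the errors of second order. The orthonormal
    sequences have to be complete, since otherwise the isometry could move a vector off their span.
    The set [hcore] is split off because on it the projection onto [M] acts as the identity, a type
    above all others. *)

Section ComplexParts.
Variable R : realType.
Implicit Types z w : R[i].
Lemma cReD z w : Re (z + w) = Re z + Re w.
Proof. by case: z w => [? ?] [? ?]. Qed.
Lemma cReN z : Re (- z) = - Re z. Proof. by case: z. Qed.
Lemma cReM z w : Re (z * w) = Re z * Re w - Im z * Im w.
Proof. by case: z w => [? ?] [? ?]. Qed.
Lemma cImN z : Im (- z) = - Im z. Proof. by case: z. Qed.
Lemma cImM z w : Im (z * w) = Re z * Im w + Im z * Re w.
Proof. by case: z w => [? ?] [? ?]. Qed.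
Lemma cReJ z : Re z^* = Re z. Proof. by case: z. Qed.
Lemma cImJ z : Im z^* = - Im z. Proof. by case: z. Qed.
Lemma complex_eq z w : Re z = Re w -> Im z = Im w -> z = w.
Proof. by case: z w => [? ?] [? ?] /= -> ->. Qed.
Lemma conjR (r : R) : (r%:C)^* = r%:C. Proof. exact: conjc_real. Qed.
Lemma realC_eq0 (r : R) : (r%:C == 0 :> R[i]) = (r == 0).
Proof. by rewrite eq_complex /= eqxx andbT. Qed.
Lemma cRe_sum I (r : seq I) P (F : I -> R[i]) :
  Re (\sum_(i <- r | P i) F i) = \sum_(i <- r | P i) Re (F i).
Proof. by apply: (big_morph _ cReD). Qed.

Definition sqm z : R := Re z ^+ 2 + Im z ^+ 2.
Lemma sqm_ge0 z : 0 <= sqm z. Proof. by rewrite addr_ge0 ?sqr_ge0. Qed.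
Lemma sqmE z : z * z^* = (sqm z)%:C.
Proof.
by apply: complex_eq; rewrite /sqm ?cReM ?cImM cReJ cImJ /=; ring.
Qed.
Lemma sqm_eq0 z : sqm z = 0 -> z = 0.
Proof.
move=> h; apply: complex_eq => /=; apply/eqP; rewrite -sqrf_eq0; apply/eqP;
  have := sqr_ge0 (Re z); have := sqr_ge0 (Im z); move: h; rewrite /sqm; lra.
Qed.
Lemma sqmJ z : sqm z^* = sqm z. Proof. by rewrite /sqm cReJ cImJ sqrrN. Qed.
Lemma sqmR (r : R) : sqm r%:C = r ^+ 2. Proof. by rewrite /sqm /=; ring. Qed.
Lemma sqmM z w : sqm (z * w) = sqm z * sqm w.
Proof. by rewrite /sqm cReM cImM; ring. Qed.
Definition cmod z : R := Num.sqrt (sqm z).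
Lemma cmod_ge0 z : 0 <= cmod z. Proof. exact: sqrtr_ge0. Qed.
Lemma cmod_sq z : cmod z ^+ 2 = sqm z. Proof. by rewrite sqr_sqrtr ?sqm_ge0. Qed.
Lemma normC_cmod z : `|z| = (cmod z)%:C. Proof. exact: normc_def. Qed.
Lemma Re_le_cmod z : `|Re z| <= cmod z.
Proof.
by rewrite -(ler_pXn2r (n := 2)) ?nnegrE ?cmod_ge0// cmod_sq real_normK ?num_real// /sqm
  lerDl sqr_ge0.
Qed.
Lemma cmodM z w : cmod (z * w) = cmod z * cmod w.
Proof. by rewrite /cmod sqmM sqrtrM ?sqm_ge0. Qed.
Lemma cmodR (r : R) : cmod r%:C = `|r|. Proof. by rewrite /cmod sqmR sqrtr_sqr. Qed.
Lemma cmodD z w : cmod (z + w) <= cmod z + cmod w.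
Proof. by have := ler_normD z w; rewrite !normC_cmod -rmorphD/= lecR. Qed.
End ComplexParts.

(* An abstract inner product, so that [H] and its finite powers share one theory. *)
Record hspace (R : realType) (V : lmodType R[i]) := HSpace {
  ip :> V -> V -> R[i];
  ipDl : forall x y z, ip (x + y) z = ip x z + ip y z;
  ipZl : forall a x z, ip (a *: x) z = a * ip x z;
  ipC : forall x y, ip y x = (ip x y)^*;
  ip_ge0 : forall x, 0 <= Re (ip x x);
  ip_eq0 : forall x, Re (ip x x) = 0 -> x = 0;
  ip_complete : forall u : nat -> V,
    (forall e : R, 0 < e -> exists N, forall m n, (N <= m)%N -> (N <= n)%N ->
       Re (ip (u m - u n) (u m - u n)) <= e) ->
    exists l, forall e : R, 0 < e -> exists N, forall m, (N <= m)%N ->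
       Re (ip (u m - l) (u m - l)) <= e }.

(** * Hilbert space geometry: norms, closed subspaces, orthogonal projections *)

Section HspaceTheory.
Variables (R : realType) (V : lmodType R[i]) (s : hspace V).
Implicit Types (x y z : V) (a b : R[i]).
Local Notation "<< x , y >>" := (ip s x y).

Lemma ipDr x y z : ip s x (y + z) = ip s x y + ip s x z.
Proof. by rewrite ipC ipDl rmorphD/= -!ipC. Qed.
Lemma ipZr a x z : ip s x (a *: z) = a^* * ip s x z.
Proof. by rewrite ipC ipZl rmorphM/= -ipC. Qed.
Lemma ip0l z : ip s 0 z = 0.
Proof. by rewrite -(scale0r z) ipZl mul0r. Qed.
Lemma ip0r z : ip s z 0 = 0. Proof. by rewrite ipC ip0l rmorph0. Qed.
Lemma ipNl x z : ip s (- x) z = - ip s x z.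
Proof. by rewrite -scaleN1r ipZl mulN1r. Qed.
Lemma ipNr x z : ip s x (- z) = - ip s x z.
Proof. by rewrite ipC ipNl rmorphN/= -ipC. Qed.
Lemma ipBl x y z : ip s (x - y) z = ip s x z - ip s y z.
Proof. by rewrite ipDl ipNl. Qed.
Lemma ipBr x y z : ip s x (y - z) = ip s x y - ip s x z.
Proof. by rewrite ipDr ipNr. Qed.
Lemma ip_suml I (r : seq I) P (F : I -> V) z :
  ip s (\sum_(i <- r | P i) F i) z = \sum_(i <- r | P i) ip s (F i) z.
Proof. by apply: (big_morph (fun x => ip s x z)) => [x y|]; rewrite ?ipDl ?ip0l. Qed.
Lemma ip_sumr I (r : seq I) P (F : I -> V) z :
  ip s z (\sum_(i <- r | P i) F i) = \sum_(i <- r | P i) ip s z (F i).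
Proof. by apply: (big_morph (fun x => ip s z x)) => [x y|]; rewrite ?ipDr ?ip0r. Qed.

Definition rip x y : R := Re (ip s x y).
Lemma ripC x y : rip x y = rip y x. Proof. by rewrite /rip ipC cReJ. Qed.
Lemma ripDl x y z : rip (x + y) z = rip x z + rip y z.
Proof. by rewrite /rip ipDl cReD. Qed.
Lemma ripDr x y z : rip x (y + z) = rip x y + rip x z.
Proof. by rewrite /rip ipDr cReD. Qed.
Lemma ripNl x z : rip (- x) z = - rip x z. Proof. by rewrite /rip ipNl cReN. Qed.
Lemma ripNr x z : rip x (- z) = - rip x z. Proof. by rewrite /rip ipNr cReN. Qed.
Lemma rip0l z : rip 0 z = 0. Proof. by rewrite /rip ip0l. Qed.
Lemma rip0r z : rip z 0 = 0. Proof. by rewrite /rip ip0r. Qed.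
Lemma ripZl (r : R) x z : rip (r%:C *: x) z = r * rip x z.
Proof. by rewrite /rip ipZl cReM /=; ring. Qed.
Lemma ripZr (r : R) x z : rip x (r%:C *: z) = r * rip x z.
Proof. by rewrite ripC ripZl ripC. Qed.
Lemma ripZZ a x y : rip (a *: x) (a *: y) = sqm a * rip x y.
Proof. by rewrite /rip ipZl ipZr mulrA sqmE cReM/=; ring. Qed.
Lemma rip_suml I (r : seq I) P (F : I -> V) z :
  rip (\sum_(i <- r | P i) F i) z = \sum_(i <- r | P i) rip (F i) z.
Proof. by rewrite /rip ip_suml cRe_sum. Qed.
Lemma rip_sumr I (r : seq I) P (F : I -> V) z :
  rip z (\sum_(i <- r | P i) F i) = \sum_(i <- r | P i) rip z (F i).
Proof. by rewrite /rip ip_sumr cRe_sum. Qed.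
Definition ripE := (ripDl, ripDr, ripNl, ripNr, ripZl, ripZr, rip0l, rip0r).

Definition n2 x := rip x x.
Lemma n2_ge0 x : 0 <= n2 x. Proof. exact: ip_ge0. Qed.
Lemma n2_eq0 x : n2 x = 0 -> x = 0. Proof. exact: ip_eq0. Qed.
Lemma n2_0 : n2 0 = 0. Proof. exact: rip0l. Qed.
Lemma ipxx x : ip s x x = (n2 x)%:C.
Proof.
apply: complex_eq => //=; have := congr1 (@complex.Im R) (ipC s x x); rewrite cImJ; lra.
Qed.
Lemma n2D x y : n2 (x + y) = n2 x + 2 * rip x y + n2 y.
Proof. by rewrite /n2 !ripE (ripC y x); ring. Qed.
Lemma n2N x : n2 (- x) = n2 x.
Proof. by rewrite /n2 !ripE opprK. Qed.
Lemma n2B x y : n2 (x - y) = n2 x - 2 * rip x y + n2 y.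
Proof. by rewrite n2D n2N !ripE; ring. Qed.
Lemma n2Z a x : n2 (a *: x) = sqm a * n2 x. Proof. exact: ripZZ. Qed.
Lemma n2ZR (r : R) x : n2 (r%:C *: x) = r ^+ 2 * n2 x.
Proof. by rewrite n2Z sqmR. Qed.
Lemma n2_gt0 x : x != 0 -> 0 < n2 x.
Proof.
move=> x0; rewrite lt_def n2_ge0 andbT; apply: contra x0 => /eqP h.
by apply/eqP/n2_eq0.
Qed.

(** The discriminant criterion. For [c > 0] the minimiser [t = - b / c] gives it; for [c = 0] a
    nonzero [b] would make the affine function equal to -1 at the chosen [t]. *)
Lemma quad_nonneg (a b c : R) : 0 <= c ->
  (forall t : R, 0 <= a + 2 * t * b + t ^+ 2 * c) -> b ^+ 2 <= a * c.
Proof.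
move=> c0 h; have [c_0|cn0] := eqVneq c 0.
  rewrite c_0 mulr0; suff -> : b = 0 by rewrite expr0n.
  apply/eqP/negPn/negP => b0.
  have := h (- (a + 1) / (2 * b)); rewrite c_0.
  have -> : a + 2 * (- (a + 1) / (2 * b)) * b + (- (a + 1) / (2 * b)) ^+ 2 * 0 = -1.
    by field; rewrite b0.
  by lra.
have cp : 0 < c by rewrite lt_def cn0.
have := h (- b / c); have -> : a + 2 * (- b / c) * b + (- b / c) ^+ 2 * c = (a * c - b ^+ 2) / c.
  by field.
by rewrite pmulr_lge0 ?invr_gt0// subr_ge0.
Qed.

Lemma CS x y : rip x y ^+ 2 <= n2 x * n2 y.
Proof.
apply: quad_nonneg (n2_ge0 y) _ => t.
by have := n2_ge0 (x + t%:C *: y); rewrite n2D n2ZR !ripE; nra.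
Qed.

(** Rotating [x] by a unimodular scalar turns [<x, y>] into its modulus, which upgrades
    Cauchy-Schwarz for real parts to [CSc]. *)
Lemma ip_phase x y : exists a, sqm a = 1 /\ (ip s (a *: x) y) = (cmod (ip s x y))%:C.
Proof.
have [h|h] := eqVneq (cmod (ip s x y)) 0.
  exists 1; split; first by rewrite /sqm/=; ring.
  by rewrite scale1r h; apply: sqm_eq0; rewrite -cmod_sq h expr0n.
exists ((cmod (ip s x y))^-1%:C * (ip s x y)^*); split.
  by rewrite sqmM sqmR sqmJ -cmod_sq exprVn mulVf// expf_neq0.
rewrite ipZl mulrAC -mulrA sqmE -rmorphM/= -cmod_sq; congr (_%:C).
by field.
Qed.

Definition nr x := Num.sqrt (n2 x).
Lemma nr_ge0 x : 0 <= nr x. Proof. exact: sqrtr_ge0. Qed.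
Lemma nr_sq x : nr x ^+ 2 = n2 x. Proof. by rewrite sqr_sqrtr ?n2_ge0. Qed.
Lemma nr0 : nr 0 = 0. Proof. by rewrite /nr n2_0 sqrtr0. Qed.
Lemma nr_eq0 x : nr x = 0 -> x = 0.
Proof. by move=> h; apply: n2_eq0; rewrite -nr_sq h expr0n. Qed.
Lemma nrZ a x : nr (a *: x) = cmod a * nr x.
Proof. by rewrite /nr n2Z sqrtrM ?sqm_ge0. Qed.
Lemma nrZR (r : R) x : nr (r%:C *: x) = `|r| * nr x.
Proof. by rewrite nrZ cmodR. Qed.
Lemma nrN x : nr (- x) = nr x. Proof. by rewrite /nr n2N. Qed.
Lemma nrBC x y : nr (x - y) = nr (y - x). Proof. by rewrite -nrN opprB. Qed.
Lemma nr_gt0 x : x != 0 -> 0 < nr x.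
Proof. by move=> x0; rewrite sqrtr_gt0 n2_gt0. Qed.
Lemma ler_sq (a b : R) : 0 <= b -> a ^+ 2 <= b ^+ 2 -> a <= b.
Proof. by move=> b0 h; have [//|ba] := leP a b; nra. Qed.
Lemma CSn x y : `|rip x y| <= nr x * nr y.
Proof.
apply: ler_sq; first by rewrite mulr_ge0 ?nr_ge0.
by rewrite real_normK ?num_real// exprMn !nr_sq CS.
Qed.
Lemma rip_le x y : rip x y <= nr x * nr y.
Proof. exact: le_trans (ler_norm _) (CSn _ _). Qed.
Lemma CSc x y : cmod (ip s x y) <= nr x * nr y.
Proof.
have [a [a1 ha]] := ip_phase x y.
have := rip_le (a *: x) y; rewrite /rip ha /= nrZ /cmod a1 sqrtr1 mul1r; exact.
Qed.
Lemma nrD x y : nr (x + y) <= nr x + nr y.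
Proof.
apply: ler_sq; first by rewrite addr_ge0 ?nr_ge0.
by rewrite nr_sq n2D sqrrD !nr_sq; have := rip_le x y; lra.
Qed.
Lemma nrB x y : nr (x - y) <= nr x + nr y.
Proof. by rewrite -(nrN y) nrD. Qed.
Lemma nr_sum I (r : seq I) P (F : I -> V) :
  nr (\sum_(i <- r | P i) F i) <= \sum_(i <- r | P i) nr (F i).
Proof.
elim/big_ind2 : _ => [|x1 x2 y1 y2 h1 h2|//]; first by rewrite nr0.
exact: le_trans (nrD _ _) (lerD h1 h2).
Qed.
Lemma ip_inj x y : (forall z, ip s z x = ip s z y) -> x = y.
Proof.
move=> h; apply/eqP; rewrite -subr_eq0; apply/eqP/n2_eq0.
by rewrite /n2 /rip ipBr h subrr.
Qed.
Lemma rip_inj x y : (forall z, rip z x = rip z y) -> x = y.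
Proof.
move=> h; apply/eqP; rewrite -subr_eq0; apply/eqP/n2_eq0.
by rewrite /n2 ripDr ripNr h subrr.
Qed.

Lemma complete u : (forall e : R, 0 < e -> exists N, forall m n, (N <= m)%N -> (N <= n)%N ->
       nr (u m - u n) <= e) ->
    exists l, forall e : R, 0 < e -> exists N, forall m, (N <= m)%N -> nr (u m - l) <= e.
Proof.
move=> h; have [e e0|l hl] := @ip_complete R V s u.
  have se : 0 < Num.sqrt e by rewrite sqrtr_gt0.
  have [N hN] := h _ se.
  exists N => m n Nm Nn; have := hN m n Nm Nn.
  by rewrite ler_sqrt; [exact | exact: ltW].
exists l => e e0; have [N hN] := hl (e ^+ 2) (exprn_gt0 _ e0).
by exists N => m Nm; apply: ler_sq (ltW e0) _; rewrite nr_sq hN.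
Qed.

Definition lin_set (M : set V) := M 0 /\ forall a x y, M x -> M y -> M (a *: x + y).
Definition cl (M : set V) : set V := [set x | forall e : R, 0 < e -> exists2 m, M m & nr (x - m) <= e].
Definition closed_lin M := lin_set M /\ cl M `<=` M.
Definition perp (M : set V) : set V := [set x | forall m, M m -> ip s m x = 0].

Lemma lin_setZ M a x : lin_set M -> M x -> M (a *: x).
Proof. by move=> [M0 h] Mx; rewrite -[_ *: _]addr0; apply: h. Qed.
Lemma lin_setD M x y : lin_set M -> M x -> M y -> M (x + y).
Proof. by move=> [M0 h] Mx My; rewrite -[x]scale1r; apply: h. Qed.
Lemma lin_setN M x : lin_set M -> M x -> M (- x).
Proof. by move=> h Mx; rewrite -scaleN1r; apply: lin_setZ. Qed.
Lemma lin_setB M x y : lin_set M -> M x -> M y -> M (x - y).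
Proof. by move=> h Mx My; apply: lin_setD => //; apply: lin_setN. Qed.
Lemma lin_set_sum M I (r : seq I) (P : pred I) (F : I -> V) : lin_set M ->
  (forall i, P i -> M (F i)) -> M (\sum_(i <- r | P i) F i).
Proof.
move=> h hF; elim/big_ind : _ => //; first by case: h.
by move=> x y; apply: lin_setD.
Qed.

Lemma sub_cl M : M `<=` cl M.
Proof. by move=> x Mx e e0; exists x => //; rewrite subrr nr0 ltW. Qed.
Lemma cl_cl M : cl (cl M) `<=` cl M.
Proof.
move=> x h e e0; have e2 : 0 < e / 2 by lra.
have [y /(_ _ e2)[z Mz yz] xy] := h _ e2; exists z => //.
have := nrD (x - y) (y - z); rewrite addrA subrK; lra.
Qed.
Lemma cl_lin M : lin_set M -> closed_lin (cl M).
Proof.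
move=> hM; split; last exact: cl_cl.
split; first by apply: sub_cl; case: hM.
move=> a x y hx hy e e0.
have ca : 0 < cmod a + 1 by have := cmod_ge0 a; lra.
have [m Mm xm] := hx (e / 2 / (cmod a + 1)) (divr_gt0 (divr_gt0 e0 (ltr0Sn _ 1)) ca).
have [m' Mm' ym] := hy (e / 2) (divr_gt0 e0 (ltr0Sn _ 1)).
exists (a *: m + m'); first by case: hM => _; exact.
have -> : a *: x + y - (a *: m + m') = a *: (x - m) + (y - m').
  by rewrite scalerBr opprD addrACA.
apply: le_trans (nrD _ _) _; rewrite nrZ.
move: xm; rewrite ler_pdivlMr// => xm.
by have := nr_ge0 (x - m); nra.
Qed.

(** A linear set contains [- i m] along with [m], and the real part of [<- i m, x>] is the imaginary
    part of [<m, x>]. *)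
Lemma perp_rip M x : lin_set M -> (forall m, M m -> rip m x = 0) -> perp M x.
Proof.
move=> hM h m Mm; apply: complex_eq; first exact: h.
have /h := lin_setZ (- 'i%C) hM Mm.
by rewrite /rip ipZl cReM /=; lra.
Qed.
Lemma perp_closed M : closed_lin (perp M).
Proof.
split; first split => [m Mm|a x y hx hy m Mm].
- exact: ip0r.
- by rewrite ipDr ipZr hx// hy// mulr0 addr0.
move=> x h m Mm; apply: sqm_eq0; rewrite -cmod_sq.
suff -> : cmod (ip s m x) = 0 by rewrite expr0n.
apply/eqP; rewrite eq_le cmod_ge0 andbT; apply/ler_addgt0Pl => e e0; rewrite addr0.
have mp : 0 < nr m + 1 by have := nr_ge0 m; lra.
have [y py xy] := h (e / (nr m + 1)) (divr_gt0 e0 mp).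
have -> : ip s m x = ip s m (x - y) by rewrite ipBr py// subr0.
apply: le_trans (CSc _ _) _; move: xy; rewrite ler_pdivlMr// => xy.
by have := nr_ge0 (x - y); nra.
Qed.

Lemma closed_lim M (u : nat -> V) l : cl M `<=` M -> (forall n, M (u n)) ->
  (forall e : R, 0 < e -> exists N, forall m, (N <= m)%N -> nr (u m - l) <= e) -> M l.
Proof.
move=> cM Mu h; apply: cM => e e0; have [N hN] := h e e0.
by exists (u N) => //; rewrite nrBC hN.
Qed.

Lemma parallelogram x y : n2 (x + y) + n2 (x - y) = 2 * n2 x + 2 * n2 y.
Proof. by rewrite n2D n2B; ring. Qed.

(** A minimising sequence for the distance is Cauchy by the parallelogram law; perturbing the
    minimiser [l] to [l - t m] for real [t] yields a quadratic whose discriminant forces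
    orthogonality. *)
Theorem proj_exists M x : closed_lin M -> exists2 m, M m & perp M (x - m).
Proof.
move=> [hM cM].
pose D := [set n2 (x - m) | m in M].
have hD : has_inf D.
  split; first by exists (n2 (x - 0)), 0 => //; case: hM.
  by exists 0 => _ [m _ <-]; exact: n2_ge0.
pose d := inf D.
have dle m : M m -> d <= n2 (x - m).
  by move=> Mm; apply: inf_lbound; [case: hD|exists m].
have ex n : exists m, M m /\ n2 (x - m) <= d + n.+1%:R^-1.
  have n0 : 0 < n.+1%:R^-1 :> R by rewrite invr_gt0.
  have [_ [m Mm <-] hm] := inf_adherent n0 hD.
  by exists m; split=> //; exact: ltW.
have [u hu] := choice ex.
have dist m y : M m -> M y -> n2 (m - y) <= 2 * n2 (x - m) + 2 * n2 (x - y) - 4 * d.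
  move=> Mm My; have := parallelogram (x - m) (x - y).
  have -> : x - m - (x - y) = y - m by rewrite opprB addrC subrKA.
  have -> : x - m + (x - y) = 2%:C *: (x - (2^-1)%:C *: (m + y)).
    rewrite scalerBr scalerA -rmorphM/= mulfV ?pnatr_eq0// scale1r.
    by rewrite rmorph_nat scaler_nat mulr2n opprD addrACA.
  rewrite n2ZR -(n2N (y - m)) opprB.
  have : d <= n2 (x - (2^-1)%:C *: (m + y)).
    by apply: dle; apply: lin_setZ => //; apply: lin_setD.
  by lra.
have [|l hl] := @complete u.
  move=> e e0; have e2 : 0 < e ^+ 2 by rewrite exprn_gt0.
  (* [dist] bounds [|u_m - u_n|^2] by [2 / (m + 1) + 2 / (n + 1)], hence by [4 / (N + 1)]. *)
  have [N hN] : exists N : nat, N.+1%:R^-1 <= e ^+ 2 / 4.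
    exists (Num.truncn ((e ^+ 2 / 4)^-1)).
    rewrite -[leRHS]invrK lef_pV2 ?posrE ?invr_gt0 ?ltr0n ?divr_gt0//.
    by apply/ltW; rewrite truncnS_gt// invr_ge0 divr_ge0// ltW.
  exists N => m n Nm Nn; apply: ler_sq (ltW e0) _; rewrite nr_sq.
  have [Mm um] := hu m; have [Mn un] := hu n.
  have := dist _ _ Mm Mn.
  have : m.+1%:R^-1 <= N.+1%:R^-1 :> R by rewrite lef_pV2 ?posrE ?ltr0n// ler_nat.
  have : n.+1%:R^-1 <= N.+1%:R^-1 :> R by rewrite lef_pV2 ?posrE ?ltr0n// ler_nat.
  move: um un hN; move: (m.+1%:R^-1) (n.+1%:R^-1) (N.+1%:R^-1) => a1 a2 a3.
  by lra.
have Ml : M l by apply: closed_lim cM _ hl => n; case: (hu n).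
exists l => //; apply: perp_rip => // m Mm.
have nle : nr (x - l) <= Num.sqrt d.
  apply/ler_addgt0Pl => e e0.
  have d0 : 0 <= d by apply: lb_le_inf; [case: hD|move=> _ [? _ <-]; exact: n2_ge0].
  have e2 : 0 < (e / 2) ^+ 2 by rewrite exprn_gt0 ?divr_gt0.
  have [N1 h1] := hl (e / 2) (divr_gt0 e0 (ltr0Sn _ 1)).
  have [N2 h2] : exists N : nat, N.+1%:R^-1 <= (e / 2) ^+ 2.
    exists (Num.truncn (((e / 2) ^+ 2)^-1)).
    rewrite -[leRHS]invrK lef_pV2 ?posrE ?invr_gt0 ?ltr0n//.
    by apply/ltW; rewrite truncnS_gt// invr_ge0 ltW.
  pose k := maxn N1 N2.
  have := h1 k (leq_maxl _ _); have [Mk uk] := hu k => hk.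
  have k2 : k.+1%:R^-1 <= N2.+1%:R^-1 :> R.
    by rewrite lef_pV2 ?posrE ?ltr0n// ler_nat ltnS leq_maxr.
  have : nr (x - u k) <= Num.sqrt d + e / 2.
    apply: ler_sq; first by rewrite addr_ge0 ?sqrtr_ge0// divr_ge0 ?ltW.
    rewrite nr_sq sqrrD sqr_sqrtr//; have := sqrtr_ge0 d.
    move: uk h2 k2; move: (k.+1%:R^-1) (N2.+1%:R^-1) => a1 a2.
    by move=> ? ? ? ?; nra.
  have := nrD (x - u k) (u k - l); rewrite addrA subrK; lra.
have d0 : 0 <= d by apply: lb_le_inf; [case: hD|move=> _ [? _ <-]; exact: n2_ge0].
have n2l : n2 (x - l) <= d.
  by rewrite -nr_sq -[leRHS](sqr_sqrtr d0) ler_pXn2r ?nnegrE ?nr_ge0 ?sqrtr_ge0.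
have : rip m (x - l) ^+ 2 <= 0 * n2 m.
  apply: quad_nonneg (n2_ge0 m) _ => t.
  have := dle (l - t%:C *: m) (lin_setB hM Ml (lin_setZ _ hM Mm)).
  have -> : x - (l - t%:C *: m) = (x - l) + t%:C *: m by rewrite opprB addrA addrAC.
  by rewrite n2D n2ZR !ripE (ripC x m) (ripC l m); lra.
by rewrite mul0r => h; apply/eqP; rewrite -sqrf_eq0 eq_le h sqr_ge0.
Qed.

(** For a closed linear [M] the default 0 is never reached, by [proj_exists], and [proj_uniq] makes
    the choice unambiguous. *)
Definition hproj M x : V := xget 0 [set m | M m /\ perp M (x - m)].

Section Proj.
Variable (M : set V).
Hypothesis hM : closed_lin M.
Let lM : lin_set M. Proof. by case: hM. Qed.
Lemma projP x : M (hproj M x) /\ perp M (x - hproj M x).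
Proof.
rewrite /hproj; case: xgetP => [y _ //|].
by have [m Mm pm] := proj_exists x hM => /(_ m); case.
Qed.
Lemma proj_in x : M (hproj M x). Proof. by case: (projP x). Qed.
Lemma proj_perp x : perp M (x - hproj M x). Proof. by case: (projP x). Qed.
Lemma proj_uniq x m : M m -> perp M (x - m) -> hproj M x = m.
Proof.
move=> Mm pm; have [Mp pp] := projP x.
have Md := lin_setB lM Mp Mm.
apply/eqP; rewrite -subr_eq0; apply/eqP/n2_eq0; rewrite /n2 /rip.
have -> : ip s (hproj M x - m) (hproj M x - m) =
  ip s (hproj M x - m) (x - m) - ip s (hproj M x - m) (x - hproj M x).
  by rewrite -ipBr; congr (ip s _ _); rewrite opprB [RHS]addrC subrKA.
by rewrite pm// pp// subr0.
Qed.
Lemma proj_id m : M m -> hproj M m = m.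
Proof. by move=> Mm; apply: proj_uniq => //; rewrite subrr => y _; rewrite ip0r. Qed.
Lemma proj_0 x : perp M x -> hproj M x = 0.
Proof. by move=> h; apply: proj_uniq; [case: lM|rewrite subr0]. Qed.
Lemma proj_lin a x y : hproj M (a *: x + y) = a *: hproj M x + hproj M y.
Proof.
have [_ pl] := perp_closed M.
apply: proj_uniq; first by apply: lM.2; exact: proj_in.
have -> : a *: x + y - (a *: hproj M x + hproj M y) =
  a *: (x - hproj M x) + (y - hproj M y) by rewrite scalerBr opprD addrACA.
by apply: (perp_closed M).1.2; exact: proj_perp.
Qed.
Lemma projD x y : hproj M (x + y) = hproj M x + hproj M y.
Proof. by rewrite -[x in LHS]scale1r proj_lin scale1r. Qed.
Lemma projZ a x : hproj M (a *: x) = a *: hproj M x.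
Proof. by rewrite -[_ *: x]addr0 proj_lin (proj_id lM.1) addr0. Qed.
Lemma projB x y : hproj M (x - y) = hproj M x - hproj M y.
Proof. by rewrite projD -scaleN1r projZ scaleN1r. Qed.
Lemma proj_sum I (r : seq I) P (F : I -> V) :
  hproj M (\sum_(i <- r | P i) F i) = \sum_(i <- r | P i) hproj M (F i).
Proof.
apply: (big_morph (hproj M)) => [x y|]; first exact: projD.
by apply: proj_id; case: lM.
Qed.
Lemma proj_ip x y : ip s (hproj M x) y = ip s x (hproj M y).
Proof.
have h1 : ip s (hproj M x) (y - hproj M y) = 0 by apply: proj_perp; exact: proj_in.
have h2 : ip s (hproj M y) (x - hproj M x) = 0 by apply: proj_perp; exact: proj_in.
move: h1; rewrite ipBr => /eqP; rewrite subr_eq0 => /eqP ->.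
apply/eqP; rewrite -subr_eq0 -ipBl -oppr_eq0 -ipNl opprB ipC h2 rmorph0.
by [].
Qed.
Lemma proj_rip x y : rip (hproj M x) y = rip x (hproj M y).
Proof. by rewrite /rip proj_ip. Qed.
Lemma proj_n2 x : n2 x = n2 (hproj M x) + n2 (x - hproj M x).
Proof.
have := n2D (x - hproj M x) (hproj M x); rewrite subrK => ->.
suff -> : rip (x - hproj M x) (hproj M x) = 0 by ring.
by rewrite ripC /rip (proj_perp x (proj_in x)).
Qed.
Lemma proj_nr x : nr (hproj M x) <= nr x.
Proof. by rewrite ler_wsqrtr// (proj_n2 x) lerDl n2_ge0. Qed.
Lemma projC_nr x : nr (x - hproj M x) <= nr x.
Proof. by rewrite ler_wsqrtr// (proj_n2 x) lerDr n2_ge0. Qed.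
Lemma perp_perp x : perp (perp M) x -> M x.
Proof.
move=> h; have := h _ (proj_perp x) => h1.
suff /eqP : x - hproj M x = 0 by rewrite subr_eq0 => /eqP ->; exact: proj_in.
apply: n2_eq0; rewrite /n2 /rip ipBr h1.
by rewrite ipC (proj_perp x (proj_in x)) rmorph0 subr0.
Qed.
End Proj.

End HspaceTheory.

(** * The Hilbert spaces [H] and [H^n] *)

Section Instances.
Variables (R : realType) (H : hilbertType R).

Lemma hdotDl (x y z : H) : '[x + y, z] = '[x, z] + '[y, z].
Proof. exact: linearDl. Qed.
Lemma hdotZl a (x z : H) : '[a *: x, z] = a * '[x, z].
Proof. exact: linearZl_LR. Qed.
Lemma hdotC (x y : H) : '[y, x] = ('[x, y])^*.
Proof. by rewrite hermC expr0 mul1r. Qed.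
Lemma normE (x : H) : `|x| = (Num.sqrt (Re '[x, x]))%:C.
Proof.
have n0 : 0 <= `|x| by [].
have e : `|x| = (Re `|x|)%:C by apply: complex_eq => //=; exact: ger0_Im.
rewrite -hdot_norm e -rmorphXn/= sqrtr_sqr ger0_norm//.
by move: n0; rewrite e lecR.
Qed.
Lemma hdot_ge0 (x : H) : 0 <= Re '[x, x].
Proof.
rewrite -hdot_norm normE -rmorphXn/=; exact: sqr_ge0.
Qed.
Lemma hdot_eq0 (x : H) : Re '[x, x] = 0 -> x = 0.
Proof. by move=> h; apply/eqP; rewrite -normr_eq0 normE h sqrtr0. Qed.

Lemma hdot_complete (u : nat -> H) :
    (forall e : R, 0 < e -> exists N, forall m n, (N <= m)%N -> (N <= n)%N ->
       Re '[u m - u n, u m - u n] <= e) ->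
    exists l, forall e : R, 0 < e -> exists N, forall m, (N <= m)%N ->
       Re '[u m - l, u m - l] <= e.
Proof.
move=> h.
have posC (e : R[i]) : 0 < e -> exists2 r : R, 0 < r & e = r%:C.
  by case: e => a b; rewrite ltcE /= => /andP[/eqP-> a0]; exists a.
have : cvg (u @ \oo).
  apply/cauchy_cvgP/cauchy_ballP => e e0.
  have [r r0 ->] := posC _ e0.
  (* Half the radius, because [ball] is defined by a strict inequality. *)
  have r2 : 0 < (r / 2) ^+ 2 by rewrite exprn_gt0// divr_gt0.
  have [N hN] := h _ r2.
  rewrite near_map2.
  exists ([set k | (N <= k)%N], [set k | (N <= k)%N]) => /=.
    by split; exists N.
  move=> [m n] [/= Nm Nn]; rewrite -ball_normE /ball_ /= normE ltcR.
  have := hN _ _ Nm Nn; rewrite -(ler_sqrt _ (ltW r2)) sqrtr_sqr ger0_norm; lra.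
case/cvg_ex => l /cvgrPdist_le hl; exists l => e e0.
have se : 0 < (Num.sqrt e)%:C by rewrite ltcR sqrtr_gt0.
have [N _ hN] := hl _ se.
exists N => m Nm; have := hN m Nm; rewrite /= distrC normE lecR ler_sqrt//; exact: ltW.
Qed.

Definition hH : hspace H := HSpace hdotDl hdotZl hdotC hdot_ge0 hdot_eq0 hdot_complete.

Lemma nrH (x : H) : `|x| = (nr hH x)%:C. Proof. exact: normE. Qed.

Section Tuples.
Variable n : nat.
Definition ipn (x y : 'I_n -> H) : R[i] := \sum_i '[x i, y i].
Lemma ipnDl x y z : ipn (x + y) z = ipn x z + ipn y z.
Proof. by rewrite /ipn -big_split/=; apply: eq_bigr => i _; rewrite hdotDl. Qed.
Lemma ipnZl a x z : ipn (a *: x) z = a * ipn x z.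
Proof. by rewrite /ipn mulr_sumr; apply: eq_bigr => i _; rewrite hdotZl. Qed.
Lemma ipnC x y : ipn y x = (ipn x y)^*.
Proof. by rewrite /ipn rmorph_sum; apply: eq_bigr => i _; rewrite hdotC. Qed.
Lemma ipn_ge0 x : 0 <= Re (ipn x x).
Proof. by rewrite cRe_sum sumr_ge0// => i _; exact: hdot_ge0. Qed.
Lemma ipn_eq0 x : Re (ipn x x) = 0 -> x = 0.
Proof.
rewrite cRe_sum => /eqP; rewrite psumr_eq0; last by move=> i _; exact: hdot_ge0.
by move=> /allP h; apply/funext => i; apply/hdot_eq0/eqP/h; rewrite mem_index_enum.
Qed.
Lemma ipn_complete (u : nat -> 'I_n -> H) :
    (forall e : R, 0 < e -> exists N, forall m k, (N <= m)%N -> (N <= k)%N ->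
       Re (ipn (u m - u k) (u m - u k)) <= e) ->
    exists l, forall e : R, 0 < e -> exists N, forall m, (N <= m)%N ->
       Re (ipn (u m - l) (u m - l)) <= e.
Proof.
move=> h.
have coord i : exists l, forall e : R, 0 < e -> exists N, forall m, (N <= m)%N ->
    Re '[u m i - l, u m i - l] <= e.
  apply: (@hdot_complete (fun m => u m i)) => e /h [N hN]; exists N => m k Nm Nk.
  apply: le_trans (hN m k Nm Nk); rewrite cRe_sum (bigD1 i)//= lerDl sumr_ge0//.
  by move=> j _; exact: hdot_ge0.
have [l hl] := choice coord; exists l => e e0.
(* The divisor [n.+1] instead of [n] also covers the empty tuple. *)
have en : 0 < e / n.+1%:R by rewrite divr_gt0.
have cN i : exists N, forall m, (N <= m)%N -> Re '[u m i - l i, u m i - l i] <= e / n.+1%:R.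
  exact: hl.
have [N hN] := choice cN; exists (\max_i N i) => m Nm.
rewrite cRe_sum; apply: (@le_trans _ _ (\sum_(i < n) e / n.+1%:R)).
  by apply: ler_sum => i _; apply: hN; apply: leq_trans Nm; exact: leq_bigmax.
rewrite sumr_const card_ord -[leLHS]mulr_natr mulrAC ler_pdivrMr//.
by rewrite ler_pM2l// ler_nat.
Qed.
Definition hT : hspace ('I_n -> H) :=
  HSpace ipnDl ipnZl ipnC ipn_ge0 ipn_eq0 ipn_complete.

Lemma ipTE x y : ip hT x y = \sum_i ip hH (x i) (y i). Proof. by []. Qed.
Lemma ripTE x y : rip hT x y = \sum_i rip hH (x i) (y i).
Proof. by rewrite /rip ipTE cRe_sum. Qed.
Lemma n2TE x : n2 hT x = \sum_i n2 hH (x i). Proof. exact: ripTE. Qed.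
Lemma n2_coord x i : n2 hH (x i) <= n2 hT x.
Proof. by rewrite n2TE (bigD1 i)//= lerDl sumr_ge0// => j _; exact: n2_ge0. Qed.
Lemma nr_coord x i : nr hH (x i) <= nr hT x.
Proof. by rewrite ler_wsqrtr// n2_coord. Qed.
Lemma nrT_le x : nr hT x <= \sum_i nr hH (x i).
Proof.
apply: ler_sq; first by rewrite sumr_ge0// => i _; exact: nr_ge0.
rewrite nr_sq n2TE expr2 mulr_suml ler_sum// => i _.
rewrite -nr_sq expr2 ler_wpM2l ?nr_ge0// (bigD1 i)//= lerDl sumr_ge0// => j _.
exact: nr_ge0.
Qed.
End Tuples.
End Instances.
Arguments ip : simpl never.
Arguments hH : simpl never.
Arguments hT : simpl never.

(** * Riesz representation, adjoints and the weak operator topology *)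

Section Riesz.
Variables (R : realType) (V : lmodType R[i]) (s : hspace V).

Theorem riesz (f : V -> R[i]) :
  (forall a x y, f (a *: x + y) = a * f x + f y) ->
  (exists c : R, forall x, cmod (f x) <= c * nr s x) ->
  exists z, forall x, f x = ip s x z.
Proof.
move=> lf [c bf].
have f0 : f 0 = 0 by have := lf 1 0 0; rewrite scaler0 addr0 mul1r => /esym/eqP; rewrite -subr_eq0 addrK => /eqP.
have fZ a x : f (a *: x) = a * f x by rewrite -[_ *: _]addr0 lf f0 addr0.
have [|nz] := pselect (forall x, f x = 0); first by exists 0 => x; rewrite ip0r.
have [x fx] : exists x, f x <> 0 by apply/existsNP.
pose K : set V := [set x | f x = 0].
have hK : closed_lin s K.
  split; first by split => // a y z; rewrite /K /= lf => -> ->; rewrite mulr0 addr0.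
  move=> y hy; apply: sqm_eq0; rewrite -cmod_sq.
  suff -> : cmod (f y) = 0 by rewrite expr0n.
  apply/eqP; rewrite eq_le cmod_ge0 andbT; apply/ler_addgt0Pl => e e0; rewrite addr0.
  have cp : 0 < `|c| + 1 by have := normr_ge0 c; lra.
  have [m Km ym] := hy (e / (`|c| + 1)) (divr_gt0 e0 cp).
  have -> : f y = f (y - m) by rewrite -scaleN1r addrC lf Km mulr0 add0r.
  apply: le_trans (bf _) _; move: ym; rewrite ler_pdivlMr// => ym.
  have := nr_ge0 s (y - m); have := ler_norm c; nra.
pose z0 := x - hproj s K x.
have pz : perp s K z0 := proj_perp hK x.
have fz0 : f z0 = f x by rewrite /z0 -scaleN1r addrC lf (proj_in hK x) mulr0 add0r.
have z00 : z0 != 0 by apply: contra_notN fx => /eqP h; rewrite -fz0 h.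
have n0 := n2_gt0 s z00.
(* As [z0] is orthogonal to the kernel, both sides vanish on the kernel; agreement at [z0] fixes the
   scalar. *)
exists ((f z0)^* / (n2 s z0)%:C *: z0) => y.
have := pz (y - (f y / f z0) *: z0).
have fz0' : f z0 != 0 by rewrite fz0; apply/eqP.
have e1 : f (y - (f y / f z0) *: z0) = 0.
  by rewrite -scaleN1r addrC scalerA lf; field.
move=> /(_ e1); rewrite ipBl ipZl ipxx => /eqP; rewrite subr_eq0 => /eqP e.
have nC : (n2 s z0)%:C != 0 :> R[i] by rewrite realC_eq0 gt_eqF.
have -> : ip s y (((f z0)^* / (n2 s z0)%:C) *: z0) = f z0 / (n2 s z0)%:C * ip s y z0.
  by rewrite ipZr rmorphM/= conjCK fmorphV/= conjR.
by rewrite e; field; rewrite fz0'.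
Qed.
End Riesz.

Section Ops.
Variables (R : realType) (H : hilbertType R).
Implicit Types (A B S T U : 'B(H)) (x y z : H).
Notation "<< x , y >>" := (ip (hH H) x y).
Notation nrm := (nr (hH H)).

Lemma bop_lin A (a : R[i]) x y : A (a *: x + y) = a *: A x + A y.
Proof. by have /asboolP[l _] := bop_funP A; exact: l. Qed.
Lemma bopD A x y : A (x + y) = A x + A y.
Proof. by have := bop_lin A 1 x y; rewrite !scale1r. Qed.
Lemma bop0 A : A 0 = 0.
Proof. by have := bopD A 0 0; rewrite addr0 => /esym/eqP; rewrite -subr_eq0 addrK => /eqP. Qed.
Lemma bopZ A (a : R[i]) x : A (a *: x) = a *: A x.
Proof. by rewrite -[_ *: x]addr0 bop_lin bop0 addr0. Qed.
Lemma bopN A x : A (- x) = - A x. Proof. by rewrite -scaleN1r bopZ scaleN1r. Qed.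
Lemma bopB A x y : A (x - y) = A x - A y. Proof. by rewrite bopD bopN. Qed.
Lemma bop_sum A I (r : seq I) (P : pred I) (F : I -> H) :
  A (\sum_(i <- r | P i) F i) = \sum_(i <- r | P i) A (F i).
Proof. by apply: (big_morph A) => [x y|]; [exact: bopD|exact: bop0]. Qed.
Lemma bop_bd A : exists2 c : R, 0 <= c & forall x, nrm (A x) <= c * nrm x.
Proof.
have /asboolP h := bop_funP A; have [M M0 hM] := bounded_linear_ge0 h.
exists (Re M); first by move: M0; rewrite lecE /= => /andP[].
move=> x; have := hM x; rewrite !nrH.
have -> : M = (Re M)%:C by apply: complex_eq => //=; exact: ger0_Im.
by rewrite -rmorphM lecR.
Qed.
Lemma bopDE A B x : (A + B) x = A x + B x. Proof. by []. Qed.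
Lemma bopNE A x : (- A) x = - A x. Proof. by []. Qed.
Lemma bopBE A B x : (A - B) x = A x - B x. Proof. by []. Qed.
Lemma bopZE (a : R[i]) A x : (a *: A) x = a *: A x. Proof. by []. Qed.
Lemma bopME A B x : (A * B) x = A (B x). Proof. by []. Qed.
Lemma bop1E x : (1 : 'B(H)) x = x. Proof. by []. Qed.
Definition bopE := (bopDE, bopNE, bopZE, bopME, bop1E).

Lemma bop_intro (f : H -> H) :
  (forall (a : R[i]) x y, f (a *: x + y) = a *: f x + f y) ->
  (exists c : R, forall x, nrm (f x) <= c * nrm x) ->
  f \in @bounded_linear_pred R H.
Proof.
move=> lf [c bf]; apply/asboolP; split; first exact: lf.
by exists c%:C => x; rewrite !nrH -rmorphM lecR.
Qed.
Definition mkop f lf bf : 'B(H) := BoundedOperator (@bop_intro f lf bf).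

Lemma adjoint_exists A : exists B, forall x y, << A x, y>> = << x, B y>>.
Proof.
have [c c0 bA] := bop_bd A.
have ex y : exists z, forall x, << A x, y>> = << x, z>>.
  apply: (@riesz _ _ (hH H) (fun x => << A x, y>>)) => [a u v|].
    by rewrite bop_lin ipDl ipZl.
  exists (c * nrm y) => x; apply: le_trans (CSc _ _ _) _.
  by rewrite mulrAC ler_wpM2r ?nr_ge0.
have [f hf] := choice ex.
have lf (a : R[i]) x y : f (a *: x + y) = a *: f x + f y.
  by apply: (@ip_inj _ _ (hH H)) => z; rewrite -hf !ipDr !ipZr -!hf.
have bf : exists c : R, forall x, nrm (f x) <= c * nrm x.
  exists c => x.
  have h : n2 (hH H) (f x) <= c * nrm (f x) * nrm x.
    rewrite /n2 {1}/rip -hf; apply: le_trans (rip_le _ _ _) _.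
    by rewrite ler_wpM2r ?nr_ge0.
  have [->|fx0] := eqVneq (f x) 0; first by rewrite nr0 mulr_ge0 ?nr_ge0.
  have fp := nr_gt0 (hH H) fx0.
  by rewrite -(ler_pM2l fp) mulrA (mulrC (nrm _) c) -expr2 nr_sq.
by exists (mkop lf bf) => x y; rewrite hf.
Qed.
Lemma adjE A x y : << A x, y>> = << x, adjoint A y>>.
Proof.
rewrite /adjoint; case: xgetP => [B _ h|]; [exact: h|]; have [B hB] := adjoint_exists A.
by move=> /(_ B).
Qed.
Lemma adjE' A x y : << adjoint A x, y>> = << x, A y>>.
Proof. by rewrite ipC -adjE -ipC. Qed.
Lemma radjE A x y : rip (hH H) (A x) y = rip (hH H) x (adjoint A y).
Proof. by rewrite /rip adjE. Qed.
Lemma adj_uniq A B : (forall x y, << A x, y>> = << x, B y>>) -> adjoint A = B.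
Proof.
by move=> h; apply/bop_eqP => y; apply: (@ip_inj _ _ (hH H)) => x; rewrite -adjE h.
Qed.
Lemma adjK A : adjoint (adjoint A) = A.
Proof. by apply: adj_uniq => x y; rewrite adjE'. Qed.

Section Amp.
Variable n : nat.
Implicit Types X Y : 'I_n -> H.
Definition amp A X : 'I_n -> H := fun i => A (X i).
Lemma ampD A X Y : amp A (X + Y) = amp A X + amp A Y.
Proof. by apply/funext => i; exact: bopD. Qed.
Lemma ampB A X Y : amp A (X - Y) = amp A X - amp A Y.
Proof. by apply/funext => i; exact: bopB. Qed.
Lemma amp_bd A c : (forall x, nrm (A x) <= c * nrm x) -> 0 <= c ->
  forall X, nr (hT H n) (amp A X) <= c * nr (hT H n) X.
Proof.
move=> h c0 X; apply: ler_sq; first by rewrite mulr_ge0 ?nr_ge0.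
rewrite exprMn !nr_sq !n2TE mulr_sumr ler_sum// => i _.
by rewrite -!nr_sq -exprMn ler_pXn2r ?nnegrE ?mulr_ge0 ?nr_ge0//; exact: h.
Qed.
Lemma amp_adj A X Y : ip (hT H n) (amp A X) Y = ip (hT H n) X (amp (adjoint A) Y).
Proof. by rewrite !ipTE; apply: eq_bigr => i _; rewrite adjE. Qed.
Lemma ampM A B X : amp (A * B) X = amp A (amp B X). Proof. by []. Qed.
Definition ainv (AA : set 'B(H)) (M : set ('I_n -> H)) :=
  forall A X, AA A -> M X -> M (amp A X).
End Amp.

(** For a finite tuple [X], the closure of its orbit under [AA] is an invariant subspace of [H^n]
    that contains [X], because [1] is in [AA]. It therefore contains [amp T X], so some element of
    [AA] is close to [T] at all the chosen vectors. This strong approximation implies membership in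
    the weak closure. *)
Theorem wot_reduction (AA : set 'B(H)) T :
  unital_subalgebra AA -> wot_closed AA ->
  (forall n (M : set ('I_n -> H)), closed_lin (hT H n) M -> ainv AA M ->
     forall X, M X -> M (amp T X)) -> AA T.
Proof.
move=> [AA1 AAl AAm] cAA hT0.
(* The filter generated by the traces on [AA] of the strong neighbourhoods of [T]. *)
pose F : set_system 'B(H) := [set N | exists (s : seq H) (e : R), 0 < e /\
  forall A, AA A -> (forall x, x \in s -> nrm (A x - T x) <= e) -> N A].
have FF : Filter F.
  split.
  - by exists [::], 1.
  - move=> P Q [s [e [e0 hP]]] [s' [e' [e0' hQ]]].
    exists (s ++ s'), (Num.min e e'); split; first by rewrite lt_min e0.
    move=> A AAA hA; split.
      apply: hP => // x xs; have := hA x; rewrite mem_cat xs => /(_ isT).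
      by rewrite le_min => /andP[].
    apply: hQ => // x xs; have := hA x; rewrite mem_cat xs orbT => /(_ isT).
    by rewrite le_min => /andP[].
  - move=> P Q PQ [s [e [e0 hP]]]; exists s, e; split=> // A AAA hA.
    by apply: PQ; exact: hP.
have PF : ProperFilter F.
  split=> // -[s [e [e0 he]]].
  pose n := size s; pose X : 'I_n -> H := fun i => s`_i.
  pose M0 : set ('I_n -> H) := [set amp A X | A in AA].
  have lM0 : lin_set M0.
    have h (a : R[i]) (x y : 'I_n -> H) : M0 x -> M0 y -> M0 (a *: x + y).
      by move=> [A AAA <-] [B AAB <-]; exists (a *: A + B) => //; exact: AAl.
    split=> //; exists 0; last by apply/funext.
    have := AAl (-1) 1 1 AA1 AA1; rewrite scaleN1r addNr; exact.
  have cM := @cl_lin _ _ (hT H n) _ lM0.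
  have iM : ainv AA (cl (hT H n) M0).
    move=> A x AAA hx e1 e10.
    have [c c0 bA] := bop_bd A.
    have cp : 0 < c + 1 by lra.
    have [_ [B AAB <-] xB] := hx (e1 / (c + 1)) (divr_gt0 e10 cp).
    exists (amp A (amp B X)); first by exists (A * B) => //; exact: AAm.
    rewrite -ampB; apply: le_trans (amp_bd bA c0 _) _.
    move: xB; rewrite ler_pdivlMr//; have := nr_ge0 (hT H n) (x - amp B X); nra.
  have MX : cl (hT H n) M0 X by apply: sub_cl; exists 1.
  have [_ [A AAA <-] hA] := hT0 n _ cM iM X MX e e0.
  apply: (he A) => // x xs.
  have xi : (index x s < n)%N by rewrite index_mem.
  have := nr_coord (amp T X - amp A X) (Ordinal xi).
  rewrite !fctE /amp /X /= nth_index// => h; rewrite nrBC.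
  exact: le_trans h hA.
have FAA : F AA by exists [::], 1; split.
have cF : F --> (T : wot H).
  move=> N; rewrite nbhsE => -[B [[C Cop <-] CT] BN].
  have : (@wot_coef R H @ F) --> (wot_coef T : {ptws (H * H)%type -> R[i]^o}).
    apply/pointwise_cvgP => -[x y]; apply/cvgrPdist_le => e e0.
    have [r r0 ->] : exists2 r : R, 0 < r & e = r%:C.
      by move: e0; case: (e) => a b; rewrite ltcE /= => /andP[/eqP-> a0]; exists a.
    have yp : 0 < nrm y + 1 by have := nr_ge0 (hH H) y; lra.
    exists [:: x], (r / (nrm y + 1)); split; first by rewrite divr_gt0.
    move=> A AAA /(_ x); rewrite inE eqxx => /(_ isT) h.
    rewrite /wot_coef /= -[hdot (T x) y]/(<< T x, y>>) -[hdot (A x) y]/(<< A x, y>>).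
    rewrite distrC -ipBl normC_cmod lecR; apply: le_trans (CSc _ _ _) _.
    move: h; rewrite ler_pdivlMr//; have := nr_ge0 (hH H) (A x - T x); nra.
  move=> /(_ C) h; have : F (@wot_coef R H @^-1` C) by apply: h; apply: open_nbhs_nbhs.
  by apply: filterS => A; exact: BN.
have : closure (AA : set (wot H)) T.
  rewrite closureEcvg; exists F => //; split=> // P AP.
  by apply: filterS FAA => A; exact: AP.
exact: cAA.
Qed.
End Ops.

(** * Invariant subspaces of [H^n], rank-one operators and elementary tensors *)

Section Tools.
Variables (R : realType) (H : hilbertType R).
Implicit Types (A B S T U : 'B(H)) (x y z : H) (AA : set 'B(H)).
Notation "<< x , y >>" := (ip (hH H) x y).
Notation nrm := (nr (hH H)).

Lemma bop_adjM A B : adjoint (A * B) = adjoint B * adjoint A.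
Proof. by apply: adj_uniq => x y; rewrite !bopE !adjE. Qed.
Lemma bop_adj1 : adjoint (1 : 'B(H)) = 1.
Proof. by apply: adj_uniq. Qed.
Lemma bop_adjD A B : adjoint (A + B) = adjoint A + adjoint B.
Proof. by apply: adj_uniq => x y; rewrite !bopE ipDl ipDr !adjE. Qed.
Lemma bop_adjZ (a : R[i]) A : adjoint (a *: A) = a^* *: adjoint A.
Proof. by apply: adj_uniq => x y; rewrite !bopE ipZl ipZr conjCK adjE. Qed.
Lemma bop_adjN A : adjoint (- A) = - adjoint A.
Proof. by apply: adj_uniq => x y; rewrite !bopE ipNl ipNr adjE. Qed.

Lemma isom_nr U : isometry U -> forall x, nrm (U x) = nrm x.
Proof. by move=> h x; have := h x; rewrite !nrH => /complexI. Qed.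
Lemma isom_ip U : isometry U -> forall x y, << U x, U y>> = << x, y>>.
Proof.
move=> h.
have hn x : n2 (hH H) (U x) = n2 (hH H) x by rewrite -!nr_sq isom_nr.
have hr x y : rip (hH H) (U x) (U y) = rip (hH H) x y.
  have := hn (x + y); rewrite bopD !n2D !hn; lra.
move=> x y; apply: complex_eq; first exact: hr.
have := hr ((- 'i%C) *: x) y.
by rewrite /rip bopZ !ipZl !cReM /=; lra.
Qed.

Lemma amp_perp n (M : set ('I_n -> H)) A :
  (forall X, M X -> M (amp A X)) ->
  forall Y, perp (hT H n) M Y -> perp (hT H n) M (amp (adjoint A) Y).
Proof. by move=> h Y hY X MX; rewrite -amp_adj; apply: hY; exact: h. Qed.

(** The two members of [AA] preserve [M] and their adjoints preserve its complement. The second and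
    third clauses, where [U] acts first on a vector, serve the case of an isometry; the first and
    fourth, where [adjoint U] acts last, serve the case of a co-isometry. *)
Lemma pfp_transport (isom : 'B(H) -> Prop) AA S S' :
  partial_factorization isom AA -> S * S' = 1 -> S' * S = 1 ->
  exists2 U, isom U & forall n (M : set ('I_n -> H)), ainv AA M ->
    [/\ forall X, M X -> M (amp (adjoint U * S) X),
        forall X, M X -> M (amp (S' * U) X),
        forall Y, perp (hT H n) M Y -> perp (hT H n) M (amp (adjoint S * U) Y)
      & forall Y, perp (hT H n) M Y -> perp (hT H n) M (amp (adjoint U * adjoint S') Y)].
Proof.
move=> h SS' S'S; have [U [iU h1 h2]] := h S S' SS' S'S; exists U => // n M iM.
have m1 X : M X -> M (amp (adjoint U * S) X) by apply: iM.
have m2 X : M X -> M (amp (S' * U) X) by apply: iM.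
split=> // Y MY; last by have := amp_perp m2 MY; rewrite bop_adjM.
by have := amp_perp m1 MY; rewrite bop_adjM adjK.
Qed.

Section ProjOp.
Variable (E : set H).
Hypothesis hE : closed_lin (hH H) E.
Lemma projop_ex : exists P : 'B(H), forall x, P x = hproj (hH H) E x.
Proof.
have l (a : R[i]) x y : hproj (hH H) E (a *: x + y) = a *: hproj (hH H) E x + hproj (hH H) E y.
  exact: proj_lin.
have b : exists c : R, forall x, nrm (hproj (hH H) E x) <= c * nrm x.
  by exists 1 => x; rewrite mul1r proj_nr.
by exists (mkop l b).
Qed.
End ProjOp.

(** Membership in [Alg (Lat AA)] phrased with closed subspaces instead of projections, the form that
    both cases use. *)
Definition lat_inv AA T := forall E : set H, closed_lin (hH H) E ->
  (forall A, AA A -> forall x, E x -> E (A x)) -> forall x, E x -> E (T x).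

Lemma alglat_inv AA T : Alg (Lat AA) T -> lat_inv AA T.
Proof.
move=> hT E hE iE x Ex.
have [P hP] := projop_ex hE.
have LP : Lat AA P.
  split; first split.
  - by apply/bop_eqP => y; rewrite !bopE !hP; apply: proj_id => //; exact: proj_in.
  - by apply: adj_uniq => y z; rewrite !hP; exact: proj_ip.
  move=> A AAA; apply/bop_eqP => y; rewrite mulrBl mul1r mulrBl !bopE !hP.
  apply/eqP; rewrite subr_eq0; apply/eqP/esym/proj_id => //; apply: iE => //.
  exact: proj_in.
have /bop_eqP/(_ x) := hT P LP.
rewrite mulrBl mul1r mulrBl !bopE !hP (proj_id hE Ex) => /eqP; rewrite subr_eq0 => /eqP ->.
exact: proj_in.
Qed.
Lemma sub_alglat AA : AA `<=` Alg (Lat AA).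
Proof. by move=> A AAA E [_]; apply. Qed.

Lemma reflexive_reduction AA : unital_subalgebra AA -> wot_closed AA ->
  (forall T, lat_inv AA T -> forall n (M : set ('I_n -> H)), closed_lin (hT H n) M ->
     ainv AA M -> forall X, M X -> M (amp T X)) ->
  AA = Alg (Lat AA).
Proof.
move=> uA cA h; apply/seteqP; split=> T; first exact: sub_alglat.
by move=> /alglat_inv hT; apply: wot_reduction => // n M cM iM X; exact: h.
Qed.

Section Rk1.
Variables u v : H.
Lemma rk1_lin (a : R[i]) x y : << a *: x + y, v>> *: u = a *: (<< x, v>> *: u) + << y, v>> *: u.
Proof. by rewrite ipDl ipZl scalerDl scalerA. Qed.
Lemma rk1_bd : exists c : R, forall x, nrm (<< x, v>> *: u) <= c * nrm x.
Proof.
exists (nrm v * nrm u) => x; rewrite nrZ mulrAC ler_wpM2r ?nr_ge0//.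
by rewrite mulrC CSc.
Qed.
Definition rk1 : 'B(H) := mkop rk1_lin rk1_bd.
Lemma rk1E x : rk1 x = << x, v>> *: u. Proof. by []. Qed.
End Rk1.
Lemma rk1_adj u v : adjoint (rk1 u v) = rk1 v u.
Proof. by apply: adj_uniq => x y; rewrite !rk1E ipZl ipZr -ipC mulrC. Qed.
(** The Sherman-Morrison formula for a rank-one perturbation of the identity. *)
Lemma rk1_inv u v (t : R[i]) : t * (1 + << u, v>>) = 1 ->
  (1 + rk1 u v) * (1 - t *: rk1 u v) = 1 /\ (1 - t *: rk1 u v) * (1 + rk1 u v) = 1.
Proof.
move=> ht.
have e0 x : (<< x, v>> - t * << x, v>> - t * << x, v>> * << u, v>>) *: u = 0.
  have -> : << x, v>> - t * << x, v>> - t * << x, v>> * << u, v>> =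
     << x, v>> * (1 - t * (1 + << u, v>>)) by ring.
  by rewrite ht subrr mulr0 scale0r.
split; apply/bop_eqP => x; rewrite !bopE !rk1E.
  rewrite ipBl !ipZl scalerA -addrA -scaleNr -scalerDl -[RHS]addr0 -[X in _ = _ + X](e0 x).
  by congr (_ + _ *: _); ring.
rewrite ipDl !ipZl scalerA -addrA -scaleNr -scalerDl -[RHS]addr0 -[X in _ = _ + X](e0 x).
by congr (_ + _ *: _); ring.
Qed.

Section Tens.
Variable n : nat.
Implicit Types (w v : 'I_n -> R[i]) (X Y : 'I_n -> H).
Definition tens x w : 'I_n -> H := fun i => w i *: x.
(** The adjoint of [x |-> tens x w], hence the conjugates; [cip] is the inner product of [C^n],
    linear in its first argument. *)
Definition slice w X : H := \sum_i (w i)^* *: X i.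
Definition cip w v : R[i] := \sum_i w i * (v i)^*.
Definition c2 w : R := \sum_i sqm (w i).
Lemma tensDl x y w : tens (x + y) w = tens x w + tens y w.
Proof. by apply/funext => i; exact: scalerDr. Qed.
Lemma tensBl x y w : tens (x - y) w = tens x w - tens y w.
Proof. by apply/funext => i; exact: scalerBr. Qed.
Lemma tensZl (a : R[i]) x w : tens (a *: x) w = a *: tens x w.
Proof. by apply/funext => i; rewrite /tens scalerA mulrC -scalerA. Qed.
Lemma tens0l w : tens 0 w = 0.
Proof. by apply/funext => i; exact: scaler0. Qed.
Lemma tensZr (a : R[i]) x w : tens x (a *: w) = a *: tens x w.
Proof. by apply/funext => i; exact: esym (scalerA _ _ _). Qed.
Lemma tensDr x w v : tens x (w + v) = tens x w + tens x v.
Proof. by apply/funext => i; exact: scalerDl. Qed.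
Lemma tens_sumr x I (r : seq I) (P : pred I) (F : I -> 'I_n -> R[i]) :
  tens x (\sum_(i <- r | P i) F i) = \sum_(i <- r | P i) tens x (F i).
Proof.
apply: (big_morph (tens x)) => [w v|]; first exact: tensDr.
by apply/funext => i; exact: scale0r.
Qed.
Lemma amp_tens A x w : amp A (tens x w) = tens (A x) w.
Proof. by apply/funext => i; exact: bopZ. Qed.
Lemma amp_slice A w X : slice w (amp A X) = A (slice w X).
Proof. by rewrite /slice bop_sum; apply: eq_bigr => i _; rewrite bopZ. Qed.
Lemma ip_tens X x w : ip (hT H n) X (tens x w) = << slice w X, x>>.
Proof. by rewrite ipTE /slice ip_suml; apply: eq_bigr => i _; rewrite ipZr ipZl. Qed.
Lemma ip_tens' X x w : ip (hT H n) (tens x w) X = << x, slice w X>>.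
Proof. by rewrite ipC ip_tens -ipC. Qed.
Lemma slice_tens v x w : slice v (tens x w) = cip w v *: x.
Proof.
by rewrite /slice /cip scaler_suml; apply: eq_bigr => i _; rewrite /tens scalerA mulrC.
Qed.
Lemma sliceD w X Y : slice w (X + Y) = slice w X + slice w Y.
Proof. by rewrite /slice -big_split/=; apply: eq_bigr => i _; rewrite scalerDr. Qed.
Lemma sliceZ w (a : R[i]) X : slice w (a *: X) = a *: slice w X.
Proof.
by rewrite /slice scaler_sumr; apply: eq_bigr => i _; rewrite -[(a *: X) i]/(a *: X i) !scalerA mulrC.
Qed.
Lemma sliceB w X Y : slice w (X - Y) = slice w X - slice w Y.
Proof. by rewrite sliceD -scaleN1r sliceZ scaleN1r. Qed.
Lemma c2_ge0 w : 0 <= c2 w.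
Proof. by rewrite sumr_ge0// => i _; exact: sqm_ge0. Qed.
Lemma n2_tens x w : n2 (hT H n) (tens x w) = c2 w * n2 (hH H) x.
Proof. by rewrite n2TE mulr_suml; apply: eq_bigr => i _; rewrite n2Z. Qed.
Lemma nr_tens x w : nr (hT H n) (tens x w) = Num.sqrt (c2 w) * nrm x.
Proof. by rewrite /nr n2_tens sqrtrM// c2_ge0. Qed.
Lemma cipxx w : cip w w = (c2 w)%:C.
Proof. by rewrite /cip /c2 rmorph_sum; apply: eq_bigr => i _; rewrite sqmE. Qed.
Definition dl (k : 'I_n) : 'I_n -> R[i] := fun i => (i == k)%:R.
Lemma slice_dl k X : slice (dl k) X = X k.
Proof.
rewrite /slice (bigD1 k)//= big1 => [|i ik]; rewrite /dl.
  by rewrite addr0 eqxx rmorph1 scale1r.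
by rewrite (negbTE ik) rmorph0 scale0r.
Qed.
Lemma tuple_sum X : X = \sum_k tens (X k) (dl k).
Proof.
apply/funext => i; rewrite fct_sumE (bigD1 i)//= big1 => [|k ki]; rewrite /tens /dl.
  by rewrite addr0 eqxx scale1r.
by rewrite eq_sym (negbTE ki) scale0r.
Qed.
Lemma vec_sum w : w = \sum_k w k *: dl k.
Proof.
apply/funext => i; rewrite fct_sumE (bigD1 i)//= big1 => [|k ki].
  by rewrite addr0 -[(w i *: dl i) i]/(w i * dl i i) /dl eqxx mulr1.
by rewrite -[(w k *: dl k) i]/(w k * dl k i) /dl eq_sym (negbTE ki) mulr0.
Qed.
Lemma nr_slice w X : nrm (slice w X) <= Num.sqrt (c2 w) * nr (hT H n) X.
Proof.
have h : n2 (hH H) (slice w X) <= nr (hT H n) X * (Num.sqrt (c2 w) * nrm (slice w X)).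
  rewrite /n2 /rip -ip_tens; apply: le_trans (rip_le _ _ _) _.
  by rewrite nr_tens.
have [->|s0] := eqVneq (slice w X) 0.
  by rewrite nr0 mulr_ge0 ?nr_ge0 ?sqrtr_ge0.
rewrite -(ler_pM2r (nr_gt0 (hH H) s0)) -expr2 nr_sq; apply: le_trans h _.
by rewrite mulrA (mulrC (nr _ _)).
Qed.

Variables (AA : set 'B(H)) (M : set ('I_n -> H)).
Hypotheses (cM : closed_lin (hT H n) M) (iM : ainv AA M).
Definition Eset w : set H := [set x | M (tens x w)].
Lemma Eset_closed w : closed_lin (hH H) (Eset w).
Proof.
split; first split.
- by rewrite /Eset /= tens0l; case: cM => -[].
- by move=> a x y hx hy; rewrite /Eset /= tensDl tensZl; apply: cM.1.2.
move=> x hx; apply: cM.2 => e e0.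
have cp : 0 < Num.sqrt (c2 w) + 1 by have := sqrtr_ge0 (c2 w); lra.
have [y Ey xy] := hx (e / (Num.sqrt (c2 w) + 1)) (divr_gt0 e0 cp).
exists (tens y w) => //; rewrite -tensBl nr_tens.
move: xy; rewrite ler_pdivlMr// => xy; have := nr_ge0 (hH H) (x - y); nra.
Qed.
Lemma Eset_inv w A : AA A -> forall x, Eset w x -> Eset w (A x).
Proof. by move=> AAA x hx; rewrite /Eset /= -amp_tens; apply: iM. Qed.
End Tens.
End Tools.

(** * Orthogonal families in a separable space *)

Section Separable.
Variables (R : realType) (H : hilbertType R).
Notation nrm := (nr (hH H)).

Lemma dense_seq : separable H -> exists d : nat -> H, forall x (e : R), 0 < e ->
  exists k, nrm (x - d k) < e.
Proof.
move=> [D [/countable_injP[h hinj] dD]].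
(* [h] is injective on [D], so an index determines its point; indices outside the image receive the
   harmless default 0. *)
exists (fun k => xget 0 [set x | D x /\ h x = k]) => x e e0.
have eC : 0 < e%:C by rewrite ltcR.
have [|z [xz Dz]] := dD (ball x e%:C) _ (ball_open x e%:C).
  by exists x; exact: ballxx.
exists (h z); case: xgetP => [z' _ [Dz' hz]|/(_ z)]; last by case.
have -> : z' = z by apply: hinj => //; exact: mem_set.
by move: xz; rewrite -ball_normE /ball_ /= nrH ltcR.
Qed.

Lemma no_orth_family n (f : R -> 'I_n -> H) : separable H ->
  (forall g : R, 0 < g -> f g != 0) ->
  (forall g g' : R, 0 < g -> 0 < g' -> g != g' -> ip (hT H n) (f g) (f g') = 0) -> False.
Proof.
move=> /dense_seq [d hd] f0 forth.
have ex (g : R) : exists c : 'I_n -> nat, 0 < g -> nr (hT H n) (f g - ((fun i => d (c i)) : 'I_n -> H)) < nr (hT H n) (f g) / 2.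
  have [g0|g0] := pselect (0 < g); last by exists (fun=> 0%N).
  have np := nr_gt0 (hT H n) (f0 g g0).
  have ep : 0 < nr (hT H n) (f g) / 2 / n.+1%:R by rewrite !divr_gt0.
  have exi i : exists k, nrm (f g i - d k) < nr (hT H n) (f g) / 2 / n.+1%:R by exact: hd.
  have [c hc] := choice exi; exists c => _; apply: le_lt_trans (nrT_le _) _.
  apply: (@le_lt_trans _ _ (\sum_(i < n) nr (hT H n) (f g) / 2 / n.+1%:R)).
    by apply: ler_sum => i _; apply/ltW; exact: hc.
  rewrite sumr_const card_ord -[ltLHS]mulr_natr mulrAC ltr_pdivrMr//.
  by rewrite ltr_pM2l ?divr_gt0// ltr_nat.
have [c hc] := choice ex.
(* Two members sharing an approximant would be at distance below [(a + b) / 2], where [a] and [b]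
   are their norms, whereas orthogonality makes the squared distance [a^2 + b^2]. *)
have cinj : {in ([set` `]0, 1[] : set R) &, injective (fun g : R => pickle [ffun i => c g i])}.
  move=> g g'; rewrite !inE /= !in_itv /= => /andP[g0 _] /andP[g0' _].
  move=> /(pcan_inj pickleK) /ffunP ec; apply/eqP/negPn/negP => gg'.
  have {}ec : c g = c g' by apply/funext => i; have := ec i; rewrite !ffunE.
  have := hc g g0; have := hc g' g0'; rewrite -ec => h' h.
  have := nrB (hT H n) (f g - ((fun i => d (c g i)) : 'I_n -> H)) (f g' - ((fun i => d (c g i)) : 'I_n -> H)).
  rewrite opprB addrA subrK => h2.
  have : n2 (hT H n) (f g - f g') = n2 (hT H n) (f g) + n2 (hT H n) (f g').
    by rewrite n2B /rip forth//= mulr0 subr0.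
  rewrite -!nr_sq => hz.
  have a0 := nr_ge0 (hT H n) (f g); have b0 := nr_ge0 (hT H n) (f g').
  have z0 := nr_ge0 (hT H n) (f g - f g').
  have zl : nr (hT H n) (f g - f g') < (nr (hT H n) (f g) + nr (hT H n) (f g')) / 2 by lra.
  move: hz zl z0 a0 b0; move: (nr _ (f g - f g')) (nr _ (f g)) (nr _ (f g')) => z a b *.
  have : z ^+ 2 < ((a + b) / 2) ^+ 2 by rewrite ltr_pXn2r ?nnegrE//; lra.
  by have := sqr_ge0 (a - b); nra.
have cI : countable ([set` `]0, 1[] : set R) by apply/countable_injP; eexists; exact: cinj.
(* The interval is uncountable since its Lebesgue measure is 1. *)
have := countable_lebesgue_measure0 cI.
rewrite lebesgue_measure_itv /= lte_fin ltr01 oppr0 adde0 => /eqP.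
by rewrite eqe oner_eq0.
Qed.
End Separable.

(** * The right factorization property *)

Section Right.
Variables (R : realType) (H : hilbertType R).
Implicit Types (A B S T U : 'B(H)) (x y z : H) (AA : set 'B(H)).
Notation "<< x , y >>" := (ip (hH H) x y).
Notation nrm := (nr (hH H)).

(* one step of [biorth_equalizer]: both sides are mapped to the same multiple of [z / |z|] *)
Lemma biorth_equalizer1 x z (a : R) : 0 < a -> << x, z>> = a%:C ->
  exists S S', [/\ S * S' = 1, S' * S = 1, S x = adjoint S' z
    & forall p, << x, p>> = 0 -> << p, z>> = 0 -> S p = p /\ adjoint S' p = p].
Proof.
move=> a0 xz.
have z0 : z != 0.
  by apply/eqP => z0; move: xz; rewrite z0 ip0r => /complexI a00; rewrite -a00 ltxx in a0.
have N0 := nr_gt0 (hH H) z0; set N := nrm z in N0.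
pose b := Num.sqrt a.
have b0 : 0 < b by rewrite sqrtr_gt0.
have b2 : b * b = a by rewrite -expr2 sqr_sqrtr// ltW.
have NC : N%:C != 0 :> R[i] by rewrite realC_eq0 gt_eqF.
have bC : b%:C != 0 :> R[i] by rewrite realC_eq0 gt_eqF.
(* [1 + rk1 g e] sends the unit vector [e] to [x / b], so its inverse sends [x] to [b e]. Its
   adjoint sends [z = N e] to [b e] too, since [<z, g> = b - N]; the last equality is what fixes [b]
   as the root of [a]. *)
pose e := (N^-1)%:C *: z; pose g := (b^-1)%:C *: x - e.
have zz : << z, z>> = N%:C * N%:C by rewrite ipxx -nr_sq expr2 rmorphM.
have ge : << g, e>> = b%:C / N%:C - 1.
  rewrite /g /e ipBl !ipZl !ipZr !conjR xz zz -b2 !rmorphM/= !fmorphV/=.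
  by field; rewrite NC.
have t1 : (N%:C / b%:C) * (1 + << g, e>>) = 1 by rewrite ge; field; rewrite NC.
have [i1 i2] := rk1_inv t1.
exists (1 - (N%:C / b%:C) *: rk1 g e), (1 + rk1 g e); split=> //.
  rewrite bop_adjD bop_adj1 rk1_adj !bopE !rk1E.
  have -> : << x, e>> = b%:C * b%:C / N%:C.
    by rewrite /e ipZr conjR xz -b2 rmorphM/= fmorphV/= mulrC.
  have -> : << z, g>> = b%:C - N%:C.
    rewrite /g /e ipBr !ipZr !conjR (ipC (hH H) x z) xz zz conjR -b2 !rmorphM/= !fmorphV/=.
    by field; rewrite NC.
  have -> : (N%:C / b%:C) *: ((b%:C * b%:C / N%:C) *: g) = b%:C *: g.
    by rewrite scalerA; congr (_ *: _); field; rewrite NC.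
  rewrite /g scalerBr scalerA -rmorphM/= mulfV ?gt_eqF// scale1r opprB addrC subrK.
  rewrite /e scalerBl [X in _ = z + (_ - X)]scalerA -rmorphM/= mulfV ?gt_eqF// scale1r.
  by rewrite addrC subrK.
move=> p xp pz; rewrite bop_adjD bop_adj1 rk1_adj !bopE !rk1E.
have -> : << p, e>> = 0 by rewrite /e ipZr pz mulr0.
have -> : << p, g>> = 0.
  by rewrite /g /e ipBr !ipZr pz (ipC (hH H) x p) xp rmorph0 !mulr0 subr0.
by rewrite !scale0r scaler0 subr0 addr0.
Qed.

(** Indices are treated one at a time. Replacing [m] by [S m] and [y] by [adjoint S' y] keeps all
    pairings, and each correction fixes the vectors orthogonal to the pair being treated, so earlier
    equalities survive. *)
Lemma biorth_equalizer n (m y : 'I_n -> H) (al : 'I_n -> R) :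
  (forall i j, << m i, y j>> = (al i)%:C * (i == j)%:R) ->
  (forall i, al i = 0 -> m i = 0 /\ y i = 0) -> (forall i, 0 <= al i) ->
  exists S S', [/\ S * S' = 1, S' * S = 1 & forall i, S (m i) = adjoint S' (y i)].
Proof.
move=> hmy h0 hp.
suff : forall k, exists S S', [/\ S * S' = 1, S' * S = 1 &
    forall i : 'I_n, (i < k)%N -> S (m i) = adjoint S' (y i)].
  by move=> /(_ n) [S [S' [h1 h2 h3]]]; exists S, S'; split=> // i; exact: h3.
elim=> [|k [S [S' [h1 h2 h3]]]]; first by exists 1, 1; rewrite mulr1.
have biorth i j : << S (m i), adjoint S' (y j)>> = (al i)%:C * (i == j)%:R.
  by rewrite -adjE -bopME h2 bop1E hmy.
have [kn|kn] := ltnP k n; last first.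
  by exists S, S'; split=> // i _; apply: h3; exact: leq_trans kn.
pose i0 := Ordinal kn.
have [a0|an0] := eqVneq (al i0) 0.
  exists S, S'; split=> // i; rewrite ltnS leq_eqVlt => /orP[/eqP ik|]; last exact: h3.
  have -> : i = i0 by exact: val_inj.
  by have [-> ->] := h0 _ a0; rewrite !bop0.
have ap : 0 < al i0 by rewrite lt_def an0 hp.
have := biorth i0 i0; rewrite eqxx mulr1 => /(biorth_equalizer1 ap)[T [T' [t1 t2 t3 t4]]].
exists (T * S), (S' * T'); split.
- by rewrite mulrA -(mulrA T) h1 mulr1.
- by rewrite mulrA -(mulrA S') t2 mulr1.
move=> i; rewrite bop_adjM !bopE ltnS leq_eqVlt => /orP[/eqP ik|ik].
  by have -> : i = i0 by exact: val_inj.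
have ii0 : (i == i0) = false by rewrite -val_eqE /= ltn_eqF.
have e := h3 i ik; rewrite -e.
have [|| -> ->] // := t4 (S (m i)).
  by rewrite e biorth eq_sym ii0 mulr0.
by rewrite biorth ii0 mulr0.
Qed.

Variable (AA : set 'B(H)).
Hypotheses (sepH : separable H) (rpf : right_partial_factorization AA).

(** An equaliser of [m] and [sg g * y] gives [Y] in the complement of [M] with [sg g * Y] in [M].
    Two ratios yield [g a = b] and [g' a = b], where [a] and [b] sum [<Y g i, Y g' i>] over the
    positive and over the other indices. Hence [a = 0], and the positive parts [Z g] are pairwise
    orthogonal. *)
Lemma diag_pairing_le0 n (M : set ('I_n -> H)) (m y : 'I_n -> H) (nu : 'I_n -> R) :
  ainv AA M -> M m -> perp (hT H n) M y ->
  (forall i j, << m i, y j>> = (nu i)%:C * (i == j)%:R) ->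
  (forall i, nu i = 0 -> m i = 0 /\ y i = 0) -> forall i, nu i <= 0.
Proof.
move=> iM Mm My hmy h0 i0; rewrite leNgt; apply/negP => nu0.
(* The value -1 makes [sg g i * nu i] nonnegative at the remaining indices too, as
   [biorth_equalizer] requires. *)
pose sg (g : R) i := if 0 < nu i then g else -1.
have ex g : exists Y, 0 < g -> [/\ perp (hT H n) M Y,
   M (fun i => (sg g i)%:C *: Y i) & Y i0 != 0].
  have [g0|g0] := pselect (0 < g); last by exists 0.
  have [i j|i|i|S [S' [h1 h2 h3]]] := @biorth_equalizer n m (fun i => (sg g i)%:C *: y i) (fun i => sg g i * nu i).
  - rewrite ipZr conjR hmy rmorphM/=; have [->|] := eqVneq i j; last by rewrite !mulr0.
    by rewrite mulrA.
  - have s0 : sg g i != 0.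
      by rewrite /sg; case: ifP => _; [exact: lt0r_neq0|rewrite oppr_eq0 oner_eq0].
    by move=> /eqP; rewrite mulf_eq0 (negbTE s0) => /eqP/h0[-> ->]; rewrite scaler0.
  - rewrite /sg; case: ifP => [nui|/negbT]; first by rewrite mulr_ge0 ?ltW.
    by rewrite -leNgt => ?; rewrite mulN1r oppr_ge0.
  have [U iU /(_ n M iM) [a1 _ _ a2]] := pfp_transport rpf h1 h2.
  exists (amp (adjoint U * adjoint S') y) => _; split; first exact: a2.
    have := a1 m Mm; congr (M _); apply/funext => i.
    by rewrite /amp !bopE h3 !bopZ.
  rewrite /amp !bopE; apply/eqP => h.
  have : nrm (adjoint S' (y i0)) = 0 by rewrite -(isom_nr iU) h nr0.
  move/nr_eq0 => /(congr1 (adjoint S)); rewrite -bopME -bop_adjM h2 bop_adj1 bop0 bop1E => yi0.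
  have := hmy i0 i0; rewrite yi0 ip0r eqxx mulr1 => /complexI nu00.
  by rewrite -nu00 ltxx in nu0.
have [Y hY] := choice ex.
pose Z g : 'I_n -> H := fun i => if 0 < nu i then Y g i else 0.
apply: (@no_orth_family R H n Z) => // [g g0|g g' g0 g0' gg'].
  have [_ _ Yi] := hY g g0; apply: contra Yi => /eqP/(congr1 (fun f => f i0)).
  by rewrite /Z nu0 => ->.
have [p1 M1 _] := hY g g0; have [p2 M2 _] := hY g' g0'.
have := p2 _ M1; have := p1 _ M2; rewrite !ipTE.
pose a := \sum_(i | 0 < nu i) << Y g i, Y g' i>>.
pose b := \sum_(i | ~~ (0 < nu i)) << Y g i, Y g' i>>.
have h c d : \sum_i << (sg c i)%:C *: Y d i, Y (if d == g then g' else g) i>> =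
   \sum_(i | 0 < nu i) c%:C * << Y d i, Y (if d == g then g' else g) i>>
   - \sum_(i | ~~ (0 < nu i)) << Y d i, Y (if d == g then g' else g) i>>.
  rewrite (bigID (fun i => 0 < nu i))/= -sumrN; congr (_ + _); apply: eq_bigr => i hi.
    by rewrite ipZl /sg hi.
  by rewrite ipZl /sg (negbTE hi) rmorphN rmorph1 mulN1r.
have := h g' g'; rewrite eq_sym (negbTE gg') => -> h1.
have := h g g; rewrite eqxx => -> h2.
have e2 : g%:C * a - b = 0 by rewrite -[RHS]h2 /a /b mulr_sumr.
have e1 : g'%:C * a - b = 0.
  rewrite -[RHS]conjc0 -[RHS]/((0 : R[i])^*) -h1 rmorphB !rmorph_sum /a /b mulr_sumr.
  congr (_ - _); apply: eq_bigr => i _; last exact: ipC.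
  by rewrite rmorphM/= conjR -ipC.
have -> : \sum_i << Z g i, Z g' i>> = a.
  rewrite /a [RHS]big_mkcond; apply: eq_bigr => i _; rewrite /Z; case: ifP => // _.
  by rewrite ip0l.
have /eqP : (g - g')%:C * a = 0 by rewrite rmorphB mulrBl -[RHS](subrr b) -{1}(subr0 b) -e1 -[RHS]addr0 -e2; ring.
by rewrite mulf_eq0 realC_eq0 subr_eq0 (negbTE gg') => /eqP.
Qed.
End Right.

Section Spectral.
Local Open Scope sesquilinear_scope.
Variable R : realType.
(** The spectral theorem for Hermitian matrices on plain functions; row [i] of [P] is the conjugate
    of a unit eigenvector for [d i]. *)
Lemma herm_diag n (N : 'I_n -> 'I_n -> R[i]) : (forall i j, N j i = (N i j)^*) ->
  exists (P : 'I_n -> 'I_n -> R[i]) (d : 'I_n -> R),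
  [/\ forall i j, \sum_k P i k * (P j k)^* = (i == j)%:R,
      forall i j, \sum_k (P k i)^* * P k j = (i == j)%:R,
      forall i j, \sum_k \sum_l P i k * N k l * (P j l)^* = (d i)%:C * (i == j)%:R
    & forall i k, \sum_l N k l * (P i l)^* = (d i)%:C * (P i k)^*].
Proof.
move=> hN; pose A := \matrix_(i < n, j < n) N i j.
have hA : A \is hermsymmx.
  by apply/is_hermitianmxP; rewrite expr0 scale1r; apply/matrixP => i j; rewrite !mxE hN.
have /orthomx_spectralP eA := hermitian_normalmx hA.
have uP := spectral_unitarymx A; have invP := invmx_unitary uP.
pose P := spectralmx A; pose D := spectral_diag A.
have rD i : D 0 i = (Re (D 0 i))%:C.
  apply: complex_eq => //=; have /mxOverP/(_ 0 i) := hermitian_spectral_diag_real hA.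
  by move/RIm_real; rewrite -/D => /complexI.
have PP : P *m P^t* = 1%:M by apply/unitarymxP.
have PP' : P^t* *m P = 1%:M by rewrite -invP mulVmx// unitarymx_unit.
have PAP : P *m A *m P^t* = diag_mx D.
  by rewrite eA invP -/P -/D !mulmxA PP mul1mx -mulmxA PP mulmx1.
have AP : A *m P^t* = P^t* *m diag_mx D.
  by rewrite -PAP !mulmxA PP' mul1mx.
exists (fun i j => P i j), (fun i => Re (D 0 i)); split.
- move=> i j; have /matrixP/(_ i j) := PP; rewrite !mxE => <-.
  by apply: eq_bigr => k _; rewrite !mxE.
- move=> i j; have /matrixP/(_ i j) := PP'; rewrite !mxE => <-.
  by apply: eq_bigr => k _; rewrite !mxE.
- move=> i j; rewrite -rD; have /matrixP/(_ i j) := PAP; rewrite !mxE mulr_natr => <-.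
  rewrite exchange_big/=; apply: eq_bigr => l _; rewrite !mxE mulr_suml.
  by apply: eq_bigr => k _; rewrite !mxE.
- move=> i k; rewrite -rD; have /matrixP/(_ k i) := AP; rewrite mul_mx_diag !mxE mulrC => <-.
  by apply: eq_bigr => l _; rewrite !mxE.
Qed.
End Spectral.

Section RightFinal.
Variables (R : realType) (H : hilbertType R).
Implicit Types (A B S T U : 'B(H)).
Notation "<< x , y >>" := (ip (hH H) x y).
Notation nrm := (nr (hH H)).
Variable (AA : set 'B(H)).
Hypotheses (sepH : separable H) (rpf : right_partial_factorization AA).

(** A unitary change of coordinates makes the pairing diagonal with real entries [d i]. They are
    nonpositive by [diag_pairing_le0] and their sum is [<m, y> = 0], so all vanish; the kernel
    hypothesis then kills every coordinate of [V m]. *)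
Lemma herm_pairing_eq0 n (M : set ('I_n -> H)) (m y : 'I_n -> H) :
  lin_set M -> ainv AA M -> M m -> perp (hT H n) M y ->
  (forall i j, << m j, y i>> = << m i, y j>>^*) ->
  (forall u : 'I_n -> R[i], (forall k, \sum_l << m k, y l>> * u l = 0) ->
     slice u m = 0 /\ slice u y = 0) -> forall k l, << m k, y l>> = 0.
Proof.
move=> lM iM Mm My hN hker.
have [P [d [P1 P2 P3 P4]]] := herm_diag hN.
pose V (x : 'I_n -> H) i := \sum_k P i k *: x k.
pose V' (x : 'I_n -> H) k := \sum_i (P i k)^* *: x i.
have VK x : V' (V x) = x.
  apply/funext => k; rewrite /V' /V.
  under eq_bigr => i _ do rewrite scaler_sumr.
  rewrite exchange_big/= (bigD1 k)//= [X in _ + X]big1 => [|l lk].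
    rewrite addr0; under eq_bigr => i _ do rewrite scalerA.
    by rewrite -scaler_suml P2 eqxx scale1r.
  under eq_bigr => i _ do rewrite scalerA.
  by rewrite -scaler_suml P2 eq_sym (negbTE lk) scale0r.
have VipE x z : ip (hT H n) x (V z) = ip (hT H n) (V' x) z.
  rewrite !ipTE /V /V'.
  under eq_bigr => i _ do rewrite ip_sumr; rewrite exchange_big/=.
  apply: eq_bigr => k _; rewrite ip_suml; apply: eq_bigr => i _.
  by rewrite ipZr ipZl.
pose M' : set ('I_n -> H) := [set x | M (V' x)].
have iM' : ainv AA M'.
  move=> A x AAA Mx; rewrite /M' /=.
  have -> : V' (amp A x) = amp A (V' x).
    apply/funext => k; rewrite /V' /amp bop_sum; apply: eq_bigr => i _.
    by rewrite bopZ.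
  exact: iM.
have d0 i : d i = 0 -> V m i = 0 /\ V y i = 0.
  move=> di; have [|h1 h2] := hker (fun l => (P i l)^*).
    by move=> k; rewrite P4 di mul0r.
  split; [rewrite -[RHS]h1|rewrite -[RHS]h2]; rewrite /V /slice;
    by apply: eq_bigr => k _; rewrite conjCK.
have hV i j : << V m i, V y j>> = (d i)%:C * (i == j)%:R.
  rewrite -P3 /V ip_suml; apply: eq_bigr => k _; rewrite ip_sumr; apply: eq_bigr => l _.
  by rewrite ipZl ipZr; ring.
have hd : forall i, d i <= 0.
  apply: (@diag_pairing_le0 _ _ AA sepH rpf n M' (V m) (V y) d iM') => //.
    by rewrite /M' /= VK.
  by move=> x Mx; rewrite VipE; apply: My.
have sd : \sum_i d i = 0.
  have : ip (hT H n) (V m) (V y) = 0 by rewrite VipE VK; apply: My.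
  suff -> : ip (hT H n) (V m) (V y) = (\sum_i d i)%:C by move=> /complexI.
  by rewrite ipTE rmorph_sum; apply: eq_bigr => i _; rewrite hV eqxx mulr1.
have dz i : d i = 0.
  apply/eqP; rewrite -oppr_eq0; move: sd => /eqP; rewrite -oppr_eq0 -sumrN.
  rewrite psumr_eq0 => [/allP/(_ i)|j _]; last by rewrite oppr_ge0.
  by rewrite mem_index_enum => /(_ isT).
move=> k l; rewrite -(VK m).
suff -> : V m = 0.
  by rewrite /V' big1 ?ip0l// => i _; rewrite scaler0.
by apply/funext => i; have [] := d0 i (dz i).
Qed.

(** Diagonalising makes [Q (h (x) v_j)] orthogonal to [h (x) v_i] for [i != j]. With
    [y = h (x) v_j - m], this makes the vector of the [<y_k, h>] a multiple of [v_j] and the matrix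
    [<m_k, y_l>] Hermitian. Either its kernel contains a vector not orthogonal to [v_j], which makes
    [y] elementary, or [herm_pairing_eq0] shows that the matrix is zero, and then [v_j] itself is
    such a vector. *)
Lemma right_splitting_basis n (M : set ('I_n -> H)) h : closed_lin (hT H n) M -> ainv AA M ->
  exists v : 'I_n -> 'I_n -> R[i], (forall w, w = \sum_j cip w (v j) *: v j) /\
    forall j, exists h', hproj (hT H n) M (tens h (v j)) = tens h' (v j).
Proof.
move=> cM iM; pose Q := hproj (hT H n) M.
pose N i j := ip (hT H n) (Q (tens h (dl R j))) (tens h (dl R i)).
have hN i j : N j i = (N i j)^*.
  by rewrite /N -ipC /Q -proj_ip.
have [P [d [P1 P2 P3 _]]] := herm_diag hN.
pose v j : 'I_n -> R[i] := fun k => (P j k)^*.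
have vv i j : cip (v i) (v j) = (i == j)%:R.
  by rewrite eq_sym -P1 /cip; apply: eq_bigr => k _; rewrite /v conjCK mulrC.
exists v; split=> [w|j].
  apply/funext => k; rewrite fct_sumE /cip.
  under eq_bigr => j _.
    rewrite -[(_ *: v j) k]/(_ * v j k) mulr_suml.
    under eq_bigr => l _ do rewrite /v conjCK mulrAC -mulrA.
    over.
  rewrite /= exchange_big/= (bigD1 k)//= [X in _ + X]big1 => [|l lk].
    by rewrite -mulr_sumr P2 eqxx mulr1 addr0.
  by rewrite -mulr_sumr P2 eq_sym (negbTE lk) mulr0.
have hQ i : i != j -> ip (hT H n) (Q (tens h (v j))) (tens h (v i)) = 0.
  move=> ij; have := P3 i j; rewrite (negbTE ij) mulr0 => <-.
  rewrite [v j]vec_sum [v i]vec_sum !tens_sumr /Q proj_sum// ip_suml [RHS]exchange_big/=.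
  apply: eq_bigr => l _; rewrite ip_sumr; apply: eq_bigr => k _.
  by rewrite !tensZr projZ// ipZl ipZr /v !conjCK /N /Q; ring.
set m := Q (tens h (v j)) in hQ *; pose y := tens h (v j) - m.
have Mm : M m by exact: proj_in.
have My : perp (hT H n) M y by exact: proj_perp.
pose g := n2 (hT H n) y.
have yh : ip (hT H n) y (tens h (v j)) = g%:C.
  by rewrite -(subrK m (tens h (v j))) -/y ipDr ipxx ipC My// rmorph0 addr0.
(* Computed in the orthonormal basis [v]: the coordinate along [v i] is zero for [i != j] by
   [hQ]. *)
have a k : << y k, h>> = v j k * g%:C.
  have hi i : \sum_l P i l * << y l, h>> = g%:C * (i == j)%:R.
    transitivity (ip (hT H n) y (tens h (v i))).
      by rewrite ip_tens /slice ip_suml; apply: eq_bigr => l _; rewrite ipZl /v conjCK.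
    have [->|ij] := eqVneq i j; first by rewrite mulr1.
    by rewrite mulr0 /y ipBl hQ// subr0 ip_tens slice_tens vv eq_sym (negbTE ij) scale0r ip0l.
  transitivity (\sum_i (P i k)^* * \sum_l P i l * << y l, h>>).
    under eq_bigr => i _ do rewrite mulr_sumr.
    rewrite exchange_big/= (bigD1 k)//= [X in _ + X]big1 => [|l lk].
      under eq_bigr => i _ do rewrite mulrA.
      by rewrite -mulr_suml P2 eqxx mul1r addr0.
    under eq_bigr => i _ do rewrite mulrA.
    by rewrite -mulr_suml P2 eq_sym (negbTE lk) mul0r.
  under eq_bigr => i _ do rewrite hi.
  rewrite (bigD1 j)//= big1 => [|i ij]; first by rewrite eqxx mulr1 addr0.
  by rewrite (negbTE ij) !mulr0.
have mE k : m k = v j k *: h - y k.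
  by rewrite /y -[(_ - m) k]/(v j k *: h - m k) opprB addrC subrK.
have NE k l : << m k, y l>> = g%:C * (v j k * (v j l)^*) - << y k, y l>>.
  rewrite mE ipBl ipZl (ipC (hH H) (y l) h) a rmorphM/= conjR; congr (_ - _); ring.
have NH i k : << m k, y i>> = << m i, y k>>^*.
  by rewrite !NE rmorphB !rmorphM/= conjR conjCK -ipC; congr (_ - _); ring.
have kerE u : (forall k, \sum_l << m k, y l>> * u l = 0) ->
    forall k, << y k, slice u y>> = g%:C * v j k * cip u (v j).
  move=> hu k; have := hu k.
  under eq_bigr => l _ do rewrite NE mulrBl.
  rewrite sumrB => /eqP; rewrite subr_eq0 => /eqP e.
  rewrite /slice ip_sumr; under eq_bigr => l _ do rewrite ipZr conjCK mulrC.
  by rewrite -e /cip mulr_sumr; apply: eq_bigr => l _; ring.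
have cip_conj (w u : 'I_n -> R[i]) : \sum_k (u k)^* * w k = (cip u w)^*.
  by rewrite /cip rmorph_sum; apply: eq_bigr => k _; rewrite rmorphM/= conjCK.
have ssE u : (forall k, \sum_l << m k, y l>> * u l = 0) ->
    << slice u y, slice u y>> = g%:C * (cip u (v j) * (cip u (v j))^*).
  move=> hu; rewrite {1}/slice ip_suml.
  under eq_bigr => k _ do rewrite ipZl kerE//.
  rewrite -cip_conj mulrA mulr_sumr; apply: eq_bigr => k _; ring.
have [[u [hu tau]]|nex] := pselect (exists u, (forall k, \sum_l << m k, y l>> * u l = 0) /\
    cip u (v j) != 0).
  (* With this [c] the three terms of the squared distance from [y] to [tens (c *: slice u y) (v j)]
     are [g], [- 2 g] and [g]. *)
  pose c := (cip u (v j))^*^-1.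
  have c0 : (cip u (v j))^* != 0 by rewrite conjC_eq0.
  have : y - tens (c *: slice u y) (v j) = 0.
    apply: (@n2_eq0 _ _ (hT H n)); rewrite n2B n2_tens.
    have -> : c2 (v j) = 1.
      by apply: complexI; rewrite -cipxx vv eqxx.
    have -> : rip (hT H n) y (tens (c *: slice u y) (v j)) = g.
      rewrite /rip ipTE /tens.
      under eq_bigr => k _ do rewrite scalerA ipZr kerE//.
      suff -> : \sum_i (v j i * c)^* * (g%:C * v j i * cip u (v j)) = g%:C by [].
      transitivity (g%:C * (\sum_i v j i * (v j i)^*)); last first.
        by have := vv j j; rewrite /cip eqxx => ->; rewrite mulr1.
      rewrite mulr_sumr; apply: eq_bigr => i _.
      by rewrite rmorphM/= /c fmorphV/= conjCK; field.
    have -> : n2 (hH H) (c *: slice u y) = g.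
      apply: complexI; rewrite -ipxx ipZl ipZr ssE// /c fmorphV/= conjCK.
      by field; rewrite tau.
    by rewrite -/g; ring.
  move=> /eqP; rewrite subr_eq0 => /eqP ye; exists (h - c *: slice u y).
  by rewrite tensBl -ye /y opprB addrC subrK.
exfalso.
have hz : forall k l, << m k, y l>> = 0.
  apply: (herm_pairing_eq0 _ iM Mm My NH) => [|u hu]; first by case: cM.
  have t0 : cip u (v j) = 0.
    by apply/eqP/negPn/negP => t0; apply: nex; exists u.
  have s0 : slice u y = 0.
    by apply: (@n2_eq0 _ _ (hH H)); apply: complexI; rewrite -ipxx ssE// t0 mul0r mulr0.
  split=> //; have -> : m = tens h (v j) - y by rewrite /y opprB addrC subrK.
  rewrite sliceB s0 subr0 slice_tens.
  have -> : cip (v j) u = (cip u (v j))^*.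
    by rewrite -cip_conj /cip; apply: eq_bigr => k _; rewrite mulrC.
  by rewrite t0 rmorph0 scale0r.
apply: nex; exists (v j); split; last by rewrite vv eqxx oner_eq0.
by move=> k; apply: big1 => l _; rewrite hz mul0r.
Qed.

(** An element of [M] is the projection of a sum of elementary tensors. Each of these projections is
    a sum of elementary tensors in [M], on which [T] acts through the invariant subspaces [Eset] of
    [H]. *)
Theorem right_case T : lat_inv AA T -> forall n (M : set ('I_n -> H)),
  closed_lin (hT H n) M -> ainv AA M -> forall X, M X -> M (amp T X).
Proof.
move=> hT0 n M cM iM X MX.
have key h w : M (amp T (hproj (hT H n) M (tens h w))).
  have [v [hv hb]] := right_splitting_basis h cM iM.
  rewrite (hv w) tens_sumr proj_sum//.
  have -> : amp T (\sum_j hproj (hT H n) M (tens h (cip w (v j) *: v j))) =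
     \sum_j cip w (v j) *: amp T (hproj (hT H n) M (tens h (v j))).
    rewrite (big_morph (amp T) (ampD T) (_ : _ = 0)); last by apply/funext => i; exact: bop0.
    apply: eq_bigr => j _; rewrite tensZr projZ//.
    by apply/funext => i; exact: bopZ.
  apply: lin_set_sum => [|j _]; first by case: cM.
  apply: lin_setZ; first by case: cM.
  have [h' e] := hb j; rewrite e amp_tens.
  apply: (hT0 _ (Eset_closed cM (v j)) (fun A AAA => Eset_inv iM AAA)).
  by rewrite /Eset /= -e; exact: proj_in.
rewrite -(proj_id cM MX) [X]tuple_sum proj_sum//.
rewrite (big_morph (amp T) (ampD T) (_ : _ = 0)); last by apply/funext => i; exact: bop0.
by apply: lin_set_sum => [|j _]; [case: cM|exact: key].
Qed.
End RightFinal.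

(** * Limits of vectors and operators, Neumann series *)

Section Limits.
Variables (R : realType) (V : lmodType R[i]) (s : hspace V).
Implicit Types (u v : nat -> V) (x y l : V).
Definition tends u l := forall e : R, 0 < e -> exists N, forall m, (N <= m)%N -> nr s (u m - l) <= e.

Lemma tends_uniq u l l' : tends u l -> tends u l' -> l = l'.
Proof.
move=> h h'; apply/eqP; rewrite -subr_eq0; apply/eqP/(@nr_eq0 _ _ s).
apply/eqP; rewrite eq_le nr_ge0 andbT; apply/ler_addgt0Pl => e e0; rewrite addr0.
have e2 : 0 < e / 2 by lra.
have [N1 h1] := h _ e2; have [N2 h2] := h' _ e2.
have := h1 _ (leq_maxl N1 N2); have := h2 _ (leq_maxr N1 N2).
have := nrD s (l - u (maxn N1 N2)) (u (maxn N1 N2) - l').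
rewrite addrA subrK (nrBC s l); lra.
Qed.
Lemma tends_const l : tends (fun=> l) l.
Proof. by move=> e e0; exists 0%N => m _; rewrite subrr nr0 ltW. Qed.
Lemma tends_lin (a : R[i]) u v l l' : tends u l -> tends v l' ->
  tends (fun k => a *: u k + v k) (a *: l + l').
Proof.
move=> h h' e e0.
have cp : 0 < cmod a + 1 by have := cmod_ge0 a; lra.
have [N1 h1] := h _ (divr_gt0 (divr_gt0 e0 (ltr0Sn _ 1)) cp).
have [N2 h2] := h' _ (divr_gt0 e0 (ltr0Sn _ 1)).
exists (maxn N1 N2) => m; rewrite geq_max => /andP[/h1 + /h2 +].
rewrite ler_pdivlMr// => a1 a2.
have -> : a *: u m + v m - (a *: l + l') = a *: (u m - l) + (v m - l').
  by rewrite scalerBr opprD addrACA.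
apply: le_trans (nrD _ _ _) _; rewrite nrZ.
by have := nr_ge0 s (u m - l); nra.
Qed.
Lemma tends_bd u l (c : R) : tends u l -> (forall k, nr s (u k) <= c) -> nr s l <= c.
Proof.
move=> h b; apply/ler_addgt0Pl => e e0; have [N /(_ N (leqnn _)) hN] := h e e0.
have := nrB s (u N) (u N - l); rewrite opprB addrC subrK; have := b N; lra.
Qed.
Lemma tends_ip u l z : tends u l -> (forall k, ip s (u k) z = 0) -> ip s l z = 0.
Proof.
move=> h hz; apply: sqm_eq0; rewrite -cmod_sq.
suff -> : cmod (ip s l z) = 0 by rewrite expr0n.
apply/eqP; rewrite eq_le cmod_ge0 andbT; apply/ler_addgt0Pl => e e0; rewrite addr0.
have zp : 0 < nr s z + 1 by have := nr_ge0 s z; lra.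
have [N /(_ N (leqnn _))] := h _ (divr_gt0 e0 zp).
rewrite ler_pdivlMr// => hN.
have -> : ip s l z = - ip s (u N - l) z by rewrite ipBl hz sub0r opprK.
rewrite -ipNl; apply: le_trans (CSc _ _ _) _; rewrite nrN.
have := nr_ge0 s (u N - l); nra.
Qed.

Lemma pow2_small (c e : R) : 0 <= c -> 0 < e -> exists N : nat, c / 2 ^+ N <= e.
Proof.
move=> c0 e0; exists (Num.truncn (c / e)).
rewrite ler_pdivrMr ?exprn_gt0//.
have h : c / e < (Num.truncn (c / e)).+1%:R by exact: truncnS_gt.
have h2 k : k.+1%:R <= 2 ^+ k :> R.
  by rewrite -natrX ler_nat ltn_expl.
rewrite -ler_pdivrMl// mulrC; apply: le_trans (h2 _); exact: ltW.
Qed.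
Lemma geo_cauchy u (c : R) : 0 <= c -> (forall k, nr s (u k.+1 - u k) <= c / 2 ^+ k) ->
  forall e : R, 0 < e -> exists N, forall m n, (N <= m)%N -> (N <= n)%N -> nr s (u m - u n) <= e.
Proof.
move=> c0 h.
have tail N k : nr s (u (N + k)%N - u N) <= 2 * c / 2 ^+ N - c / 2 ^+ (N + k) * 2.
  elim: k => [|k IH]; first by rewrite addn0 subrr nr0; lra.
  rewrite addnS; have := nrD s (u (N + k).+1 - u (N + k)%N) (u (N + k)%N - u N).
  rewrite addrA subrK; have := h (N + k)%N; rewrite exprS invfM.
  have : 0 <= (2 ^+ (N + k))^-1 :> R by rewrite invr_ge0 exprn_ge0.
  nra.
move=> e e0; have [N hN] := @pow2_small (4 * c) e ltac:(lra) e0; exists N => m n Nm Nn.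
have b k : (N <= k)%N -> nr s (u k - u N) <= 2 * c / 2 ^+ N.
  move=> /subnKC <-; apply: le_trans (tail _ _) _.
  by rewrite gerBl mulr_ge0// divr_ge0// exprn_ge0.
have := nrB s (u m - u N) (u n - u N); rewrite opprB addrA subrK.
have := b m Nm; have := b n Nn; lra.
Qed.
End Limits.

Section OpLimits.
Variables (R : realType) (H : hilbertType R).
Implicit Types (A B S T : 'B(H)) (f : nat -> 'B(H)).
Notation "<< x , y >>" := (ip (hH H) x y).
Notation nrm := (nr (hH H)).
Notation tendsH := (tends (hH H)).

Lemma tends_op A u l : tendsH u l -> tendsH (fun k => A (u k)) (A l).
Proof.
move=> h e e0; have [c c0 bA] := bop_bd A.
have cp : 0 < c + 1 by lra.
have [N hN] := h _ (divr_gt0 e0 cp); exists N => m /hN; rewrite ler_pdivlMr// => hm.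
rewrite -bopB; apply: le_trans (bA _) _; have := nr_ge0 (hH H) (u m - l); nra.
Qed.

Lemma op_lim f (c : R) : (forall N x, nrm (f N x) <= c * nrm x) ->
  (forall x (e : R), 0 < e -> exists N, forall m n, (N <= m)%N -> (N <= n)%N ->
     nrm (f m x - f n x) <= e) ->
  exists2 F : 'B(H), (forall x, tendsH (fun k => f k x) (F x)) & forall x, nrm (F x) <= c * nrm x.
Proof.
move=> bf cf.
have ex x : exists l, tendsH (fun k => f k x) l by apply: complete; exact: cf.
have [F hF] := choice ex.
have lF (a : R[i]) x y : F (a *: x + y) = a *: F x + F y.
  apply: tends_uniq (hF _) _.
  have := tends_lin a (hF x) (hF y).
  by congr (tends _ _ _); apply/funext => k; rewrite bop_lin.
have bF x : nrm (F x) <= c * nrm x by apply: tends_bd (hF x) _ => k; exact: bf.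
by exists (mkop lF (ex_intro _ c bF)).
Qed.

(** The bound 2 is the sum of the geometric series of ratio one half. The last clause, inherited
    from the partial sums, later keeps the inverse of [1 - t aop] inside [hcocore]. *)
Theorem neumann A : (forall x, nrm (A x) <= 2^-1 * nrm x) ->
  exists S', [/\ (1 - A) * S' = 1, S' * (1 - A) = 1, forall x, nrm (S' x) <= 2 * nrm x
   & forall K, closed_lin (hH H) K -> (forall x, K x -> K (A x)) -> forall x, K x -> K (S' x)].
Proof.
move=> bA.
pose f N : 'B(H) := \sum_(k < N) A ^+ k.
have fE N x : f N x = \sum_(k < N) (A ^+ k) x.
  by rewrite /f (big_morph (fun B : 'B(H) => B x) (fun B C => erefl) erefl).
have bAk k x : nrm ((A ^+ k) x) <= nrm x / 2 ^+ k.
  elim: k => [|k IH]; first by rewrite !expr0 divr1.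
  rewrite exprS bopME exprS invfM; apply: le_trans (bA _) _.
  by rewrite [leRHS]mulrCA ler_wpM2l// invr_ge0.
have fS N x : f N.+1 x - f N x = (A ^+ N) x.
  by rewrite !fE big_ord_recr/= addrAC subrr add0r.
have bf N x : nrm (f N x) <= 2 * nrm x.
  suff : nrm (f N x) <= 2 * nrm x - 2 * nrm x / 2 ^+ N.
    move/le_trans; apply; rewrite gerBl mulr_ge0 ?mulr_ge0 ?nr_ge0 ?invr_ge0 ?exprn_ge0//.
  elim: N => [|N IH]; first by rewrite fE big_ord0 nr0 expr0; lra.
  have := nrD (hH H) (f N.+1 x - f N x) (f N x); rewrite subrK fS.
  have := bAk N x; rewrite exprS invfM; lra.
have [|S' hS bS] := op_lim bf.
  move=> x; apply: (@geo_cauchy _ _ _ (fun k => f k x) (nrm x)); first exact: nr_ge0.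
  by move=> k; rewrite fS.
have Ak0 x : tendsH (fun k => (A ^+ k) x) 0.
  move=> e e0; have [N hN] := @pow2_small R (nrm x) e (nr_ge0 _ _) e0.
  exists N => m Nm; rewrite subr0; apply: le_trans (bAk _ _) _; apply: le_trans hN.
  rewrite ler_wpM2l ?nr_ge0// lef_pV2 ?posrE ?exprn_gt0// ler_weXn2l//.
  by rewrite ler1n.
have comm N : (1 - A) * f N = f N * (1 - A).
  rewrite mulrBl mul1r mulrBr mulr1; congr (_ - _).
  by rewrite /f mulr_sumr mulr_suml; apply: eq_bigr => k _; rewrite -exprS -exprSr.
have tel N : (1 - A) * f N = 1 - A ^+ N.
  rewrite /f; elim: N => [|N IH]; first by rewrite big_ord0 mulr0 expr0 subrr.
  by rewrite big_ord_recr/= mulrDr IH mulrBl mul1r -exprS addrA subrK.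
exists S'; split=> //.
- apply/bop_eqP => x; apply: tends_uniq (tends_op (1 - A) (hS x)) _.
  have := tends_lin (-1) (Ak0 x) (tends_const (hH H) x); rewrite scaler0 add0r.
  congr (tends _ _ _); apply/funext => k.
  by rewrite -[RHS]bopME tel bopBE scaleN1r addrC.
- apply/bop_eqP => x; apply: tends_uniq (hS ((1 - A) x)) _.
  have := tends_lin (-1) (Ak0 x) (tends_const (hH H) x); rewrite scaler0 add0r.
  congr (tends _ _ _); apply/funext => k.
  by rewrite -[RHS]bopME -comm tel bopBE scaleN1r addrC.
- move=> K cK iK x Kx; apply: closed_lim cK.2 _ (hS x) => k; rewrite fE.
  apply: lin_set_sum => [|i _]; first exact: cK.1.
  elim: (i : nat) => [|j IH]; first by rewrite expr0.
  by rewrite exprS bopME; apply: iK.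
Qed.
End OpLimits.

(** * Transport of invariant subspaces in the left case *)

Section LeftBasics.
Variables (R : realType) (H : hilbertType R).
Implicit Types (A B S T U a : 'B(H)).
Notation "<< x , y >>" := (ip (hH H) x y).
Notation nrm := (nr (hH H)).
Variable (AA : set 'B(H)).

Definition hinv (E : set H) := forall A, AA A -> forall x, E x -> E (A x).

(** The last clause is the case [n = 1] of the preceding one, read on subspaces of [H]; it controls
    [U] on the complement of [hcore]. *)
Lemma left_pfp S S' : left_partial_factorization AA -> S * S' = 1 -> S' * S = 1 ->
  exists U, [/\ isometry U, forall n (M : set ('I_n -> H)), ainv AA M ->
    (forall X, M X -> M (amp (S' * U) X)) /\
    (forall Y, perp (hT H n) M Y -> perp (hT H n) M (amp (adjoint S * U) Y))
  & forall E, hinv E -> forall x, perp (hH H) E x -> perp (hH H) E (adjoint S (U x))].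
Proof.
move=> h h1 h2; have [U iU hU] := pfp_transport h h1 h2; exists U; split=> //.
  by move=> n M /hU[].
move=> E iE x Ex; pose M : set ('I_1 -> H) := [set X | E (X ord0)].
have iM : ainv AA M by move=> A X AAA; exact: iE.
have [_ _ + _] := hU 1%N M iM => /(_ (fun=> x)) hp.
have /hp hx : perp (hT H 1) M (fun=> x) by move=> X /Ex; rewrite ipTE big_ord1.
move=> e Ee; have := hx (fun=> e) Ee; rewrite ipTE big_ord1; exact.
Qed.

Section FixM.
Variables (n : nat) (M : set ('I_n -> H)).
Hypotheses (cM : closed_lin (hT H n) M) (iM : ainv AA M).
Notation QM := (hproj (hT H n) M).
Implicit Types (w v : 'I_n -> R[i]) (X Y : 'I_n -> H) (x y h : H).

Section Qop.
Variables w v : 'I_n -> R[i].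
Lemma qop_lin (z : R[i]) x y : slice w (QM (tens (z *: x + y) v)) =
  z *: slice w (QM (tens x v)) + slice w (QM (tens y v)).
Proof. by rewrite tensDl tensZl proj_lin// sliceD sliceZ. Qed.
Lemma qop_bd1 x : nrm (slice w (QM (tens x v))) <= Num.sqrt (c2 w) * Num.sqrt (c2 v) * nrm x.
Proof.
apply: le_trans (nr_slice _ _) _; rewrite -mulrA ler_wpM2l ?sqrtr_ge0//.
by rewrite -nr_tens proj_nr.
Qed.
(** The block of the projection onto [M] between the copies [H (x) v] and [H (x) w] of [H]; [phi]
    below is the quadratic form of a diagonal block. *)
Definition qop : 'B(H) := mkop qop_lin (ex_intro _ _ qop_bd1).
Lemma qopE x : qop x = slice w (QM (tens x v)). Proof. by []. Qed.
End Qop.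
Lemma qop_adj w v : adjoint (qop w v) = qop v w.
Proof. by apply: adj_uniq => x y; rewrite !qopE -ip_tens' -ip_tens proj_ip. Qed.
Definition phi w h : R := n2 (hT H n) (QM (tens h w)).
Lemma phiE w h : phi w h = rip (hH H) (qop w w h) h.
Proof.
rewrite /phi /n2 /rip qopE -ip_tens -(proj_ip cM).
by rewrite (proj_id cM (proj_in cM _)).
Qed.
Lemma phi_ge0 w h : 0 <= phi w h. Proof. exact: n2_ge0. Qed.
Lemma phi_le w h : phi w h <= c2 w * n2 (hH H) h.
Proof. by rewrite -n2_tens /phi -!nr_sq ler_pXn2r ?nnegrE ?nr_ge0// proj_nr. Qed.
Lemma phiZ w (z : R[i]) h : phi w (z *: h) = sqm z * phi w h.
Proof. by rewrite /phi tensZl projZ// n2Z. Qed.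

(** The projection onto [M] is the identity on [hcore (x) C^n]. The analysis takes place on
    [hcocore], which all blocks [qop] preserve. *)
Definition hcore : set H := [set h | forall k, M (tens h (dl R k))].
Lemma hcore_tens h w : hcore h -> M (tens h w).
Proof.
move=> Eh; rewrite [w]vec_sum tens_sumr; apply: lin_set_sum => [|k _]; first exact: cM.1.
by rewrite tensZr; apply: lin_setZ => //; exact: cM.1.
Qed.
Lemma hcore_closed : closed_lin (hH H) hcore.
Proof.
split; first split.
- by move=> k; apply: (Eset_closed cM (dl R k)).1.1.
- by move=> z x y hx hy k; apply: (Eset_closed cM (dl R k)).1.2; [exact: hx|exact: hy].
move=> x hx k; apply: (Eset_closed cM (dl R k)).2 => e /hx[m Em xm].
by exists m.
Qed.
Lemma hcore_inv : hinv hcore.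
Proof. by move=> A AAA x hx k; apply: (Eset_inv iM AAA (w := dl R k)); exact: hx. Qed.
Definition hcocore := perp (hH H) hcore.
Lemma hcocore_closed : closed_lin (hH H) hcocore. Proof. exact: perp_closed. Qed.
Lemma qop_cocore w v x : hcocore x -> hcocore (qop w v x).
Proof.
move=> Kx e Ee; rewrite -{1}(adjK (qop w v)) -adjE qop_adj qopE.
by rewrite (proj_id cM (hcore_tens w Ee)) slice_tens ipZl Kx// mulr0.
Qed.
Lemma coord_cocore w x j : hcocore x -> hcocore (QM (tens x w) j).
Proof. by move=> Kx; rewrite -slice_dl -qopE; exact: qop_cocore. Qed.

Section Step.
Variables (a S' U : 'B(H)) (ca t c : R).
Hypotheses (sa : adjoint a = a) (ba : forall x, nrm (a x) <= ca * nrm x)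
  (ca0 : 0 <= ca) (t0 : 0 <= t) (c0 : 0 <= c).
Let S : 'B(H) := 1 - t%:C *: a.
Hypotheses (SS' : S * S' = 1) (S'S : S' * S = 1) (bS' : forall x, nrm (S' x) <= 2 * nrm x)
  (iU : isometry U) (h1 : forall X, M X -> M (amp (S' * U) X))
  (h2 : forall Y, perp (hT H n) M Y -> perp (hT H n) M (amp (S * U) Y)).
Variable X : 'I_n -> H.
Let mt := amp (S' * U) (QM X).
Notation ripT := (rip (hT H n)).
Notation nrT := (nr (hT H n)).
Notation n2T := (n2 (hT H n)).
Let u := amp U (QM X).
Let v := amp U (X - QM X).

Lemma amp_isom Y : nrT (amp U Y) = nrT Y.
Proof.
by rewrite /nr !n2TE; congr Num.sqrt; apply: eq_bigr => i _; rewrite -!nr_sq /amp isom_nr.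
Qed.
Let ue : u = mt - t%:C *: amp a mt.
Proof.
have -> : u = amp S mt by rewrite /mt -ampM mulrA SS' mul1r.
by apply/funext.
Qed.
Let UXe : amp U X = u + v. Proof. by rewrite /u /v ampB addrC subrK. Qed.
Let Mmt : M mt. Proof. by apply: h1; exact: proj_in. Qed.
Let sa_rip Y Z : ripT (amp a Y) Z = ripT Y (amp a Z).
Proof. by rewrite /rip amp_adj sa. Qed.
Let orth : ripT mt v = t * ripT mt (amp a v).
Proof.
have := h2 (proj_perp cM X) Mmt; rewrite ampM -/v => /(congr1 (@complex.Re R)).
have -> : amp S v = v - t%:C *: amp a v by apply/funext.
by rewrite -[Re _]/(ripT _ _) !ripE /=; lra.
Qed.
Let nv : nrT v <= nrT X. Proof. by rewrite amp_isom projC_nr. Qed.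
Let nu : nrT u <= nrT X. Proof. by rewrite amp_isom proj_nr. Qed.
Let nmt : nrT mt <= 2 * nrT X.
Proof.
rewrite /mt ampM; apply: le_trans (amp_bd bS' _ _) _ => //.
by rewrite ler_pM2l.
Qed.
Let ba' Y : nrT (amp a Y) <= ca * nrT Y. Proof. exact: amp_bd. Qed.

(** [U X - mt] differs from [S v] by [t a (v - mt)], and [S v] is orthogonal to [M]. The factor 3
    comes from [|v| + |mt| <= (1 + 2) |X|]. *)
Lemma step_dist : nrT (QM (amp U X) - mt) <= 3 * t * ca * nrT X.
Proof.
have Qy : QM (amp S v) = 0 by apply: proj_0 => //; rewrite /v -ampM; apply: h2; exact: proj_perp.
have e : QM (amp U X) - mt = QM (t%:C *: amp a (v - mt)).
  have -> : t%:C *: amp a (v - mt) = amp U X - mt - amp S v.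
    have -> : amp S v = v - t%:C *: amp a v by apply/funext.
    by rewrite UXe ue ampB; apply: (@rip_inj _ _ (hT H n)) => z; rewrite !ripE; ring.
  by rewrite projB// projB// Qy subr0 (proj_id cM Mmt).
rewrite e projZ// nrZR ger0_norm//.
have e1 := proj_nr cM (amp a (v - mt)); have e2 := ba' (v - mt).
have e3 : nrT (v - mt) <= 3 * nrT X by have := nrB (hT H n) v mt; move: nv nmt; lra.
have e4 : ca * nrT (v - mt) <= ca * (3 * nrT X) by rewrite ler_wpM2l.
have -> : 3 * t * ca * nrT X = t * (ca * (3 * nrT X)) by ring.
by rewrite ler_wpM2l//; lra.
Qed.

(** As [mt] lies in [M], [|Q U X|^2 >= 2 Re <U X, mt> - |mt|^2], and [|Q X| = |U Q X|] is expanded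
    through [U Q X = S mt]; orthogonality of [S v] to [mt] cancels the terms of order zero. The
    terms in [c] are inserted to produce the form [B] used later: [<U X, mt>] and [|mt|^2] differ by
    [O(t)], so they cost only [O(t^2)]. *)
Lemma step_gain : 2 * t * ((c * n2T mt - ripT mt (amp a mt)) -
    (c * ripT (amp U X) mt - ripT (amp U X) (amp a mt))) - 12 * c * ca * t ^+ 2 * n2T X
  <= n2T (QM (amp U X)) - n2T (QM X).
Proof.
have nQ : n2T (QM X) = n2T u by rewrite -!nr_sq amp_isom.
have h1' : 2 * ripT (amp U X) mt - n2T mt <= n2T (QM (amp U X)).
  have := n2_ge0 (hT H n) (QM (amp U X) - mt); rewrite n2B proj_rip// (proj_id cM Mmt); lra.
have nu2 : n2T u = n2T mt - 2 * t * ripT mt (amp a mt) + t ^+ 2 * n2T (amp a mt).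
  by rewrite ue n2B n2ZR !ripE; ring.
have e1 : ripT (amp U X) mt = n2T mt - t * ripT mt (amp a mt) + t * ripT v (amp a mt).
  have o : ripT v mt = t * ripT v (amp a mt) by rewrite ripC orth -sa_rip ripC.
  by rewrite UXe ripDl o {1}ue !ripE sa_rip.
have e2 : ripT v (amp a mt) = ripT (amp U X) (amp a mt) - ripT mt (amp a mt) + t * n2T (amp a mt).
  by rewrite UXe ue !ripE /n2; ring.
have b1 : `|ripT mt (amp a mt)| <= 4 * ca * n2T X.
  apply: le_trans (CSn _ _ _) _; have := ba' mt; rewrite -[n2T X]nr_sq.
  have := nr_ge0 (hT H n) mt; have := nr_ge0 (hT H n) (amp a mt); move: nmt ca0.
  move: (nrT mt) (nrT X) (nrT (amp a mt)) => p q r *; have : p * r <= p * (ca * p) by nra.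
  have : p * p <= 4 * (q * q) by nra.
  nra.
have b2 : `|ripT v (amp a mt)| <= 2 * ca * n2T X.
  apply: le_trans (CSn _ _ _) _; have := ba' mt; rewrite -[n2T X]nr_sq.
  have := nr_ge0 (hT H n) v; have := nr_ge0 (hT H n) mt; have := nr_ge0 (hT H n) (amp a mt).
  move: nmt nv ca0.
  move: (nrT mt) (nrT X) (nrT (amp a mt)) (nrT v) => p q r w *.
  have : w * r <= w * (ca * p) by nra.
  have : w * p <= 2 * (q * q) by nra.
  nra.
have N0 := n2_ge0 (hT H n) (amp a mt).
have t20 : 0 <= t ^+ 2 by rewrite sqr_ge0.
have d1 : `|ripT (amp U X) mt - n2T mt| <= t * (6 * ca * n2T X).
  have -> : ripT (amp U X) mt - n2T mt = t * (ripT v (amp a mt) - ripT mt (amp a mt)).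
    by rewrite e1; ring.
  rewrite normrM ger0_norm// ler_wpM2l//; have := ler_normB (ripT v (amp a mt)) (ripT mt (amp a mt)).
  lra.
have d2 : - (c * t * (6 * ca * n2T X)) <= c * (ripT (amp U X) mt - n2T mt).
  have := ler_norml (ripT (amp U X) mt - n2T mt) (t * (6 * ca * n2T X)).
  rewrite d1 => /esym/andP[hh _]; have := ler_wpM2l c0 hh; lra.
rewrite nQ nu2; move: h1'; rewrite e1.
move: d2; rewrite e1 e2.
move: (ripT (amp U X) (amp a mt)) (ripT mt (amp a mt)) (n2T mt) (n2T (amp a mt)) (n2T X) (n2T (QM (amp U X))) N0 => be al nm nn nX nQU N0 d2 h.
have : 0 <= t ^+ 2 * nn by rewrite mulr_ge0.
have : t * (- (c * t * (6 * ca * nX))) <= t * (c * (nm - t * al + t * (be - al + t * nn) - nm)) by rewrite ler_wpM2l.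
lra.
Qed.
End Step.
End FixM.
End LeftBasics.

(** * Near-maximisers and types *)

Section NearMaximizers.
Variables (R : realType) (H : hilbertType R).
Implicit Types (B S T U a : 'B(H)).
Notation "<< x , y >>" := (ip (hH H) x y).
Notation nrm := (nr (hH H)).
Notation nn := (n2 (hH H)).
Notation re := (rip (hH H)).
Variable (AA : set 'B(H)).
Hypothesis lpf : left_partial_factorization AA.
Variables (n : nat) (M : set ('I_n -> H)).
Hypotheses (cM : closed_lin (hT H n) M) (iM : ainv AA M).
Notation QM := (hproj (hT H n) M).
Notation K := (hcocore M).
Variables (I : finType) (w : I -> 'I_n -> R[i]) (gam : I -> R).
Hypothesis gam1 : forall b, 1 <= gam b.
Notation ph b := (phi M (w b)).
Notation q b := (qop cM (w b) (w b)).

(* The strictly convex squares force near-maximisers to be approximate eigenvectors of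
   all the compressions [q b]. *)
Definition Phi h : R := \sum_b (gam b * ph b h + (ph b h) ^+ 2).
(** The factor [2 ^+ n] absorbs the loss of [B_sum] over [n] coordinates. [cT] bounds the sum of the
    derivatives [th b], and [cL] dominates [cW], [cT] and [cT * cW + 1], so that later estimates
    carry a single constant. *)
Definition cW : R := 1 + \sum_b 2 ^+ n * c2 (w b).
Definition cT : R := \sum_b (gam b + 2 * cW).
Definition cL : R := cT * cW + cW + 1.

Lemma cW_ge b : 2 ^+ n * c2 (w b) + 1 <= cW.
Proof.
rewrite /cW addrC lerD2l (bigD1 b)//= lerDl sumr_ge0// => i _.
by rewrite mulr_ge0 ?c2_ge0 ?exprn_ge0.
Qed.
Lemma cW_ge1 : 1 <= cW.
Proof. by rewrite /cW lerDl sumr_ge0// => i _; rewrite mulr_ge0 ?c2_ge0 ?exprn_ge0. Qed.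
Lemma c2_leW b : c2 (w b) <= cW.
Proof.
apply: le_trans (cW_ge b); have := c2_ge0 (w b).
have : 1 <= 2 ^+ n :> R by rewrite exprn_ege1// ler1n.
nra.
Qed.
Lemma cT_ge0 : 0 <= cT.
Proof.
rewrite sumr_ge0// => b _; have := gam1 b; have := cW_ge1; lra.
Qed.

Section Near.
Variables (h : H) (t : R).
Hypotheses (Kh : K h) (nh : nn h = 1) (t0 : 0 < t) (tL : 2 * cL * t <= 1)
  (hmax : forall x, K x -> nn x = 1 -> Phi x <= Phi h + t ^+ 2).
(** [th b] is the derivative of [x |-> gam b * x + x ^+ 2] at [ph b h], so [aop] represents the
    linearisation of [Phi]. The constant [c] exceeds its value at [h] by [t ^+ 2], the defect
    allowed in [hmax], which makes [B] nonnegative on [K]. *)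
Let th b := gam b + 2 * ph b h.
Let aop : 'B(H) := \sum_b (th b)%:C *: q b.
Let c := \sum_b th b * ph b h + t ^+ 2.
Let B x y := c * re x y - re (aop x) y.

Let ph_h b : ph b h <= cW.
Proof. by have := phi_le cM (w b) h; rewrite nh mulr1 => /le_trans; apply; exact: c2_leW. Qed.
Let th1 b : 1 <= th b.
Proof. by rewrite /th; have := gam1 b; have := phi_ge0 M (w b) h; lra. Qed.
Let thT : \sum_b th b <= cT.
Proof. by apply: ler_sum => b _; rewrite /th; have := ph_h b; lra. Qed.
Let aopE x : aop x = \sum_b (th b)%:C *: q b x.
Proof. by rewrite /aop (big_morph (fun T : 'B(H) => T x) (fun B C => erefl) erefl). Qed.
Let aop_adj : adjoint aop = aop.
Proof.
apply: adj_uniq => x y; rewrite !aopE ip_suml ip_sumr; apply: eq_bigr => b _.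
by rewrite ipZl ipZr conjR adjE qop_adj.
Qed.
Let KZ (z : R[i]) x : K x -> K (z *: x).
Proof. exact: (lin_setZ z (hcocore_closed M).1). Qed.
Let KD x y : K x -> K y -> K (x + y).
Proof. exact: (lin_setD (hcocore_closed M).1). Qed.
Let Ksum J (r : seq J) (F : J -> H) : (forall j, K (F j)) -> K (\sum_(j <- r) F j).
Proof. by move=> hF; apply: (lin_set_sum r (P := xpredT) (hcocore_closed M).1) => j _; exact: hF. Qed.
Let aop_K x : K x -> K (aop x).
Proof. by move=> Kx; rewrite aopE; apply: Ksum => b; apply: KZ; exact: qop_cocore. Qed.
Let cL1 : 1 <= cL. Proof. by rewrite /cL; have := cW_ge1; have := cT_ge0; nra. Qed.
Let cWL : cW <= cL. Proof. by rewrite /cL; have := cW_ge1; have := cT_ge0; nra. Qed.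
Let cTWL : cT * cW + 1 <= cL. Proof. by rewrite /cL; have := cW_ge1; lra. Qed.
Let cTL : cT <= cL. Proof. by have := cW_ge1; have := cT_ge0; move: cTWL; nra. Qed.
Let t1 : t <= 1. Proof. by move: tL cL1 t0; nra. Qed.
Let t21 : t ^+ 2 <= 1. Proof. by move: t1 t0; nra. Qed.
Let c_ge0 : 0 <= c.
Proof.
rewrite addr_ge0 ?sqr_ge0// sumr_ge0// => b _; rewrite mulr_ge0 ?phi_ge0//.
by have := th1 b; lra.
Qed.
Let cleL : c <= cL.
Proof.
apply: le_trans cTWL; apply: (lerD _ t21); apply: (@le_trans _ _ ((\sum_b th b) * cW)).
  rewrite mulr_suml; apply: ler_sum => b _; rewrite ler_wpM2l//.
  by have := th1 b; lra.
by rewrite ler_wpM2r//; have := cW_ge1; lra.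
Qed.
Let aop_bd x : nrm (aop x) <= cL * nrm x.
Proof.
rewrite aopE; apply: le_trans (nr_sum _ _ _ _) _.
apply: (@le_trans _ _ (\sum_b (th b * (cW * nrm x)))).
  apply: ler_sum => b _; have tb := th1 b; rewrite nrZR ger0_norm ?ler_wpM2l//; try lra.
  apply: le_trans (qop_bd1 cM (w b) (w b) x) _.
  by rewrite -expr2 sqr_sqrtr ?c2_ge0// ler_wpM2r ?nr_ge0 ?c2_leW.
rewrite -mulr_suml mulrA ler_wpM2r ?nr_ge0//.
apply: (@le_trans _ _ (cT * cW)); last by move: cTWL; lra.
by rewrite ler_wpM2r//; have := cW_ge1; lra.
Qed.

Let BE x : B x x = c * nn x - \sum_b th b * ph b x.
Proof.
rewrite /B; congr (_ - _); rewrite aopE rip_suml; apply: eq_bigr => b _.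
by rewrite ripZl (phiE cM).
Qed.
Let B_C x y : B x y = B y x.
Proof. by rewrite /B radjE aop_adj ripC (ripC _ x (aop y)). Qed.
Let BD x y : B (x + y) (x + y) = B x x + 2 * B x y + B y y.
Proof.
have e : B (x + y) (x + y) = B x x + B x y + B y x + B y y.
  by rewrite /B bopD !ripE; ring.
by rewrite e (B_C y x); ring.
Qed.
Let BZ (z : R[i]) x : B (z *: x) (z *: x) = sqm z * B x x.
Proof. by rewrite /B bopZ !ripZZ; ring. Qed.

(** An exact expansion of the quadratics at [ph b h]; near-maximality of [h] then makes [B x x]
    dominate the sum of squares. *)
Let Phi_diff x : nn x = 1 ->
  Phi x - Phi h = t ^+ 2 - B x x + \sum_b (ph b x - ph b h) ^+ 2.
Proof.
move=> nx.
have -> : Phi x - Phi h = \sum_b th b * ph b x - \sum_b th b * ph b h +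
    \sum_b (ph b x - ph b h) ^+ 2.
  by rewrite /Phi -!sumrB -big_split/=; apply: eq_bigr => b _; rewrite /th; ring.
by rewrite BE nx /c; ring.
Qed.
Let B_unit x : K x -> nn x = 1 -> \sum_b (ph b x - ph b h) ^+ 2 <= B x x.
Proof. by move=> Kx nx; have := Phi_diff nx; have := hmax Kx nx; lra. Qed.
(** [B_unit] at [x / |x|], multiplied by [|x|^4]. *)
Let B_hom x b : K x -> (ph b x - nn x * ph b h) ^+ 2 <= nn x * B x x.
Proof.
move=> Kx; have [->|x0] := eqVneq x 0.
  have p0 : ph b 0 = 0 by have := phiZ cM (w b) 0 0; rewrite scale0r /sqm /= expr0n/= addr0 mul0r.
  by rewrite n2_0 p0 !mul0r subr0 expr0n.
have np := nr_gt0 (hH H) x0; set r := nrm x in np.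
have nr2 : nn x = r ^+ 2 by rewrite nr_sq.
have r2 : sqm (r^-1)%:C * r ^+ 2 = 1 by rewrite sqmR -exprMn mulVf ?expr1n// gt_eqF.
have n1 : nn ((r^-1)%:C *: x) = 1 by rewrite n2Z nr2.
have := B_unit (KZ (r^-1)%:C Kx) n1; rewrite (bigD1 b)//= BZ phiZ// => hs.
have {hs} : (sqm (r^-1)%:C * ph b x - ph b h) ^+ 2 <= sqm (r^-1)%:C * B x x.
  apply: le_trans hs; rewrite lerDl sumr_ge0// => i _; exact: sqr_ge0.
rewrite nr2 => hs; have r40 : 0 <= (r ^+ 2) ^+ 2 by rewrite sqr_ge0.
have := ler_wpM2l r40 hs.
have -> : (r ^+ 2) ^+ 2 * (sqm (r^-1)%:C * ph b x - ph b h) ^+ 2 =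
  ((sqm (r^-1)%:C * r ^+ 2) * ph b x - r ^+ 2 * ph b h) ^+ 2 by ring.
have -> : (r ^+ 2) ^+ 2 * (sqm (r^-1)%:C * B x x) = (sqm (r^-1)%:C * r ^+ 2) * (r ^+ 2 * B x x) by ring.
by rewrite r2 !mul1r.
Qed.
Let B_ge0 x : K x -> 0 <= B x x.
Proof.
move=> Kx; have [->|x0] := eqVneq x 0; first by rewrite /B !rip0r mulr0 subr0.
case: (pickP I) => [b _|I0].
  by rewrite -(pmulr_rge0 _ (n2_gt0 (hH H) x0)); apply: le_trans (B_hom b Kx); exact: sqr_ge0.
by rewrite BE big_pred0// subr0 mulr_ge0 ?n2_ge0.
Qed.
Let BNr x y : B x (- y) = - B x y.
Proof. by rewrite /B !ripNr; ring. Qed.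
Let BNN x : B (- x) (- x) = B x x.
Proof. by rewrite BNr B_C BNr opprK. Qed.
Let BRl (r : R) x y : B (r%:C *: x) y = r * B x y.
Proof. by rewrite /B bopZ !ripZl; ring. Qed.
Let B_D2 x y : K x -> K y -> B (x + y) (x + y) <= 2 * B x x + 2 * B y y.
Proof.
move=> Kx Ky; have := B_ge0 (lin_setB (hcocore_closed M).1 Kx Ky).
by rewrite !BD BNr BNN; lra.
Qed.
Let B_sum k (f : 'I_k -> H) : (forall j, K (f j)) ->
  B (\sum_j f j) (\sum_j f j) <= 2 ^+ k * \sum_j B (f j) (f j).
Proof.
elim: k f => [|k IH] f Kf; first by rewrite !big_ord0 /B !rip0r !mulr0 subr0.
rewrite !big_ord_recl; apply: le_trans (B_D2 (Kf _) (Ksum _ (fun j => Kf _))) _.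
have {}IH := IH _ (fun j => Kf (lift ord0 j)).
have := B_ge0 (Kf ord0).
have p1 : 1 <= 2 ^+ k :> R by rewrite exprn_ege1// ler1n.
rewrite exprS; move: IH; move: (\sum_(i < k) _) (B _ _) (B (f ord0) (f ord0)) => s u v *.
nra.
Qed.

(** The factorisation of [1 - t aop] moves [h] to [z = U h]. By [step_gain] each [ph b] grows by at
    least [t * D b] up to small terms, while the growth weighted by [th] plus [B z z] equals
    [t ^+ 2] exactly. Hence [B z z = O(t^2)] and [D b = O(t)]; the vector [s] is the slice of
    [mt b], which [step_dist] places near [q b z]. *)
Lemma near_max_form_small : exists z, [/\ K z, nn z = 1, B z z <= 26 * cL ^+ 4 * t ^+ 2 &
  forall b, exists s, [/\ K s, B s s <= 13 * cL ^+ 5 * t & nrm (q b z - s) <= 3 * cL ^+ 2 * t]].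
Proof.
have ta x : nrm ((t%:C *: aop) x) <= 2^-1 * nrm x.
  rewrite bopZE nrZR (ger0_norm (ltW t0)).
  apply: le_trans (ler_wpM2l (ltW t0) (aop_bd x)) _; rewrite mulrA ler_wpM2r ?nr_ge0//.
  by move: tL; lra.
have [S' [h1 h2 bS' iS']] := neumann ta.
have KS' x : K x -> K (S' x).
  apply: iS'; first exact: hcocore_closed.
  by move=> y Ky; rewrite bopZE; apply: KZ; exact: aop_K.
have [U [iU hU hE]] := left_pfp lpf h1 h2.
have adjS : adjoint (1 - t%:C *: aop) = 1 - t%:C *: aop.
  by rewrite bop_adjD bop_adjN bop_adjZ bop_adj1 conjR aop_adj.
rewrite adjS in hU hE; have [hU1 hU2] := hU n M iM.
(* [(1 - t aop) U] preserves [K] by [hE], and the Neumann inverse returns to [K]. *)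
have KU x : K x -> K (U x).
  move=> Kx; have := KS' _ (hE _ (hcore_inv iM) x Kx).
  by rewrite -bopME h2.
pose z := U h; have nz : nn z = 1 by rewrite -nr_sq isom_nr// nr_sq.
have Kz : K z by exact: KU.
pose X b := tens h (w b); pose mt b := amp (S' * U) (QM (X b)); pose s b := slice (w b) (mt b).
have Kmt b j : K (mt b j) by apply: KS'; apply: KU; exact: coord_cocore.
have Ks b : K (s b) by apply: Ksum => j; apply: KZ; exact: Kmt.
have UX b : amp U (X b) = tens z (w b) by exact: amp_tens.
pose D b := \sum_j B (mt b j) (mt b j).
have D0 b : 0 <= D b by rewrite sumr_ge0// => j _; exact: B_ge0.
have DE b : D b = c * n2 (hT H n) (mt b) - rip (hT H n) (mt b) (amp aop (mt b)).
  by rewrite n2TE ripTE mulr_sumr -sumrB; apply: eq_bigr => j _; rewrite /B ripC.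
have sD b : B (s b) (s b) <= 2 ^+ n * c2 (w b) * D b.
  apply: le_trans (B_sum (f := fun j => (w b j)^* *: mt b j) _) _.
    by move=> j; apply: KZ; exact: Kmt.
  rewrite -mulrA ler_wpM2l ?exprn_ge0// mulr_sumr ler_sum// => j _.
  rewrite BZ sqmJ ler_wpM2r ?B_ge0// /c2 (bigD1 j)//= lerDl sumr_ge0// => i _.
  exact: sqm_ge0.
have sD' b : B (s b) (s b) <= cW * D b.
  apply: le_trans (sD b) _; rewrite ler_wpM2r//; have := cW_ge b; lra.
have zs b : c * rip (hT H n) (amp U (X b)) (mt b) - rip (hT H n) (amp U (X b)) (amp aop (mt b)) = B z (s b).
  by rewrite UX /rip !ip_tens' amp_slice /B /rip (adjE aop) aop_adj.
have gain b : t * D b - t * cW * B z z - 12 * cL ^+ 3 * t ^+ 2 <= ph b z - ph b h.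
  have := step_gain cM aop_adj aop_bd (le_trans ler01 cL1) (ltW t0) c_ge0 h1 bS' iU hU1 hU2 (X b).
  rewrite -/(mt b) zs -DE UX -/(phi M (w b) z) -/(phi M (w b) h) => hg.
  (* Nonnegativity of [B] at [cW z - s b]. *)
  have b1 : cW * (2 * B z (s b)) <= cW * (cW * B z z) + B (s b) (s b).
    have := B_ge0 (lin_setB (hcocore_closed M).1 (KZ cW%:C Kz) (Ks b)).
    by rewrite BD BZ sqmR BNr BNN BRl; lra.
  have b2 : 2 * B z (s b) <= cW * B z z + D b.
    have cW0 : 0 < cW by have := cW_ge1; lra.
    rewrite -(ler_pM2l cW0) [leRHS]mulrDr; apply: le_trans b1 _; rewrite lerD2l; exact: sD'.
  have b3 : 12 * c * cL * t ^+ 2 * n2 (hT H n) (X b) <= 12 * cL ^+ 3 * t ^+ 2.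
    rewrite /X n2_tens nh mulr1.
    have e1 : c * c2 (w b) <= cL * cL.
      by apply: ler_pM => //; [exact: c2_ge0|exact: le_trans (c2_leW b) cWL].
    have -> : 12 * c * cL * t ^+ 2 * c2 (w b) = (12 * cL * t ^+ 2) * (c * c2 (w b)) by ring.
    have -> : 12 * cL ^+ 3 * t ^+ 2 = (12 * cL * t ^+ 2) * (cL * cL) by ring.
    by rewrite ler_wpM2l//; apply: mulr_ge0; [apply: mulr_ge0; [lra|move: cL1; lra]|exact: sqr_ge0].
  have := ler_wpM2l (ltW t0) b2; move: hg b3; rewrite -/(mt b); lra.
have ZE : B z z + \sum_b th b * (ph b z - ph b h) = t ^+ 2.
  have -> : \sum_b th b * (ph b z - ph b h) = \sum_b th b * ph b z - \sum_b th b * ph b h.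
    by rewrite -sumrB; apply: eq_bigr => b _; ring.
  by rewrite BE nz /c; ring.
have tot : B z z + \sum_b th b * (t * D b - t * cW * B z z - 12 * cL ^+ 3 * t ^+ 2) <= t ^+ 2.
  rewrite -[leRHS]ZE lerD2l; apply: ler_sum => b _; apply: ler_wpM2l; [by have := th1 b; lra|exact: gain].
have split : \sum_b th b * (t * D b - t * cW * B z z - 12 * cL ^+ 3 * t ^+ 2) =
    t * (\sum_b th b * D b) - (\sum_b th b) * (t * cW * B z z + 12 * cL ^+ 3 * t ^+ 2).
  rewrite mulr_sumr mulr_suml -sumrB; apply: eq_bigr => b _; ring.
rewrite split in tot.
have Z0 := B_ge0 Kz.
have L0 : 0 <= cL by move: cL1; lra.
have t20 : 0 <= t ^+ 2 := sqr_ge0 t.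
have L4 : 1 <= cL ^+ 4 by rewrite exprn_ege1.
have e1 : (\sum_b th b) * (t * cW * B z z + 12 * cL ^+ 3 * t ^+ 2) <=
    2^-1 * B z z + 12 * cL ^+ 4 * t ^+ 2.
  have W0 : 0 <= cW by have := cW_ge1; lra.
  apply: (@le_trans _ _ (cT * (t * cW * B z z + 12 * cL ^+ 3 * t ^+ 2))).
    by rewrite ler_wpM2r// addr_ge0// !mulr_ge0 ?exprn_ge0// ltW.
  have a1 : cT * cW * t * B z z <= 2^-1 * B z z.
    rewrite ler_wpM2r//; apply: (@le_trans _ _ (cL * t)); last by move: tL; lra.
    by rewrite ler_wpM2r ?(ltW t0)//; move: cTWL; lra.
  have a2 : cT * (12 * cL ^+ 3 * t ^+ 2) <= cL * (12 * cL ^+ 3 * t ^+ 2).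
    apply: ler_wpM2r => //; apply: mulr_ge0 => //; apply: mulr_ge0 => //; exact: exprn_ge0.
  have a3 : cL * (12 * cL ^+ 3 * t ^+ 2) = 12 * cL ^+ 4 * t ^+ 2 by ring.
  by move: a1 a2; rewrite a3; lra.
have e2 : t ^+ 2 <= cL ^+ 4 * t ^+ 2 by rewrite ler_peMl.
have SD0 : 0 <= \sum_b th b * D b.
  by rewrite sumr_ge0// => b _; rewrite mulr_ge0//; have := th1 b; lra.
have tSD0 : 0 <= t * (\sum_b th b * D b) by rewrite mulr_ge0// ltW.
exists z; split=> //; first by move: tot e1 e2; lra.
move=> b; exists (s b); split=> //.
  apply: le_trans (sD' b) _.
  have db : D b <= 13 * cL ^+ 4 * t.
    have : t * D b <= t * (13 * cL ^+ 4 * t).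
      apply: (@le_trans _ _ (t * (\sum_b th b * D b))).
        (* A single [D b] is below the weighted sum since every [th b] is at least 1; this is where
           [gam1] pays off. *)
        rewrite ler_pM2l// (bigD1 b)//=; apply: (@le_trans _ _ (th b * D b)).
          by rewrite ler_peMl.
        by rewrite lerDl sumr_ge0// => i _; rewrite mulr_ge0//; have := th1 i; lra.
      have -> : t * (13 * cL ^+ 4 * t) = 13 * (cL ^+ 4 * t ^+ 2) by ring.
      by move: tot e1 e2; lra.
    by rewrite ler_pM2l.
  apply: le_trans (ler_wpM2l _ db) _; first by have := cW_ge1; lra.
  have -> : 13 * cL ^+ 5 * t = cL * (13 * cL ^+ 4 * t) by ring.
  by rewrite ler_wpM2r// !mulr_ge0 ?exprn_ge0// ltW.
have -> : q b z - s b = slice (w b) (QM (tens z (w b)) - mt b) by rewrite sliceB.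
apply: le_trans (nr_slice _ _) _; rewrite -UX.
have := step_dist cM aop_bd L0 (ltW t0) h1 bS' iU hU1 hU2 (X b).
rewrite -/(mt b) {2}/X nr_tens => hs.
have s0 := sqrtr_ge0 (c2 (w b)).
apply: le_trans (ler_wpM2l s0 hs) _.
have nh1 : nrm h = 1 by rewrite /nr nh sqrtr1.
have ss : Num.sqrt (c2 (w b)) * Num.sqrt (c2 (w b)) <= cL.
  by rewrite -expr2 sqr_sqrtr ?c2_ge0//; apply: le_trans (c2_leW b) _.
rewrite nh1 mulr1.
have -> : Num.sqrt (c2 (w b)) * (3 * t * cL * Num.sqrt (c2 (w b))) =
  (3 * t * cL) * (Num.sqrt (c2 (w b)) * Num.sqrt (c2 (w b))) by ring.
have -> : 3 * cL ^+ 2 * t = (3 * t * cL) * cL by ring.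
by rewrite ler_wpM2l// !mulr_ge0// ltW.
Qed.

(** [F] is the quadratic form of [q b - f], and [B_hom] makes it small at [z], [s] and [z + s].
    Polarisation then bounds [Re <g, s>], and since [s] is close to [q b z] this bounds [|g|^2]:
    smallness of a form at three vectors becomes an approximate eigenvector equation. *)
Lemma near_max_eigenvector (e : R) : 0 < e -> e <= 1 -> 2000 * cL ^+ 9 * t <= e ^+ 2 ->
  exists z, [/\ K z, nn z = 1, Phi h <= Phi z + e ^+ 2 - t ^+ 2 &
    forall b, nrm (q b z - (ph b z)%:C *: z) <= Num.sqrt (4 * cL * e) + e].
Proof.
move=> e0 e1 te; have [z [Kz nz Zle hs]] := near_max_form_small.
have L0 : 0 <= cL by move: cL1; lra.
have Lp k m : (k <= m)%N -> cL ^+ k <= cL ^+ m by move=> km; rewrite ler_weXn2l.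
have L9 := exprn_ge0 9 L0.
have tt : t ^+ 2 <= t by rewrite expr2 ler_piMl ?(ltW t0)// t1.
have L4t : cL ^+ 4 * t ^+ 2 <= cL ^+ 9 * t.
  apply: ler_pM => //; [exact: exprn_ge0|exact: sqr_ge0|exact: Lp].
have t2t : t ^+ 2 <= cL ^+ 9 * t.
  by apply: le_trans tt _; rewrite ler_peMl ?(ltW t0)// exprn_ege1.
have L9t : 0 <= cL ^+ 9 * t by rewrite mulr_ge0// ltW.
have Z2 : B z z <= e ^+ 2 by move: Zle te L4t L9t; lra.
exists z; split=> //.
  have := Phi_diff nz; have : 0 <= \sum_b (ph b z - ph b h) ^+ 2.
    by rewrite sumr_ge0// => b _; exact: sqr_ge0.
  by move: Zle te L4t L9t t2t; lra.
move=> b; have [s [Ks Bs qs]] := hs b.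
pose f := ph b h; pose F x := ph b x - nn x * f.
have f0 : 0 <= f by exact: phi_ge0.
have fL : f <= cL by exact: le_trans (ph_h b) cWL.
have z1 : nrm z = 1 by rewrite /nr nz sqrtr1.
have Fle x N D : K x -> nn x <= N -> B x x <= D -> N * D <= e ^+ 2 -> `|F x| <= e.
  move=> Kx nN BD' ND; apply: ler_sq (ltW e0) _; rewrite real_normK ?num_real//.
  apply: le_trans (B_hom b Kx) _; apply: le_trans ND.
  by apply: ler_pM => //; [exact: n2_ge0|exact: B_ge0].
have qz : nrm (q b z) <= cL.
  apply: le_trans (qop_bd1 cM (w b) (w b) z) _; rewrite z1 mulr1 -expr2 sqr_sqrtr ?c2_ge0//.
  exact: le_trans (c2_leW b) cWL.
have L2 : 0 <= cL ^+ 2 by exact: sqr_ge0.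
have LL2 : cL <= cL ^+ 2 by exact: (Lp 1%N 2%N).
have L12 : 1 <= cL ^+ 2 by exact: (Lp 0%N 2%N).
have L2t : cL ^+ 2 * t <= cL ^+ 2 by rewrite ler_piMr.
have sL : nrm s <= 4 * cL ^+ 2.
  have := nrB (hH H) (q b z) (q b z - s); rewrite opprB addrC subrK; lra.
have zsL : nrm (z + s) <= 5 * cL ^+ 2.
  by have := nrD (hH H) z s; rewrite z1; lra.
have sq4 (r : R) x (k : R) : nrm x <= k * cL ^+ 2 -> nn x <= k ^+ 2 * cL ^+ 4.
  move=> hx; rewrite -nr_sq (_ : k ^+ 2 * cL ^+ 4 = (k * cL ^+ 2) ^+ 2); last by ring.
  by rewrite ler_pXn2r ?nnegrE ?nr_ge0//; apply: le_trans hx; exact: nr_ge0.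
have Fz : `|F z| <= e by apply: (Fle z 1 (e ^+ 2)) => //; rewrite ?nz// mul1r.
have Fs : `|F s| <= e.
  apply: (Fle s (4 ^+ 2 * cL ^+ 4) (13 * cL ^+ 5 * t)) => //; first exact: sq4.
  by apply: le_trans te; have -> : 4 ^+ 2 * cL ^+ 4 * (13 * cL ^+ 5 * t) = 208 * (cL ^+ 9 * t); [ring|lra].
(* The exponent 9 in the hypothesis is [4 + 5], from the bounds on [nn] and on [B]. The number 2000
   rounds up [25 * 78], where [78 = 2 * 26 + 2 * 13] comes from [B_D2]. *)
have Fzs : `|F (z + s)| <= e.
  apply: (Fle (z + s) (5 ^+ 2 * cL ^+ 4) (78 * cL ^+ 5 * t)).
  - exact: KD.
  - exact: sq4.
  - have : cL ^+ 4 * t ^+ 2 <= cL ^+ 5 * t.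
      apply: ler_pM => //; [exact: exprn_ge0|exact: sqr_ge0|exact: Lp].
    have := B_D2 Kz Ks; move: Zle Bs; lra.
  - by apply: le_trans te; have -> : 5 ^+ 2 * cL ^+ 4 * (78 * cL ^+ 5 * t) = 1950 * (cL ^+ 9 * t); [ring|lra].
pose g := q b z - f%:C *: z.
have gz : re g z = F z by rewrite /g /F !ripE (phiE cM); rewrite -/(nn z); ring.
have gs : 2 * re g s = F (z + s) - F z - F s.
  rewrite /F /g !(phiE cM) bopD !n2D !ripE.
  have -> : re (q b s) z = re (q b z) s by rewrite radjE qop_adj ripC.
  by ring.
have ng : nrm g <= 2 * cL.
  have := nrB (hH H) (q b z) (f%:C *: z); rewrite nrZR z1 mulr1 ger0_norm//; lra.
have n2g : nn g = re g s + re g (q b z - s) - f * F z.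
  by rewrite -gz {1}/g /n2 -/g {2}/g !ripE; ring.
have t3 : 6 * cL ^+ 3 * t <= e.
  have : 6 * (cL ^+ 3 * t) <= 6 * (cL ^+ 9 * t).
    by rewrite ler_pM2l// ler_wpM2r ?(ltW t0)// Lp.
  have : e ^+ 2 <= e by rewrite expr2 ler_piMl// ltW.
  by move: te L9t; lra.
have gq : re g (q b z - s) <= e.
  apply: le_trans (rip_le _ _ _) _; apply: le_trans t3.
  have -> : 6 * cL ^+ 3 * t = (2 * cL) * (3 * cL ^+ 2 * t) by ring.
  by apply: ler_pM => //; exact: nr_ge0.
have nng : nn g <= 4 * cL * e.
  have fF : - (f * F z) <= cL * e.
    have : f * `|F z| <= cL * e by apply: ler_pM.
    have : f * - F z <= f * `|F z| by rewrite ler_wpM2l// -normrN ler_norm.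
    lra.
  have := ler_norm (F (z + s)); have := ler_norm (- F z); have := ler_norm (- F s).
  rewrite !normrN; have : e <= cL * e by rewrite ler_peMl// ltW.
  move: n2g gs gq Fz Fs Fzs fF; lra.
have -> : q b z - (ph b z)%:C *: z = g - (F z)%:C *: z.
  apply: (@rip_inj _ _ (hH H)) => y; rewrite /g /F nz !ripE; ring.
apply: le_trans (nrB _ _ _) _; rewrite nrZR z1 mulr1 lerD//.
by rewrite ler_wsqrtr.
Qed.
End Near.

Theorem approx_max_eigenvector (d : R) : (exists2 x, K x & x != 0) -> 0 < d ->
  exists z, [/\ K z, nn z = 1, forall x, K x -> nn x = 1 -> Phi x <= Phi z + d &
    forall b, nrm (q b z - (ph b z)%:C *: z) <= d].
Proof.
move=> [x0 Kx0 nz0] d0.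
have L1' : 1 <= cL by rewrite /cL; have := cW_ge1; have := cT_ge0; nra.
have L0 : 0 < cL by lra.
(* Each of the two error terms [Num.sqrt (4 * cL * e)] and [e] becomes at most [d / 2]. *)
pose e := Num.min 1 (Num.min (d / 2) (d ^+ 2 / (16 * cL))).
have e0 : 0 < e.
  by rewrite !lt_min ltr01 !divr_gt0 ?exprn_gt0// mulr_gt0.
have [e1 [ed ed2]] : e <= 1 /\ (e <= d / 2 /\ e <= d ^+ 2 / (16 * cL)).
  by rewrite /e !ge_min !lexx !orbT.
pose t := e ^+ 2 / (2000 * cL ^+ 9).
have L9 : 0 < 2000 * cL ^+ 9 by rewrite mulr_gt0// exprn_gt0.
have t0 : 0 < t by rewrite divr_gt0 ?exprn_gt0.
have te : 2000 * cL ^+ 9 * t = e ^+ 2 by rewrite mulrC divfK ?gt_eqF.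
have ee : e ^+ 2 <= e by rewrite expr2 ler_piMl// ltW.
have tL : 2 * cL * t <= 1.
  have h : cL * t <= cL ^+ 9 * t.
    by rewrite ler_pM2r// -[leLHS]expr1 ler_weXn2l.
  by move: te ee e1 h; have : 0 < cL * t by [rewrite mulr_gt0]; lra.
pose D : set R := [set Phi x | x in [set x | K x /\ nn x = 1]].
have hD : has_sup D.
  split.
    exists (Phi ((nrm x0)^-1%:C *: x0)), ((nrm x0)^-1%:C *: x0) => //; split.
      exact: (lin_setZ _ (hcocore_closed M).1).
    by rewrite n2ZR -nr_sq -exprMn mulVf ?expr1n// gt_eqF// nr_gt0.
  exists (\sum_b (gam b * cW + cW ^+ 2)) => _ [x [Kx nx] <-].
  apply: ler_sum => b _.
  have pW : ph b x <= cW.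
    by have := phi_le cM (w b) x; rewrite nx mulr1 => /le_trans; apply; exact: c2_leW.
  have p0 := phi_ge0 M (w b) x; have := gam1 b => g1.
  apply: lerD; first by rewrite ler_wpM2l//; lra.
  by rewrite ler_pXn2r ?nnegrE//; have := cW_ge1; lra.
have [_ [h [Kh nh] <-] hh] := sup_adherent (exprn_gt0 2 t0) hD.
have hmax x : K x -> nn x = 1 -> Phi x <= Phi h + t ^+ 2.
  move=> Kx nx; have : Phi x <= sup D by apply: sup_upper_bound => //; exists x.
  by move: hh; lra.
have [|z [Kz nz Pz hz]] := near_max_eigenvector Kh nh t0 tL hmax e0 e1; first by rewrite te.
exists z; split=> // [x Kx nx|b].
  by have := hmax x Kx nx; move: Pz ee ed d0; lra.
apply: le_trans (hz b) _.
have : Num.sqrt (4 * cL * e) <= d / 2.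
  apply: ler_sq; first lra.
  rewrite sqr_sqrtr; last by rewrite !mulr_ge0 ?(ltW e0)//; lra.
  move: ed2; rewrite ler_pdivlMr ?mulr_gt0//; lra.
lra.
Qed.
End NearMaximizers.

Section BoundedSequences.
Variable R : realType.
(** Bolzano-Weierstrass in finitely many coordinates, stated as a cluster point: [l j] is the limit
    along an ultrafilter containing all tails, found as the supremum of the [r] with [r <= f m j]
    for almost all [m]. *)
Lemma bounded_subseq (J : finType) (f : nat -> J -> R) (C : R) :
  (forall m j, `|f m j| <= C) ->
  exists l : J -> R, forall (e : R) N, 0 < e -> exists2 m, (N <= m)%N & forall j, `|f m j - l j| <= e.
Proof.
move=> bf.
have [F [UF ooF]] := @ultraFilterLemma nat \oo _.
have PF : ProperFilter F by case: UF.
pose A j : set R := [set r | F [set m | r <= f m j]].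
have bnd m j : - C <= f m j <= C by rewrite -ler_norml.
have hA j : has_sup (A j).
  split; first by exists (- C); apply: filterE => m /=; have /andP[] := bnd m j.
  exists C => r Fr; have [m /= rm] := filter_ex Fr.
  by apply: le_trans rm _; have /andP[] := bnd m j.
exists (fun j => sup (A j)) => e N e0.
have h j : F [set m | `|f m j - sup (A j)| <= e].
  have h1 : F [set m | sup (A j) - e <= f m j].
    have [r Ar hr] := sup_adherent e0 (hA j).
    by apply: filterS Ar => m /=; apply: le_trans; exact: ltW.
  have h2 : F [set m | f m j <= sup (A j) + e].
    have [//|h2] := in_ultra_setVsetC [set m | f m j <= sup (A j) + e] UF.
    have : A j (sup (A j) + e).
      by apply: filterS h2 => m /= /negP; rewrite -ltNge => /ltW.
    by move=> /(sup_upper_bound (hA j)); rewrite gerDl leNgt e0.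
  apply: filterS (filterI h1 h2) => m /= [a1 a2].
  by rewrite ler_norml; apply/andP; split; lra.
have hs (r : seq J) : F [set m | (N <= m)%N /\ forall j, j \in r -> `|f m j - sup (A j)| <= e].
  elim: r => [|j r IH].
    by apply: ooF; exists N => // m /= Nm; split.
  apply: filterS (filterI (h j) IH) => m /= [g1 [Nm g2]]; split=> // i.
  by rewrite inE => /orP[/eqP->//|]; exact: g2.
have [m [Nm hm]] := filter_ex (hs (enum J)).
by exists m => // j; apply: hm; rewrite mem_enum.
Qed.
End BoundedSequences.

Section Types.
Variables (R : realType) (H : hilbertType R).
Implicit Types (B S T U : 'B(H)).
Notation "<< x , y >>" := (ip (hH H) x y).
Notation nrm := (nr (hH H)).
Notation nn := (n2 (hH H)).
Variable (AA : set 'B(H)).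
Variables (n : nat) (M : set ('I_n -> H)).
Hypotheses (cM : closed_lin (hT H n) M) (iM : ainv AA M).
Notation QM := (hproj (hT H n) M).
Notation K := (hcocore M).
Notation nrT := (nr (hT H n)).
Implicit Types (P : 'M[R[i]]_n) (x h : H) (w : 'I_n -> R[i]).

Definition pcol P (k : 'I_n) : 'I_n -> R[i] := fun j => P j k.
Definition errT P k x := QM (tens x (dl R k)) - tens x (pcol P k).
(** A sum over the basis instead of an operator norm: subadditive and homogeneous in [x], and zero
    when the projection acts on [x (x) C^n] exactly as [1 (x) P]. *)
Definition EP P x : R := \sum_k nrT (errT P k x).
(* [typ M X P]: near suitable unit vectors [h] of [X], the projection onto [M] acts on
   [h (x) w] as [1 (x) P]. *)
Definition typ (X : set H) P := forall d : R, 0 < d ->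
  exists h, [/\ X h, nn h = 1 & EP P h <= d].
Definition hermproj P := (forall j k, P k j = (P j k)^*) /\ P *m P = P.
(** The value that [phi M w] takes in the limit at unit vectors realising the type [P]. *)
Definition qd P w : R := Re (\sum_j \sum_k (w j)^* * P j k * w k).

Lemma errT_lin P k (a : R[i]) x y : errT P k (a *: x + y) = a *: errT P k x + errT P k y.
Proof.
rewrite /errT !tensDl !tensZl proj_lin//.
by apply: (@ip_inj _ _ (hT H n)) => z; rewrite !(ipDr, ipZr, ipNr); ring.
Qed.
Lemma EP_ge0 P x : 0 <= EP P x.
Proof. by rewrite sumr_ge0// => k _; exact: nr_ge0. Qed.
Lemma errT_le P k x : nrT (errT P k x) <= EP P x.
Proof. by rewrite /EP (bigD1 k)//= lerDl sumr_ge0// => i _; exact: nr_ge0. Qed.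
Lemma EPD P x y : EP P (x + y) <= EP P x + EP P y.
Proof.
rewrite /EP -big_split/=; apply: ler_sum => k _.
by have := errT_lin P k 1 x y; rewrite !scale1r => ->; exact: nrD.
Qed.
Lemma EPZ P (a : R[i]) x : EP P (a *: x) = cmod a * EP P x.
Proof.
rewrite /EP mulr_sumr; apply: eq_bigr => k _.
have e0 : errT P k 0 = 0.
  by rewrite /errT !tens0l (proj_id cM cM.1.1) subr0.
by rewrite -[a *: x]addr0 errT_lin e0 addr0 nrZ.
Qed.
Lemma EP_bd P : exists2 C : R, 0 <= C & forall x, EP P x <= C * nrm x.
Proof.
exists (\sum_k (Num.sqrt (c2 (dl R k)) + Num.sqrt (c2 (pcol P k)))).
  by rewrite sumr_ge0// => k _; rewrite addr_ge0 ?sqrtr_ge0.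
move=> x; rewrite mulr_suml; apply: ler_sum => k _.
apply: le_trans (nrB _ _ _) _; rewrite mulrDl; apply: lerD.
  by apply: le_trans (proj_nr cM _) _; rewrite nr_tens.
by rewrite nr_tens.
Qed.

Definition pv P w : 'I_n -> R[i] := fun j => \sum_k P j k * w k.
Lemma proj_near P w x : nrT (QM (tens x w) - tens x (pv P w)) <= (\sum_k cmod (w k)) * EP P x.
Proof.
have -> : QM (tens x w) - tens x (pv P w) = \sum_k w k *: errT P k x.
  rewrite {1}[w]vec_sum tens_sumr proj_sum//.
  have -> : tens x (pv P w) = \sum_k w k *: tens x (pcol P k).
    apply/funext => j; rewrite fct_sumE /tens /pv scaler_suml; apply: eq_bigr => k _.
    by rewrite -[RHS]/(w k *: (P j k *: x)) scalerA mulrC.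
  rewrite -sumrB; apply: eq_bigr => k _; rewrite tensZr projZ//.
  by rewrite -scalerBr.
apply: le_trans (nr_sum _ _ _ _) _; rewrite mulr_suml; apply: ler_sum => k _.
by rewrite nrZ ler_wpM2l ?cmod_ge0// errT_le.
Qed.

Lemma qdE P w : qd P w = Re (cip (pv P w) w).
Proof.
rewrite /qd /cip /pv; congr Re; apply: eq_bigr => j _; rewrite mulr_suml.
by apply: eq_bigr => k _; rewrite mulrC mulrCA mulrA mulrC mulrA mulrC mulrA mulrC; ring.
Qed.

Lemma phi_near P w x : nn x = 1 ->
  `|phi M w x - qd P w| <= Num.sqrt (c2 w) * (\sum_k cmod (w k)) * EP P x.
Proof.
move=> nx; have -> : phi M w x - qd P w =
    rip (hT H n) (QM (tens x w) - tens x (pv P w)) (tens x w).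
  rewrite !ripE (phiE cM) qdE; congr (_ - _); first by rewrite /rip qopE -ip_tens.
  by rewrite /rip ip_tens slice_tens ipZl ipxx nx mulr1.
apply: le_trans (CSn _ _ _) _; rewrite nr_tens {2}/nr nx sqrtr1 mulr1 mulrC -mulrA.
by rewrite ler_wpM2l ?sqrtr_ge0// proj_near.
Qed.

Lemma eq0_arbitrarily_small (a C : R) : 0 <= C -> 0 <= a -> (forall d : R, 0 < d -> a <= C * d) -> a = 0.
Proof.
move=> C0 a0 h; apply/eqP; rewrite eq_le a0 andbT; apply/ler_addgt0Pl => e e0; rewrite addr0.
have cp : 0 < C + 1 by lra.
apply: le_trans (h (e / (C + 1)) _) _; first by rewrite divr_gt0.
by rewrite mulrA ler_pdivrMr//; nra.
Qed.
Lemma cmod_eq0 (z : R[i]) : cmod z = 0 -> z = 0.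
Proof. by move=> h; apply: sqm_eq0; rewrite -cmod_sq h expr0n. Qed.
Lemma cmodN (z : R[i]) : cmod (- z) = cmod z.
Proof. by rewrite /cmod /sqm cReN cImN !sqrrN. Qed.

(** The entries of [P] are limits of [<Q (h (x) e_k), h (x) e_j>], so [P] inherits self-adjointness
    and idempotence from the projection. *)
Lemma typ_prj X P : typ X P -> hermproj P.
Proof.
move=> tP.
have coef h j k : nn h = 1 -> cmod (ip (hT H n) (QM (tens h (dl R k))) (tens h (dl R j)) - P j k) <= EP P h.
  move=> nh; have -> : ip (hT H n) (QM (tens h (dl R k))) (tens h (dl R j)) - P j k = << errT P k h j, h>>.
    rewrite -[X in _ = << X, h>>]slice_dl -ip_tens /errT ipBl; congr (_ - _).
    by rewrite ip_tens slice_dl ipZl ipxx nh mulr1.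
  apply: le_trans (CSc _ _ _) _; rewrite {2}/nr nh sqrtr1 mulr1.
  exact: le_trans (nr_coord _ _) (errT_le _ _ _).
split=> [j k|].
  apply/eqP; rewrite -subr_eq0; apply/eqP/cmod_eq0/(@eq0_arbitrarily_small _ 2) => //; first exact: cmod_ge0.
  move=> d /tP[h [_ nh hd]]; have h1 := coef h j k nh; have h2 := coef h k j nh.
  pose z := ip (hT H n) (QM (tens h (dl R k))) (tens h (dl R j)).
  have ez : ip (hT H n) (QM (tens h (dl R j))) (tens h (dl R k)) = z^* by rewrite /z -ipC proj_ip.
  rewrite ez in h2; have -> : P k j - (P j k)^* = (z - P j k)^* - (z^* - P k j) by rewrite rmorphB/=; ring.
  apply: le_trans (cmodD _ _) _; rewrite cmodN.
  have -> : cmod (z - P j k)^* = cmod (z - P j k) by rewrite /cmod sqmJ.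
  rewrite -/z in h1; lra.
apply/matrixP => j k; rewrite !mxE.
apply/eqP; rewrite -subr_eq0; apply/eqP/cmod_eq0.
(* One unit for [errT P k h], one for its projection, and the sum for [proj_near] at the column
   [k]. *)
pose C := 1 + \sum_l cmod (P l k) + 1.
have sl : 0 <= \sum_l cmod (P l k) by rewrite sumr_ge0// => l _; exact: cmod_ge0.
apply: (@eq0_arbitrarily_small _ C) => //; first by rewrite /C; lra. exact: cmod_ge0.
move=> d /tP[h [_ nh hd]].
have nh1 : nrm h = 1 by rewrite /nr nh sqrtr1.
(* Q (Q X - h (x) c) is both Q X - Q (h (x) c) and small *)
have e : (\sum_l P j l * P l k - P j k) *: h =
   (errT P k h - (QM (tens h (pcol P k)) - tens h (pv P (pcol P k))) - QM (errT P k h)) j.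
  have QQ : QM (errT P k h) = QM (tens h (dl R k)) - QM (tens h (pcol P k)).
    by rewrite /errT projB// (proj_id cM (proj_in cM _)).
  have -> : errT P k h - (QM (tens h (pcol P k)) - tens h (pv P (pcol P k))) - QM (errT P k h)
     = tens h (pv P (pcol P k)) - tens h (pcol P k).
    rewrite QQ /errT; apply: (@ip_inj _ _ (hT H n)) => z; rewrite !ipBr; ring.
  by rewrite scalerBl.
have -> : cmod (\sum_l P j l * P l k - P j k) = nrm ((\sum_l P j l * P l k - P j k) *: h).
  by rewrite nrZ nh1 mulr1.
rewrite e; apply: le_trans (nr_coord _ _) _.
apply: le_trans (nrB _ _ _) _; apply: le_trans (lerD (nrB _ _ _) (proj_nr cM _)) _.
have := proj_near P (pcol P k) h; have := errT_le P k h => h1 h2.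
have h3 : (\sum_l cmod (P l k)) * EP P h <= (\sum_l cmod (P l k)) * d by rewrite ler_wpM2l.
by rewrite /C !mulrDl !mul1r; move: h1 h2 h3 hd; rewrite /pcol; lra.
Qed.
End Types.

Section MaxType.
Variables (R : realType) (H : hilbertType R).
Notation "<< x , y >>" := (ip (hH H) x y).
Notation nrm := (nr (hH H)).
Notation nn := (n2 (hH H)).
Variable (AA : set 'B(H)).
Hypothesis lpf : left_partial_factorization AA.
Variables (n : nat) (M : set ('I_n -> H)).
Hypotheses (cM : closed_lin (hT H n) M) (iM : ainv AA M).
Notation QM := (hproj (hT H n) M).
Notation K := (hcocore M).
Notation nrT := (nr (hT H n)).
Implicit Types (P : 'M[R[i]]_n) (x h : H).
Variables (u : 'I_n -> R[i]) (L : R).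
Hypothesis L0 : 0 <= L.

(* the quadratic forms at [dl j + dl k] and [dl j + i dl k] determine a sesquilinear form *)
Definition tI : finType := option ('I_n * 'I_n * bool)%type.
Definition tw (b : tI) : 'I_n -> R[i] :=
  if b is Some (j, k, e) then dl R j + (if e then 'i%C else 1) *: dl R k else u.
(** The free weight on [u] is made large in [common_slice] to force [phi M u] to vanish; the unit
    weights on the other test vectors detect strict inclusion of types. *)
Definition tgam (b : tI) : R := if b is Some _ then 1 else L + 1.
Lemma tgam1 b : 1 <= tgam b.
Proof. by case: b => [b|]; rewrite /tgam// lerDr. Qed.
Definition PhiP P : R := \sum_b (tgam b * qd P (tw b) + qd P (tw b) ^+ 2).

Lemma qop_tw j k e h : qop cM (tw (Some (j, k, e))) (tw (Some (j, k, e))) h =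
  let b := if e then 'i%C else 1 in
  qop cM (dl R j) (dl R j) h + b *: qop cM (dl R j) (dl R k) h
  + b^* *: qop cM (dl R k) (dl R j) h + qop cM (dl R k) (dl R k) h.
Proof.
cbv zeta; rewrite !qopE /tw; set b := (if e then _ else _).
have bb : b^* * b = 1 by rewrite mulrC sqmE /b; case: (e); rewrite /sqm /=; apply: complex_eq => /=; ring.
rewrite tensDr tensZr projD// projZ//.
have sl X : slice (dl R j + b *: dl R k) X = slice (dl R j) X + b^* *: slice (dl R k) X.
  rewrite /slice scaler_sumr -big_split/=; apply: eq_bigr => i _.
  by rewrite scalerA -scalerDl; congr (_ *: _); rewrite rmorphD/= rmorphM.
by rewrite sl !sliceD !sliceZ scalerDr scalerA bb scale1r -!addrA.
Qed.

(** Polarisation. The index [(j, j, false)] stands for the vector [2 e_j], whence the factors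
    [4^-1]. *)
Definition polar (f : tI -> R) : 'M[R[i]]_n := \matrix_(j, k)
  (2^-1 * ((f (Some (j, k, false)))%:C - 4^-1 * (f (Some (j, j, false)))%:C
     - 4^-1 * (f (Some (k, k, false)))%:C
   - 'i%C * ((f (Some (j, k, true)))%:C - 4^-1 * (f (Some (j, j, false)))%:C
     - 4^-1 * (f (Some (k, k, false)))%:C))).

Lemma polar_near h (f0 : tI -> R) (e : R) : 0 <= e ->
  (forall b, nrm (qop cM (tw b) (tw b) h - (f0 b)%:C *: h) <= e) ->
  EP M (polar f0) h <= n%:R * n%:R * (2 * e).
Proof.
move=> e0 he.
pose f b := (f0 b)%:C; pose A b := qop cM (tw b) (tw b) h.
pose g b := A b - f b *: h; set P := polar f0.
have key j k : nrm (errT M P k h j) <= 2 * e.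
  have -> : errT M P k h j = 2^-1 *: (g (Some (j, k, false)) - 4^-1 *: g (Some (j, j, false))
      - 4^-1 *: g (Some (k, k, false))
      - 'i%C *: (g (Some (j, k, true)) - 4^-1 *: g (Some (j, j, false)) - 4^-1 *: g (Some (k, k, false)))).
    rewrite -[LHS]/(QM (tens h (dl R k)) j - P j k *: h) /g /A !qop_tw /= mxE -slice_dl -(qopE cM).
    apply: (@ip_inj _ _ (hH H)) => z.
    have ii : ('i%C : R[i])^* * 'i%C^* = -1.
      by rewrite -rmorphM/=; apply: complex_eq; rewrite /=; ring.
    have i2 : ('i%C : R[i])^*^* = 'i%C by rewrite conjCK.
    have iJ : 'i%C^* = - 'i%C :> R[i] by apply: complex_eq => //=; rewrite oppr0.
    have q2 : ((2 : R[i])^-1)^* = 2^-1 by rewrite fmorphV rmorph_nat.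
    have q4 : ((4 : R[i])^-1)^* = 4^-1 by rewrite fmorphV rmorph_nat.
    have isq : 'i%C * 'i%C = -1 :> R[i] by apply: complex_eq; rewrite /=; ring.
    rewrite !(ipDr, ipZr, ipNr) !(rmorphM, rmorphB, rmorphN, rmorphD) /= !conjR !iJ ?rmorph1 ?conjCK ?q2 ?q4 !mul1r.
    have iN : (- 'i%C)^* = 'i%C :> R[i] by rewrite rmorphN/= iJ opprK.
    rewrite ?iN.
    set q1 := ip _ _ _; set a2 := ip _ _ _; set a3 := ip _ _ _; set a4 := ip _ _ _; set a5 := ip _ _ _.
    apply/eqP; rewrite -subr_eq0; apply/eqP.
    transitivity (2^-1 * ('i%C * 'i%C + 1) * (q1 - a4) : R[i]); first by field.
    by rewrite isq; ring.
  have m2 : cmod (2^-1 : R[i]) = 2^-1.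
    have -> : (2^-1 : R[i]) = (2^-1)%:C by rewrite fmorphV rmorph_nat.
    by rewrite cmodR ger0_norm// invr_ge0.
  have m4 : cmod (4^-1 : R[i]) = 4^-1.
    have -> : (4^-1 : R[i]) = (4^-1)%:C by rewrite fmorphV rmorph_nat.
    by rewrite cmodR ger0_norm// invr_ge0.
  have mi : cmod ('i%C : R[i]) = 1 by rewrite /cmod /sqm /= expr0n /= add0r expr1n sqrtr1.
  have h3 b : nrm (g b - 4^-1 *: g (Some (j, j, false)) - 4^-1 *: g (Some (k, k, false))) <= 2 * e.
    have := nrB (hH H) (g b - 4^-1 *: g (Some (j, j, false))) (4^-1 *: g (Some (k, k, false))).
    have := nrB (hH H) (g b) (4^-1 *: g (Some (j, j, false))); rewrite !nrZ m4.
    have := he b; have := he (Some (j, j, false)); have := he (Some (k, k, false)).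
    rewrite -/(g b) -/(g (Some (j, j, false))) -/(g (Some (k, k, false))); lra.
  rewrite nrZ m2; apply: le_trans (ler_wpM2l _ (nrB _ _ _)) _; first by rewrite invr_ge0.
  rewrite nrZ mi mul1r; have := h3 (Some (j, k, false)); have := h3 (Some (j, k, true)); lra.
have k2 k : nrT (errT M P k h) <= n%:R * (2 * e).
  apply: le_trans (nrT_le _) _; apply: (@le_trans _ _ (\sum_(j < n) 2 * e)).
    by apply: ler_sum => j _; exact: key.
  by rewrite sumr_const card_ord -[leLHS]mulr_natl.
apply: (@le_trans _ _ (\sum_(k < n) n%:R * (2 * e))); first by apply: ler_sum => k _; exact: k2.
by rewrite sumr_const card_ord -[leLHS]mulr_natl mulrA.
Qed.

(** At vectors realising the type [P], each [phi M w] tends to [qd P w], so a bound on [Phi] passes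
    to the limit. *)
Lemma PhiP_near P (s : R) (X : set H) : typ M X P ->
  (forall x, X x -> nn x = 1 -> Phi M tw tgam x <= s) -> PhiP P <= s.
Proof.
move=> tP hs; apply/ler_addgt0Pl => e e0.
pose D b : R := Num.sqrt (c2 (tw b)) * \sum_k cmod (tw b k).
have D0 b : 0 <= D b by rewrite mulr_ge0 ?sqrtr_ge0// sumr_ge0// => k _; exact: cmod_ge0.
(* [D b] is the constant of [phi_near]; [C b] adds the slope of [x |-> g x + x^2] between the two
   values, which are at most [c2 (tw b)] and [c2 (tw b) + D b]. *)
pose C b := D b * (tgam b + 2 * c2 (tw b) + D b).
have C0 b : 0 <= C b.
  by have := tgam1 b; have := c2_ge0 (tw b); have := D0 b => *; apply: mulr_ge0 => //; lra.
have SC : 0 <= \sum_b C b by rewrite sumr_ge0.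
have cp : 0 < \sum_b C b + 1 by lra.
pose d := Num.min 1 (e / (\sum_b C b + 1)).
have d0 : 0 < d by rewrite lt_min ltr01 divr_gt0.
have [x [Xx nx Ex]] := tP d d0.
have d1 : d <= 1 by rewrite ge_min lexx.
have de : d * (\sum_b C b + 1) <= e by rewrite -ler_pdivlMr// ge_min lexx orbT.
apply: (@le_trans _ _ (e + Phi M tw tgam x)); last by rewrite lerD2l; exact: hs.
rewrite -lerBlDr /PhiP /Phi -sumrB; apply: (@le_trans _ _ (\sum_b d * C b)); last first.
  by rewrite -mulr_sumr; move: de; rewrite mulrDr mulr1; lra.
apply: ler_sum => b _.
have := phi_near cM P (tw b) nx; rewrite -/(D b) => h.
have {}h : `|phi M (tw b) x - qd P (tw b)| <= D b * d by apply: le_trans h _; rewrite ler_wpM2l.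
have h1 := phi_ge0 M (tw b) x; have := phi_le cM (tw b) x; rewrite nx mulr1 => h2.
have g1 := tgam1 b; have Db := D0 b.
move: h; rewrite ler_norml /C => /andP[]; move: (phi M (tw b) x) (qd P (tw b)) (D b) (c2 (tw b)) (tgam b) h1 h2 g1 Db d0 d1 => p q D' c g h1 h2 g1 Db d0' d1' a1 a2.
have Dd : 0 <= D' * d by rewrite mulr_ge0// ltW.
have DD : D' * d <= D' by rewrite ler_piMr.
have t1 : g * (q - p) <= g * (D' * d) by rewrite ler_wpM2l//; lra.
have t2 : q ^+ 2 - p ^+ 2 <= (D' * d) * (2 * c + D').
  have -> : q ^+ 2 - p ^+ 2 = (q - p) * (q + p) by ring.
  have [qp|qp] := leP 0 (q + p); last by nra.
  apply: (@le_trans _ _ ((D' * d) * (q + p))); first by rewrite ler_wpM2r//; lra.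
  by rewrite ler_wpM2l//; lra.
lra.
Qed.

(** The eigenvalues of approximate maximisers have a cluster value [l]. Blocks that act nearly as
    the scalars [l b] at all test vectors act nearly as the matrix [polar l], which is thus a type,
    and [PhiP] at it bounds [Phi] on the unit sphere of [K]. *)
Theorem max_type : (exists2 x, K x & x != 0) ->
  exists P, typ M K P /\ forall x, K x -> nn x = 1 -> Phi M tw tgam x <= PhiP P.
Proof.
move=> K0.
pose dl m : R := m.+1%:R^-1.
have dl0 m : 0 < dl m by rewrite invr_gt0.
have [z hz] := choice (fun m => approx_max_eigenvector lpf cM iM tw tgam1 K0 (dl0 m)).
have dls e : 0 < e -> exists N, forall m, (N <= m)%N -> dl m <= e.
  move=> e0; exists (Num.truncn e^-1) => m Nm.
  rewrite /dl -[leRHS]invrK lef_pV2 ?posrE ?invr_gt0 ?ltr0n//.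
  by apply: le_trans (ltW (truncnS_gt _)) _; rewrite ler_nat ltnS.
have bd m b : `|phi M (tw b) (z m)| <= cW tw.
  have [_ nz _ _] := hz m; rewrite ger0_norm ?phi_ge0//.
  by have := phi_le cM (tw b) (z m); rewrite nz mulr1 => /le_trans; apply; exact: c2_leW.
have [l hl] := bounded_subseq bd.
pose P := polar l.
have hP e : 0 < e -> exists m, [/\ dl m <= e, forall b, `|phi M (tw b) (z m) - l b| <= e
    & EP M P (z m) <= (n%:R * n%:R * 4) * e].
  move=> e0; have [N hN] := dls e e0; have [m Nm hm] := hl e N e0.
  exists m; split=> //; first exact: hN.
  have [Kz nz _ hq] := hz m.
  have -> : n%:R * n%:R * 4 * e = n%:R * n%:R * (2 * (2 * e)) by ring.
  apply: polar_near => [|b]; first by rewrite mulr_ge0// ltW.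
  have -> : qop cM (tw b) (tw b) (z m) - (l b)%:C *: z m =
      (qop cM (tw b) (tw b) (z m) - (phi M (tw b) (z m))%:C *: z m)
      + (phi M (tw b) (z m) - l b)%:C *: z m.
    by rewrite rmorphB scalerBl addrA subrK.
  apply: le_trans (nrD _ _ _) _; rewrite nrZR (_ : nrm (z m) = 1) ?mulr1; last by rewrite /nr nz sqrtr1.
  by have := hq b; have := hN m Nm; have := hm b; lra.
have tP : typ M K P.
  move=> d d0; pose e := d / (n%:R * n%:R * 4 + 1).
  have np : 0 < n%:R * n%:R * 4 + 1 :> R by rewrite ltr_wpDl// !mulr_ge0.
  have [m [_ _ hm]] := hP e (divr_gt0 d0 np).
  have [Kz nz _ _] := hz m; exists (z m); split=> //; apply: le_trans hm _.
  rewrite /e mulrA ler_pdivrMr// mulrC ler_wpM2l ?(ltW d0)//.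
  by rewrite lerDl.
exists P; split=> // x Kx nx; apply/ler_addgt0Pl => e e0.
pose D b : R := Num.sqrt (c2 (tw b)) * \sum_k cmod (tw b k).
(* The same vectors bring [phi M (tw b)] close to [l b] and, through the type, close to
   [qd P (tw b)]. *)
have ql b : qd P (tw b) = l b.
  apply/eqP; rewrite -subr_eq0 -normr_eq0; apply/eqP.
  have D0 : 0 <= D b by rewrite mulr_ge0 ?sqrtr_ge0// sumr_ge0// => k _; exact: cmod_ge0.
  apply: (@eq0_arbitrarily_small _ _ (D b * (n%:R * n%:R * 4) + 1)) => [||d d0]; last 1 first.
  - have [m [_ h1 h2]] := hP d d0; have [_ nz _ _] := hz m.
    have := phi_near cM P (tw b) nz; rewrite -/(D b) => h3.
    have : D b * EP M P (z m) <= D b * ((n%:R * n%:R * 4) * d) by rewrite ler_wpM2l.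
    have := h1 b; have := ler_distD (phi M (tw b) (z m)) (qd P (tw b)) (l b).
    have -> : (D b * (n%:R * n%:R * 4) + 1) * d = D b * (n%:R * n%:R * 4 * d) + d by ring.
    by rewrite (distrC (qd P (tw b)) (phi M (tw b) (z m))); move: h3; lra.
  - by apply: addr_ge0 => //; apply: mulr_ge0 => //; rewrite !mulr_ge0.
  - by [].
pose C b := tgam b + 2 * cW tw.
have W1 : 1 <= cW tw := cW_ge1 tw.
have C0 b : 0 <= C b by rewrite /C; have := tgam1 b; lra.
have SC : 0 <= \sum_b C b by rewrite sumr_ge0.
have cp : 0 < \sum_b C b + 1 by lra.
pose d := e / (\sum_b C b + 1).
have d0 : 0 < d by rewrite divr_gt0.
have de : d * (\sum_b C b + 1) = e by rewrite divfK ?gt_eqF.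
have [m [dm hm _]] := hP d d0; have [Kz nz hmax _] := hz m.
have := hmax x Kx nx.
have : Phi M tw tgam (z m) - PhiP P <= \sum_b d * C b.
  rewrite /Phi /PhiP -sumrB; apply: ler_sum => b _; rewrite ql.
  have := hm b; have := phi_ge0 M (tw b) (z m); have := bd m b.
  have lW : l b <= cW tw + d.
    by have := hm b; have := bd m b; rewrite !ler_norml => /andP[_ ?] /andP[? _]; lra.
  have lW' : l b <= cW tw.
    apply/ler_addgt0Pl => e' e0'; have [m' [_ h1 _]] := hP e' e0'.
    by have := h1 b; have := bd m' b; rewrite !ler_norml => /andP[_ ?] /andP[? _]; lra.
  have g1 := tgam1 b; rewrite /C.
  move: (phi M (tw b) (z m)) (l b) (tgam b) (cW tw) lW' g1 W1 => p q g c qc g1 W1.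
  rewrite !ler_norml => /andP[_ pc] p0 /andP[a1 a2].
  have t1 : g * (p - q) <= g * d by rewrite ler_wpM2l//; lra.
  have t2 : p ^+ 2 - q ^+ 2 <= d * (2 * c).
    have -> : p ^+ 2 - q ^+ 2 = (p - q) * (p + q) by ring.
    have [qp|qp] := leP 0 (q + p); last by nra.
    apply: (@le_trans _ _ (d * (p + q))); first by rewrite ler_wpM2r//; lra.
    by rewrite ler_wpM2l ?(ltW d0)//; lra.
  lra.
rewrite -mulr_sumr; move: de dm; rewrite mulrDr mulr1; lra.
Qed.
End MaxType.

(** * Comparability of types *)

Section Factorizations.
Variables (R : realType) (H : hilbertType R).
Notation "<< x , y >>" := (ip (hH H) x y).
Notation nrm := (nr (hH H)).
Notation nn := (n2 (hH H)).
Variable (AA : set 'B(H)).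
Hypothesis lpf : left_partial_factorization AA.
Variables (n : nat) (M : set ('I_n -> H)).
Hypotheses (cM : closed_lin (hT H n) M) (iM : ainv AA M).
Notation QM := (hproj (hT H n) M).
Notation nrT := (nr (hT H n)).
Notation E := (EP M).
Implicit Types (P : 'M[R[i]]_n) (x h : H).

Definition fac_rel (S S' U : 'B(H)) := [/\ isometry U,
  forall X, M X -> M (amp (S' * U) X) &
  forall Y, perp (hT H n) M Y -> perp (hT H n) M (amp (adjoint S * U) Y)].

Lemma fac_rel_ex S S' : S * S' = 1 -> S' * S = 1 -> exists U, fac_rel S S' U.
Proof.
by move=> h1 h2; have [U [iU hU _]] := left_pfp lpf h1 h2; exists U; have [] := hU n M iM.
Qed.

(** Recovers [U h] from [amp U X] when [X] is close to [h (x) c]; slicing by [d] works as soon as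
    [d] is not orthogonal to [c]. *)
Lemma slice_near (U : 'B(H)) (c d : 'I_n -> R[i]) (kap : R[i]) h X :
  isometry U -> cip c d = kap -> kap != 0 ->
  nrm (kap^-1 *: slice d (amp U X) - U h) <=
    cmod kap^-1 * (Num.sqrt (c2 d) * nrT (X - tens h c)).
Proof.
move=> iU cd k0.
have -> : kap^-1 *: slice d (amp U X) - U h = kap^-1 *: slice d (amp U (X - tens h c)).
  rewrite ampB amp_tens sliceB slice_tens cd scalerBr scalerA mulVf// scale1r//.
rewrite nrZ ler_wpM2l ?cmod_ge0//; apply: le_trans (nr_slice _ _) _.
by rewrite ler_wpM2l ?sqrtr_ge0// (amp_isom iU).
Qed.

(** Column [k] of [1 - P]. *)
Definition dlc (P : 'M[R[i]]_n) k : 'I_n -> R[i] := fun j => dl R k j - P j k.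

Lemma tens_dlc P k x : tens x (dl R k) - QM (tens x (dl R k)) = tens x (dlc P k) - errT M P k x.
Proof.
apply: (@ip_inj _ _ (hT H n)) => z; rewrite /errT !(ipDr, ipNr) !(ipC (hT H n) _ z) !ip_tens'.
have -> : slice (dlc P k) z = slice (dl R k) z - slice (pcol P k) z.
  by rewrite /slice -sumrB; apply: eq_bigr => j _; rewrite rmorphB scalerBl.
rewrite ipBr rmorphB/=; ring.
Qed.

Lemma nr_tens_dl x i : nrT (tens x (dl R i)) = nrm x.
Proof.
rewrite nr_tens (_ : c2 (dl R i) = 1) ?sqrtr1 ?mul1r//.
rewrite /c2 (bigD1 i)//= big1 => [|k ki]; rewrite /dl /sqm.
  by rewrite eqxx /=; ring.
by rewrite (negbTE ki) /=; ring.
Qed.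

Section Pair.
Variables (P P' : 'M[R[i]]_n).
Hypotheses (pP : hermproj P) (pP' : hermproj P').

(** Let [h] be nearly of type [P'] and [x] nearly of type [P]. Then [y] is close to
    [h (x) (1 - P') e_i], [amp U y] is orthogonal to [S M], and [S M] nearly contains
    [S x (x) P e_j]. A nonzero entry of [(1 - P') P] allows slicing by [P e_j], so [U h] is nearly
    orthogonal to [S x]. *)
Lemma near_orth_image : P' *m P <> P -> exists2 C : R, 0 <= C & forall S S' U s, fac_rel S S' U -> 0 <= s ->
  (forall x, nrm (S x) <= s * nrm x) ->
  forall h, exists g, nrm (g - U h) <= C * E P' h /\
    forall x, cmod << g, S x>> <= C * s * nrm h * E P x.
Proof.
move=> nP.
have [[i j] ij] : exists ij : 'I_n * 'I_n, ((1%:M - P') *m P) ij.1 ij.2 != 0.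
  apply: contra_notP nP => h; apply/esym/eqP; rewrite -subr_eq0 -{1}[P]mul1mx -mulmxBl.
  apply/eqP/matrixP => i j; rewrite [RHS]mxE; apply/eqP/negPn/negP => hij.
  by apply: h; exists (i, j).
pose c := dlc P' i; pose d := pcol P j; pose kap := cip c d.
have k0 : kap != 0.
  have -> : kap = (((1%:M - P') *m P) i j)^*.
    rewrite mxE rmorph_sum; apply: eq_bigr => l _; rewrite rmorphM/= !mxE /c /dlc /d /pcol /dl.
    by rewrite rmorphB/= rmorph_nat -(pP'.1 i l) eq_sym.
  by rewrite conjC_eq0.
pose Cd := Num.sqrt (c2 d).
exists (cmod kap^-1 * (Cd + 1)).
  by rewrite mulr_ge0 ?cmod_ge0// addr_ge0// sqrtr_ge0.
move=> S S' U s [iU hM hMp] s0 bS h.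
pose y := tens h (dl R i) - QM (tens h (dl R i)).
have py : perp (hT H n) M y by exact: proj_perp.
exists (kap^-1 *: slice d (amp U y)); split.
  apply: le_trans (slice_near h y iU erefl k0) _.
  rewrite -mulrA ler_wpM2l ?cmod_ge0//.
  have -> : y - tens h c = - errT M P' i h.
    by rewrite /y (tens_dlc P' i) addrC addKr.
  rewrite nrN; have := errT_le M P' i h; have := EP_ge0 M P' h; have := sqrtr_ge0 (c2 d).
  rewrite -/Cd; have := nr_ge0 (hT H n) (errT M P' i h); nra.
move=> x; rewrite ipZl cmodM -!mulrA ler_wpM2l ?cmod_ge0//.
have e1 : << slice d (amp U y), S x>> = - ip (hT H n) (amp U y) (amp S (errT M P j x)).
  have h0 : ip (hT H n) (QM (tens x (dl R j))) (amp (adjoint S * U) y) = 0.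
    by apply: hMp => //; exact: proj_in.
  have {}h0 : ip (hT H n) (amp U y) (amp S (QM (tens x (dl R j)))) = 0.
    by move: h0; rewrite ampM -amp_adj => h0; rewrite ipC h0 rmorph0.
  have -> : amp S (errT M P j x) = amp S (QM (tens x (dl R j))) - amp S (tens x d) by exact: ampB.
  by rewrite -ip_tens -amp_tens ipBr h0 sub0r opprK.
rewrite e1 cmodN; apply: le_trans (CSc _ _ _) _.
have b1 : nrT (amp U y) <= nrm h.
  rewrite (amp_isom iU); apply: le_trans (projC_nr cM _) _.
  by rewrite nr_tens_dl.
have b2 : nrT (amp S (errT M P j x)) <= s * E P x.
  apply: le_trans (amp_bd bS s0 _) _; rewrite ler_wpM2l//; exact: errT_le.
have sE : 0 <= s * E P x by rewrite mulr_ge0// EP_ge0.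
have -> : (Cd + 1) * (s * (nrm h * E P x)) = (Cd + 1) * (nrm h * (s * E P x)) by ring.
have : nrT (amp U y) * nrT (amp S (errT M P j x)) <= nrm h * (s * E P x).
  by apply: ler_pM => //; exact: nr_ge0.
have : 0 <= nrm h * (s * E P x) by rewrite mulr_ge0// nr_ge0.
have := sqrtr_ge0 (c2 d); rewrite -/Cd; nra.
Qed.

(** Dual to [near_orth_image]: [S' U] keeps [Q (h (x) e_j)], which is close to [h (x) P' e_j],
    inside [M], hence orthogonal to a vector close to [x (x) (1 - P) e_i]. *)
Lemma near_orth_preimage : P *m P' <> P' -> exists2 C : R, 0 <= C & forall S S' U s, fac_rel S S' U -> 0 <= s ->
  (forall x, nrm (S' x) <= s * nrm x) ->
  forall h, exists g, nrm (g - U h) <= C * E P' h /\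
    forall x, cmod << S' g, x>> <= C * s * nrm h * E P x.
Proof.
move=> nP.
have [[i j] ij] : exists ij : 'I_n * 'I_n, ((1%:M - P) *m P') ij.1 ij.2 != 0.
  apply: contra_notP nP => h; apply/esym/eqP; rewrite -subr_eq0 -{1}[P']mul1mx -mulmxBl.
  apply/eqP/matrixP => i j; rewrite [RHS]mxE; apply/eqP/negPn/negP => hij.
  by apply: h; exists (i, j).
pose c := pcol P' j; pose d := dlc P i; pose kap := cip c d.
have k0 : kap != 0.
  have -> : kap = ((1%:M - P) *m P') i j.
    rewrite mxE; apply: eq_bigr => l _; rewrite !mxE /c /d /dlc /pcol /dl.
    by rewrite rmorphB/= rmorph_nat -(pP.1 l i) mulrC eq_sym.
  by [].
pose Cd := Num.sqrt (c2 d).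
exists (cmod kap^-1 * (Cd + 1)).
  by rewrite mulr_ge0 ?cmod_ge0// addr_ge0// sqrtr_ge0.
move=> S S' U s [iU hM hMp] s0 bS h.
pose X := QM (tens h (dl R j)).
have MX : M X by exact: proj_in.
exists (kap^-1 *: slice d (amp U X)); split.
  apply: le_trans (slice_near h X iU erefl k0) _.
  rewrite -mulrA ler_wpM2l ?cmod_ge0//.
  rewrite -/(errT M P' j h).
  have := errT_le M P' j h; have := EP_ge0 M P' h; have := sqrtr_ge0 (c2 d).
  rewrite -/Cd; have := nr_ge0 (hT H n) (errT M P' j h); nra.
move=> x; rewrite bopZ ipZl cmodM -!mulrA ler_wpM2l ?cmod_ge0//.
have e1 : << S' (slice d (amp U X)), x>> = ip (hT H n) (amp (S' * U) X) (errT M P i x).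
  rewrite -amp_slice -ip_tens -ampM.
  have -> : tens x d = (tens x (dl R i) - QM (tens x (dl R i))) + errT M P i x.
    by rewrite (tens_dlc P i) subrK.
  rewrite ipDr (_ : ip _ _ (_ - _) = 0) ?add0r//.
  by apply: (proj_perp cM); exact: hM.
rewrite e1; apply: le_trans (CSc _ _ _) _.
have b1 : nrT (amp (S' * U) X) <= s * nrm h.
  rewrite ampM; apply: le_trans (amp_bd bS s0 _) _; rewrite ler_wpM2l// (amp_isom iU).
  by apply: le_trans (proj_nr cM _) _; rewrite nr_tens_dl.
have : nrT (amp (S' * U) X) * nrT (errT M P i x) <= (s * nrm h) * E P x.
  by apply: ler_pM => //; [exact: nr_ge0|exact: nr_ge0|exact: errT_le].
have : 0 <= (s * nrm h) * E P x by rewrite !mulr_ge0 ?nr_ge0 ?EP_ge0.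
have -> : (Cd + 1) * (s * (nrm h * E P x)) = (Cd + 1) * ((s * nrm h) * E P x) by ring.
have := sqrtr_ge0 (c2 d); rewrite -/Cd; nra.
Qed.

(** Approximate eigenvectors for distinct eigenvalues: moving the projection across the inner
    product of [h (x) e_k] and [x (x) e_l] gives the factor [P l k] on one side and [P' l k] on the
    other. *)
Lemma types_almost_orth : P <> P' -> exists2 C : R, 0 <= C & forall h x,
  cmod << h, x>> <= C * (E P' h * nrm x + E P x * nrm h).
Proof.
move=> nP.
have [[l k] lk] : exists ij : 'I_n * 'I_n, (P' - P) ij.1 ij.2 != 0.
  apply: contra_notP nP => h; apply/esym/eqP; rewrite -subr_eq0.
  apply/eqP/matrixP => i j; rewrite [RHS]mxE; apply/eqP/negPn/negP => hij.
  by apply: h; exists (i, j).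
pose kap := (P' - P) l k; exists (cmod kap^-1); first exact: cmod_ge0.
move=> h x.
have e : kap * << h, x>> = ip (hT H n) (tens h (dl R k)) (errT M P l x) - ip (hT H n) (errT M P' k h) (tens x (dl R l)).
  have e1 : ip (hT H n) (tens h (dl R k)) (tens x (pcol P l)) = P l k * << h, x>>.
    by rewrite ip_tens' slice_dl -[tens x _ k]/(P k l *: x) ipZr -(pP.1 k l).
  have e2 : ip (hT H n) (tens h (pcol P' k)) (tens x (dl R l)) = P' l k * << h, x>>.
    by rewrite ip_tens slice_dl -[tens h _ l]/(P' l k *: h) ipZl.
  by rewrite /errT ipBl ipBr e1 e2 proj_ip// /kap !mxE; ring.
have k0 : cmod kap * cmod kap^-1 = 1.
  by rewrite -cmodM mulfV// /cmod /sqm /= expr0n /= addr0 expr1n sqrtr1.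
have -> : cmod << h, x>> = cmod kap^-1 * cmod (kap * << h, x>>).
  by rewrite cmodM mulrA (mulrC (cmod kap^-1)) k0 mul1r.
rewrite ler_wpM2l ?cmod_ge0// e; apply: le_trans (cmodD _ _) _; rewrite cmodN.
have := CSc (hT H n) (tens h (dl R k)) (errT M P l x).
have := CSc (hT H n) (errT M P' k h) (tens x (dl R l)).
rewrite !nr_tens_dl.
have := errT_le M P l x; have := errT_le M P' k h => a1 a2.
have := ler_wpM2r (nr_ge0 (hH H) x) a1; have := ler_wpM2r (nr_ge0 (hH H) h) a2; lra.
Qed.
End Pair.

(** For this [S], the images under [U] of the two parts of [h (x) e_k] lie in [M] and in its
    complement up to the corrections [A1] and [B1]. These are governed by the components of [U h]
    along [r1] and [r2]; if both are small, [U h] keeps the type of [h]. *)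
Lemma shear_type P : exists2 C : R, 0 <= C & forall r1 r2 U, nrm r1 <= 1 -> nrm r2 <= 1 ->
  fac_rel (1 + rk1 r2 r1) (1 - rk1 r2 r1) U ->
  forall h, E P (U h) <= C * (E P h + cmod << U h, r1>> + cmod << U h, r2>>).
Proof.
have rkb u v : nrm u <= 1 -> nrm v <= 1 -> forall x, nrm (rk1 u v x) <= 1 * nrm x.
  move=> nu nv x; rewrite rk1E nrZ mul1r.
  have c1 := CSc (hH H) x v.
  have e1 : nrm x * nrm v <= nrm x by rewrite ler_piMr ?nr_ge0.
  have : cmod << x, v>> * nrm u <= cmod << x, v>> by rewrite ler_piMr ?cmod_ge0.
  lra.
pose Ck k : R := 4 + 2 * Num.sqrt (c2 (pcol P k)) + Num.sqrt (c2 (dlc P k)).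
have Ck0 k : 0 <= Ck k.
  by rewrite /Ck; have := sqrtr_ge0 (c2 (pcol P k)); have := sqrtr_ge0 (c2 (dlc P k)); lra.
exists (\sum_k Ck k); first by rewrite sumr_ge0.
move=> r1 r2 U n1 n2' [iU hM hMp] h; rewrite mulr_suml; apply: ler_sum => k _.
pose m := QM (tens h (dl R k)); pose y := tens h (dl R k) - m.
pose a := amp U m; pose b := amp U y.
pose A1 := amp (rk1 r2 r1) a; pose B1 := amp (rk1 r1 r2) b.
have aA : M (a - A1) by have := hM m (proj_in cM _); congr (M _); apply/funext.
have bB : perp (hT H n) M (b + B1).
  have := hMp y (proj_perp cM _).
  by rewrite bop_adjD bop_adj1 rk1_adj; congr (perp _ _ _); apply/funext.
have bE : b = amp U (tens h (dl R k)) - a by rewrite -ampB.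
have e : errT M P k (U h) = amp U (errT M P k h) + (QM A1 - A1 - QM B1).
  have -> : QM A1 - A1 - QM B1 = QM (tens (U h) (dl R k)) - a.
    have q1 : QM a - QM A1 = a - A1 by rewrite -projB// (proj_id cM aA).
    have q2 : QM b + QM B1 = 0 by rewrite -projD// (proj_0 cM bB).
    have q3 : QM b = QM (tens (U h) (dl R k)) - QM a by rewrite bE projB// amp_tens.
    apply: (@rip_inj _ _ (hT H n)) => z.
    have := congr1 (rip (hT H n) z) q1; have := congr1 (rip (hT H n) z) q2; rewrite q3.
    by rewrite !(ripDr, ripNr, rip0r); lra.
  rewrite /errT ampB -/m -/a amp_tens.
  apply: (@ip_inj _ _ (hT H n)) => z; rewrite !(ipDr, ipNr); ring.
have er := errT_le M P k h; have er0 := nr_ge0 (hT H n) (errT M P k h).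
have nA : nrT A1 <= Num.sqrt (c2 (pcol P k)) * cmod << U h, r1>> + nrT (errT M P k h).
  have -> : A1 = tens (rk1 r2 r1 (U h)) (pcol P k) + amp (rk1 r2 r1) (amp U (errT M P k h)).
    by rewrite -amp_tens -ampD -amp_tens -ampD /errT addrC subrK.
  apply: le_trans (nrD _ _ _) _; apply: lerD.
    by rewrite nr_tens ler_wpM2l ?sqrtr_ge0// rk1E nrZ ler_piMr ?cmod_ge0.
  by apply: le_trans (amp_bd (rkb _ _ n2' n1) ler01 _) _; rewrite mul1r (amp_isom iU).
have nB : nrT B1 <= Num.sqrt (c2 (dlc P k)) * cmod << U h, r2>> + nrT (errT M P k h).
  have -> : B1 = tens (rk1 r1 r2 (U h)) (dlc P k) - amp (rk1 r1 r2) (amp U (errT M P k h)).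
    by rewrite -amp_tens -ampB -amp_tens -ampB /B1 /b /y /m (tens_dlc P k).
  apply: le_trans (nrB _ _ _) _; apply: lerD.
    by rewrite nr_tens ler_wpM2l ?sqrtr_ge0// rk1E nrZ ler_piMr ?cmod_ge0.
  by apply: le_trans (amp_bd (rkb _ _ n1 n2') ler01 _) _; rewrite mul1r (amp_isom iU).
have t1 : nrT (errT M P k (U h)) <= nrT (errT M P k h) + 2 * nrT A1 + nrT B1.
  rewrite e; have := nrD (hT H n) (amp U (errT M P k h)) (QM A1 - A1 - QM B1).
  have := nrB (hT H n) (QM A1 - A1) (QM B1); have := nrB (hT H n) (QM A1) A1.
  by have := proj_nr cM A1; have := proj_nr cM B1; rewrite (amp_isom iU); lra.
apply: le_trans t1 _; rewrite /Ck.
have p1 := sqrtr_ge0 (c2 (pcol P k)); have p2 := sqrtr_ge0 (c2 (dlc P k)).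
have c1 := cmod_ge0 << U h, r1>>; have c2' := cmod_ge0 << U h, r2>>.
have E0 := EP_ge0 M P h.
have s1 := mulr_ge0 p1 E0; have s2 := mulr_ge0 p2 E0.
have s3 := mulr_ge0 p1 c2'; have s4 := mulr_ge0 p2 c1.
by have s5 := mulr_ge0 p1 c1; have s6 := mulr_ge0 p2 c2'; rewrite !mulrDl !mulrDr; lra.
Qed.

(** Bessel's inequality for nearly orthonormal vectors; the loss [N k] accounts for the off-diagonal
    part of the Gram matrix. *)
Lemma almost_bessel N (u : nat -> H) (k : R) l : 0 <= k ->
  (forall i, nn (u i) = 1) ->
  (forall i j, (j < i < N)%N -> cmod << u i, u j>> <= k) ->
  \sum_(i < N) sqm << l, u i>> <= nn l * (1 + N%:R * k).
Proof.
move=> k0 u1 uk; pose c i := << l, u i>>; pose v := \sum_(i < N) c i *: u i.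
set s := \sum_(i < N) _.
have s0 : 0 <= s by rewrite sumr_ge0// => i _; exact: sqm_ge0.
have lv : rip (hH H) l v = s.
  rewrite /rip ip_sumr cRe_sum; apply: eq_bigr => i _.
  by rewrite ipZr mulrC sqmE.
have uk' (i j : 'I_N) : i != j -> cmod << u i, u j>> <= k.
  move=> ij; have [lt|lt|/val_inj e] := ltngtP i j.
  - by rewrite ipC /cmod sqmJ; apply: uk; rewrite lt ltn_ord.
  - by apply: uk; rewrite lt ltn_ord.
  - by rewrite e eqxx in ij.
have nv : nn v <= s * (1 + N%:R * k).
  have -> : s * (1 + N%:R * k) = \sum_(i < N) (sqm (c i) + \sum_(j < N) k * (sqm (c i) + sqm (c j)) / 2).
    rewrite big_split/= -/s mulrDr mulr1; congr (_ + _).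
    transitivity (\sum_(i < N) (k / 2 * (N%:R * sqm (c i) + s))).
      by rewrite -mulr_sumr big_split/= -mulr_sumr sumr_const card_ord -[s *+ N]mulr_natl -/s; field.
    apply: eq_bigr => i _; rewrite -mulr_suml -mulr_sumr big_split/= sumr_const card_ord -[_ *+ N]mulr_natl -/s.
    by ring.
  rewrite /n2 /v rip_suml; apply: ler_sum => i _; rewrite rip_sumr (bigD1 i)//=; apply: lerD.
    by rewrite ripZZ -/(nn (u i)) u1 mulr1.
  rewrite [leRHS](bigD1 i)//= ler_wpDl//.
    by apply: divr_ge0 => //; apply: mulr_ge0 => //; apply: addr_ge0; exact: sqm_ge0.
  apply: ler_sum => j ji; rewrite /rip; apply: le_trans (ler_norm _) _.
  apply: le_trans (Re_le_cmod _) _; rewrite ipZl ipZr !cmodM.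
  have -> : cmod (c j)^* = cmod (c j) by rewrite /cmod sqmJ.
  have := @uk' i j; rewrite eq_sym ji => /(_ isT) h.
  rewrite -!cmod_sq.
  have a0 := cmod_ge0 (c i); have b0 := cmod_ge0 (c j).
  have h1 : cmod (c j) * cmod << u i, u j>> <= cmod (c j) * k by rewrite ler_wpM2l.
  have h2 := ler_wpM2l a0 h1.
  have h3 : 0 <= k * (cmod (c i) - cmod (c j)) ^+ 2 by rewrite mulr_ge0// sqr_ge0.
  by nra.
have := CS (hH H) l v; rewrite lv => h.
have nl := n2_ge0 (hH H) l.
have h2 : nn l * nn v <= nn l * (s * (1 + N%:R * k)) by rewrite ler_wpM2l.
have [->|sn] := eqVneq s 0; first by rewrite mulr_ge0// addr_ge0// mulr_ge0.
have sp : 0 < s by rewrite lt_def sn.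
by rewrite -(ler_pM2l sp); move: h h2; rewrite expr2; lra.
Qed.

(** The test operator is [1 + rk1 r2 r1] with [r1] of type [P] and [r2] nearly of type [P']. It
    keeps [U h] nearly orthogonal to both when [h] is of type [P], so by [shear_type] [U h] is again
    nearly of type [P] and [U] can be iterated. The constant [C] is independent of [e]. *)
Lemma essential_step P P' : typ M setT P -> typ M setT P' -> P' *m P <> P -> P *m P' <> P' ->
  exists (C e0 : R), [/\ 1 <= C, 0 < e0 & forall e, 0 < e -> e <= e0 ->
    exists r U, [/\ isometry U, nn r = 1, E P r <= e & forall h, nrm h <= 1 ->
      cmod << U h, r>> <= C * (E P h + e) /\ E P (U h) + e <= C * (E P h + e)]].
Proof.
move=> tP tP' n1 n2'.
have pP := typ_prj cM tP; have pP' := typ_prj cM tP'.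
have nPP : P <> P' by move=> e; apply: n1; rewrite -e pP.2.
have [Ca Ca0 hA] := near_orth_image pP n2'.
have [Cb Cb0 hB] := near_orth_preimage pP' n1.
have [Cc Cc0 hC] := types_almost_orth pP nPP.
have [Ce Ce0 hE] := EP_bd cM P'.
have [Cs Cs0 hS] := shear_type P.
pose C2 := 1 + 2 * Cc * Ce.
pose D1 := 2 * Ca * C2 + Ca.
pose D2 := 2 * (D1 + Cb + 2 * Cb * C2) + Cb.
have C20 : 0 <= C2 by rewrite /C2 addr_ge0// !mulr_ge0.
have D10 : 0 <= D1 by rewrite /D1 addr_ge0// !mulr_ge0.
have CbC2 : 0 <= Cb * C2 by rewrite mulr_ge0.
have D20 : 0 <= D2 by rewrite /D2; lra.
pose C := Cs * (1 + D1 + D2) + D2 + 1.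
have CsD : 0 <= Cs * (1 + D1 + D2) by rewrite mulr_ge0//; lra.
have cc : 0 < 4 * Cc + 1 by lra.
(* Ensures [|rho| <= 1 / 2], so that [r2], the part of [r2'] orthogonal to [r1], keeps squared norm
   at least one half. *)
exists C, ((4 * Cc + 1)^-1); split; [by rewrite /C; lra|by rewrite invr_gt0|].
move=> e e0 ele.
have ce : 2 * Cc * e <= 2^-1.
  have : e * (4 * Cc + 1) <= 1 by rewrite -ler_pdivlMr// div1r.
  by move: e0; lra.
have [r1 [_ nr1 Er1]] := tP e e0; have [r2' [_ nr2 Er2]] := tP' e e0.
have r1n : nrm r1 = 1 by rewrite /nr nr1 sqrtr1.
have r2n : nrm r2' = 1 by rewrite /nr nr2 sqrtr1.
pose rho := << r2', r1>>; pose r2 := r2' - rho *: r1.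
have rhoe : cmod rho <= 2 * Cc * e.
  apply: le_trans (hC r2' r1) _; rewrite r1n r2n !mulr1.
  have : Cc * (E P' r2' + E P r1) <= Cc * (e + e) by rewrite ler_wpM2l// lerD.
  lra.
have o21 : << r2, r1>> = 0 by rewrite /r2 ipBl ipZl ipxx nr1 rmorph1 mulr1 subrr.
have n2r2 : nn r2 = 1 - sqm rho.
  have : nn r2' = nn r2 + sqm rho.
    rewrite -[in LHS](subrK (rho *: r1) r2') -/r2 n2D n2Z nr1 mulr1.
    by rewrite /rip ipZr o21 mulr0 /=; ring.
  rewrite nr2; lra.
have r2le : nrm r2 <= 1.
  rewrite -sqrtr1 /nr ler_wsqrtr// n2r2; have := sqm_ge0 rho; lra.
have r2ge : 2^-1 <= nn r2.
  rewrite n2r2 -cmod_sq; have := cmod_ge0 rho; have := sqr_ge0 (cmod rho); nra.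
have Er2e : E P' r2 <= C2 * e.
  have -> : r2 = r2' + (- rho) *: r1 by rewrite scaleNr.
  apply: le_trans (EPD cM _ _ _) _; rewrite (EPZ cM) cmodN.
  have h1 : cmod rho * E P' r1 <= 2 * Cc * e * Ce.
    apply: ler_pM => //; [exact: cmod_ge0|exact: EP_ge0|].
    by have := hE r1; rewrite r1n mulr1.
  by rewrite /C2; lra.
have [|i1 i2] := @rk1_inv _ _ r2 r1 1; first by rewrite o21 addr0 mulr1.
rewrite scale1r in i1 i2.
have [U hU] := fac_rel_ex i1 i2.
have iU : isometry U by case: hU.
have bR x : nrm (rk1 r2 r1 x) <= nrm x.
  rewrite rk1E nrZ; have := CSc (hH H) x r1; rewrite r1n mulr1 => h1.
  have : cmod << x, r1>> * nrm r2 <= cmod << x, r1>> by rewrite ler_piMr ?cmod_ge0.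
  lra.
have bS x : nrm ((1 + rk1 r2 r1) x) <= 2 * nrm x.
  by rewrite bopDE bop1E; have := nrD (hH H) x (rk1 r2 r1 x); have := bR x; lra.
have bS' x : nrm ((1 - rk1 r2 r1) x) <= 2 * nrm x.
  by rewrite bopDE bopNE bop1E; have := nrB (hH H) x (rk1 r2 r1 x); have := bR x; lra.
have close g x y : nrm y <= 1 -> cmod << x, y>> <= cmod << g, y>> + nrm (g - x).
  move=> y1; have -> : << x, y>> = << g, y>> - << g - x, y>> by rewrite ipBl; ring.
  apply: le_trans (cmodD _ _) _; rewrite cmodN lerD2l; apply: le_trans (CSc _ _ _) _.
  by rewrite ler_piMr ?nr_ge0.
have key h : nrm h <= 1 -> cmod << U h, r2>> <= D1 * (E P h + e) /\
     cmod << U h, r1>> <= D2 * (E P h + e).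
  move=> h1; have e1 := EP_ge0 M P h; have nh := nr_ge0 (hH H) h.
  have C2e : 0 <= C2 * e by rewrite mulr_ge0// ltW.
  have hc2 : nrm h * E P' r2 <= C2 * e.
    by have : nrm h * E P' r2 <= E P' r2 by [rewrite ler_piMl ?EP_ge0]; lra.
  (* [S] fixes [r2], so [near_orth_image] controls [<U h, r2>] directly. *)
  have [g [g1 g2]] := hA _ _ _ 2 hU (ler0n _ 2) bS h.
  have := g2 r2; rewrite bopDE bop1E rk1E o21 scale0r addr0 => g3.
  have g4 : cmod << g, r2>> <= 2 * Ca * (C2 * e).
    by have h5 := ler_wpM2l Ca0 hc2; apply: le_trans g3 _; lra.
  have c1 := close g (U h) r2 r2le.
  have b1 : cmod << U h, r2>> <= D1 * (E P h + e).
    have : 0 <= Ca * e by rewrite mulr_ge0// ltW.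
    have : 0 <= 2 * Ca * C2 * E P h by rewrite !mulr_ge0.
    by rewrite /D1; move: g1; lra.
  split=> //.
  (* [S' g' = g' - <g', r1> r2]; as [<g', r2>] is already small, pairing with [r2] isolates
     [<g', r1>]. *)
  have [g' [g1' g2']] := hB _ _ _ 2 hU (ler0n _ 2) bS' h.
  have := g2' r2; rewrite bopDE bopNE bop1E rk1E ipBl ipZl ipxx => g3'.
  have g4' : cmod (<< g', r2>> - << g', r1>> * (nn r2)%:C) <= 2 * Cb * (C2 * e).
    by have h5 := ler_wpM2l Cb0 hc2; apply: le_trans g3' _; lra.
  have c2' : cmod << g', r2>> <= cmod << U h, r2>> + nrm (g' - U h).
    by have := close (U h) g' r2 r2le; rewrite nrBC.
  have c3 := close g' (U h) r1 (eq_ind_r (fun z => z <= 1) (lexx 1) r1n).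
  have c4 : cmod << g', r1>> * nn r2 <= cmod << g', r2>> + 2 * Cb * (C2 * e).
    have -> : cmod << g', r1>> * nn r2 = cmod (<< g', r1>> * (nn r2)%:C).
      by rewrite cmodM cmodR ger0_norm ?n2_ge0.
    have -> : << g', r1>> * (nn r2)%:C = << g', r2>> - (<< g', r2>> - << g', r1>> * (nn r2)%:C) by ring.
    by apply: le_trans (cmodD _ _) _; rewrite cmodN lerD2l.
  have c5 : cmod << g', r1>> <= 2 * (cmod << g', r2>> + 2 * Cb * (C2 * e)).
    by have := cmod_ge0 << g', r1>>; nra.
  have : 0 <= Cb * e by rewrite mulr_ge0// ltW.
  have : 0 <= Cb * C2 * E P h by rewrite mulr_ge0.
  by rewrite /D2; move: g1' b1; lra.
exists r1, U; split=> // h h1; have [k1 k2] := key h h1.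
have e1 := EP_ge0 M P h; have ee : 0 <= E P h + e by lra.
split.
  apply: le_trans k2 _; rewrite ler_wpM2r// /C; lra.
have := hS r1 r2 U _ r2le hU h; rewrite r1n => /(_ (lexx _)) h2.
have h3 : Cs * (E P h + cmod << U h, r1>> + cmod << U h, r2>>) <= Cs * ((1 + D1 + D2) * (E P h + e)).
  by rewrite ler_wpM2l//; move: k1 k2 e0; lra.
have : 0 <= D2 * (E P h + e) by rewrite mulr_ge0.
by rewrite /C; lra.
Qed.

End Factorizations.

Section Ess.
Variables (R : realType) (H : hilbertType R).
Notation "<< x , y >>" := (ip (hH H) x y).
Notation nrm := (nr (hH H)).
Notation nn := (n2 (hH H)).
Variable (AA : set 'B(H)).
Hypothesis lpf : left_partial_factorization AA.
Variables (n : nat) (M : set ('I_n -> H)).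
Hypotheses (cM : closed_lin (hT H n) M) (iM : ainv AA M).
Notation E := (EP M).
Implicit Types (P : 'M[R[i]]_n) (x h : H).

(* A type incomparable with another one is realised on vectors tending weakly to 0 *)
Theorem essential P P' : typ M setT P -> typ M setT P' -> P' *m P <> P -> P *m P' <> P' ->
  forall (d : R) (ls : seq H), 0 < d ->
  exists h, [/\ nn h = 1, E P h <= d & forall l, l \in ls -> cmod << h, l>> <= d].
Proof.
move=> tP tP' n1 n2' d ls d0.
have [C [e0 [C1 e00 hstep]]] := essential_step lpf cM iM tP tP' n1 n2'.
pose La := \sum_(l <- ls) nn l.
have La0 : 0 <= La by rewrite sumr_ge0// => l _; exact: n2_ge0.
have d2 : 0 < d ^+ 2 by rewrite exprn_gt0.
(* If [N] vectors all failed the claim, the sum of the [|<l, u i>|^2] would be at least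
   [N * d ^+ 2], while [almost_bessel] caps it at [2 * La]. The tolerance [e] comes after [N], since
   each application of [U] multiplies the errors by [C]. *)
have [N [Npos N1]] : exists N : nat, (0 < N)%N /\ 2 * La < N%:R * d ^+ 2.
  by exists (Num.truncn (2 * La / d ^+ 2)).+1; rewrite -ltr_pdivrMr// truncnS_gt.
have CN k : 0 < C ^+ k by rewrite exprn_gt0//; lra.
have N0 : 0 < N%:R :> R by rewrite ltr0n.
have p1 : 0 < 2 * C ^+ N by apply: mulr_gt0 => //; exact: CN.
have p2 : 0 < 2 * C ^+ N.+1 * N%:R by apply: mulr_gt0 => //; apply: mulr_gt0 => //; exact: CN.
have [e [ep ee0 ed eN]] : exists e, [/\ 0 < e, e <= e0, e * (2 * C ^+ N) <= d
    & e * (2 * C ^+ N.+1 * N%:R) <= 1].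
  exists (Num.min e0 (Num.min (d / (2 * C ^+ N)) (1 / (2 * C ^+ N.+1 * N%:R)))); split.
  - by rewrite !lt_min e00 !divr_gt0.
  - by rewrite ge_min lexx.
  - by rewrite -ler_pdivlMr// !ge_min lexx !orbT.
  - by rewrite -ler_pdivlMr// !ge_min lexx !orbT.
have [r [U [iU nr1 Er hU]]] := hstep e ep ee0.
(* As [U] is isometric, [<u i, u j> = <u (i - j), r>] for [j < i], so near orthogonality to [r]
   alone makes the orbit almost orthonormal. *)
pose u k := iter k U r.
have un k : nn (u k) = 1.
  by elim: k => [//|k IH]; rewrite /u iterS -nr_sq isom_nr// nr_sq.
have un1 k : nrm (u k) <= 1 by rewrite /nr un sqrtr1.
have Eu k : E P (u k) + e <= C ^+ k * (2 * e).
  elim: k => [|k IH]; first by rewrite expr0 /u /=; lra.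
  have [_ h2] := hU (u k) (un1 k); rewrite /u iterS; apply: le_trans h2 _.
  by rewrite exprS -mulrA ler_wpM2l//; lra.
have CkN k : (k <= N)%N -> C ^+ k <= C ^+ N by move=> kN; rewrite ler_weXn2l.
have Ed k : (k <= N)%N -> E P (u k) <= d.
  move=> kN; have := Eu k; have := ler_wpM2r (ltW (mulr_gt0 (ltr0n _ 2) ep)) (CkN k kN); lra.
pose kap := 2 * C ^+ N.+1 * e.
have kap0 : 0 <= kap by apply: mulr_ge0 (ltW ep); apply: mulr_ge0 => //; exact: ltW.
have uu i j : (j < i < N)%N -> cmod << u i, u j>> <= kap.
  move=> /andP[ji iN].
  have shift k m : << u (m + k)%N, u k>> = << u m, r>>.
    elim: k => [|k IH]; first by rewrite addn0.
    by rewrite addnS /u !iterS isom_ip// -/(u _) -/(u _) IH.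
  have -> : << u i, u j>> = << u (i - j)%N, r>> by rewrite -(shift j) subnK// ltnW.
  have : (0 < i - j)%N by rewrite subn_gt0.
  have : (i - j <= N)%N by apply: leq_trans (leq_subr _ _) _; exact: ltnW.
  case: (i - j)%N => // m mN _; rewrite /u iterS -/(u m).
  have [h1 _] := hU (u m) (un1 m); apply: le_trans h1 _; rewrite /kap exprS.
  have h3 := Eu m; have h4 := ler_wpM2r (ltW (mulr_gt0 (ltr0n _ 2) ep)) (CkN m (ltnW mN)).
  have -> : 2 * (C * C ^+ N) * e = C * (C ^+ N * (2 * e)) by ring.
  by rewrite ler_wpM2l//; lra.
have kN : N%:R * kap <= 1 by rewrite /kap; move: eN; lra.
have bes l : \sum_(i < N) sqm << l, u i>> <= 2 * nn l.
  apply: le_trans (almost_bessel l kap0 un uu) _.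
  have := n2_ge0 (hH H) l; nra.
apply: contrapT => hno.
have big (i : 'I_N) : d ^+ 2 <= \sum_(l <- ls) sqm << l, u i>>.
  apply: contrapT => hi; apply: hno; exists (u i); split=> //; first exact: Ed (ltnW (ltn_ord i)).
  move=> l lls; apply: contrapT => /negP; rewrite -ltNge => hl; apply: hi.
  rewrite (big_rem l)//= -[leLHS]addr0; apply: lerD; last first.
    by rewrite sumr_ge0// => k _; exact: sqm_ge0.
  rewrite ipC sqmJ -cmod_sq ler_pXn2r ?nnegrE ?cmod_ge0 ?ltW//.
have : N%:R * d ^+ 2 <= 2 * La.
  apply: (@le_trans _ _ (\sum_(i < N) \sum_(l <- ls) sqm << l, u i>>)).
    apply: (@le_trans _ _ (\sum_(i < N) d ^+ 2)); last by apply: ler_sum => i _; exact: big.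
    by rewrite sumr_const card_ord mulr_natl.
  by rewrite exchange_big/= /La mulr_sumr; apply: ler_sum => l _; exact: bes.
by rewrite leNgt N1.
Qed.
End Ess.

(** * Complete orthonormal sequences and the operator [Y] *)

Section OrthoNormal.
Variables (R : realType) (H : hilbertType R).
Notation "<< x , y >>" := (ip (hH H) x y).
Notation nrm := (nr (hH H)).
Notation nn := (n2 (hH H)).
Implicit Types (O : seq H).

Fixpoint ons O : Prop := if O is o :: O' then
  [/\ o = 0 \/ nn o = 1, forall p, p \in O' -> << o, p>> = 0 & ons O'] else True.
Definition spr O x : H := \sum_(o <- O) << x, o>> *: o.

Lemma sprD O x y : spr O (x + y) = spr O x + spr O y.
Proof. by rewrite /spr -big_split/=; apply: eq_bigr => o _; rewrite ipDl scalerDl. Qed.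
Lemma sprZ O (a : R[i]) x : spr O (a *: x) = a *: spr O x.
Proof. by rewrite /spr scaler_sumr; apply: eq_bigr => o _; rewrite ipZl scalerA. Qed.
Lemma sprB O x y : spr O (x - y) = spr O x - spr O y.
Proof. by rewrite sprD -scaleN1r sprZ scaleN1r. Qed.
Lemma spr_cons o O x : spr (o :: O) x = << x, o>> *: o + spr O x.
Proof. by rewrite /spr big_cons. Qed.

Lemma ip_ons1 o x : o = 0 \/ nn o = 1 -> << x, o>> * << o, o>> = << x, o>>.
Proof. by case=> [->|o1]; rewrite ?ip0r ?mul0r// ipxx o1 mulr1. Qed.

Lemma spr_ip O x : ons O -> forall p, p \in O -> << spr O x, p>> = << x, p>>.
Proof.
elim: O => [//|o O IH] [o1 oO OO] p; rewrite inE spr_cons ipDl ipZl => /orP[/eqP->|pO].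
  rewrite ip_ons1// /spr ip_suml big1_seq ?addr0// => q /andP[_ qO].
  by rewrite ipZl (ipC (hH H) o q) oO// rmorph0 mulr0.
by rewrite oO// mulr0 add0r IH.
Qed.
Lemma spr_orth O x : ons O -> forall p, p \in O -> << x - spr O x, p>> = 0.
Proof. by move=> OO p pO; rewrite ipBl spr_ip// subrr. Qed.
Lemma spr_pyth O x : ons O -> nn x = nn (spr O x) + nn (x - spr O x).
Proof.
move=> OO; have e : rip (hH H) (x - spr O x) (spr O x) = 0.
  rewrite rip_sumr big1_seq// => o /andP[_ oO].
  by rewrite /rip ipZr spr_orth// mulr0.
by have := n2D (hH H) (x - spr O x) (spr O x); rewrite subrK e => ->; ring.
Qed.
Lemma nn_spr O x : ons O -> nn (spr O x) = \sum_(o <- O) sqm << x, o>>.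
Proof.
move=> OO; rewrite /n2 {2}/spr rip_sumr big_seq [RHS]big_seq; apply: eq_bigr => o oO.
by rewrite /rip ipZr spr_ip// mulrC sqmE.
Qed.
Lemma spr_best O x d : ons O -> d = spr O d -> nrm (x - spr O x) <= nrm (x - d).
Proof.
move=> OO dd; have -> : x - spr O x = (x - d) - spr O (x - d).
  by rewrite sprB -dd opprB addrA subrK.
by rewrite ler_wsqrtr// (spr_pyth (x - d) OO) lerDr n2_ge0.
Qed.
End OrthoNormal.

Section Comparable.
Variables (R : realType) (H : hilbertType R).
Notation "<< x , y >>" := (ip (hH H) x y).
Notation nrm := (nr (hH H)).
Notation nn := (n2 (hH H)).
Variable (AA : set 'B(H)).
Hypotheses (sepH : separable H) (lpf : left_partial_factorization AA).
Variables (n : nat) (M : set ('I_n -> H)).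
Hypotheses (cM : closed_lin (hT H n) M) (iM : ainv AA M).
Notation E := (EP M).
Implicit Types (P : 'M[R[i]]_n) (x h : H) (O : seq H).

Lemma ons_le O : ons O -> forall o, o \in O -> nrm o <= 1.
Proof.
elim: O => [//|o O IH] [o1 _ OO] p; rewrite inE => /orP[/eqP->|/(IH OO)//].
by case: o1 => [->|h]; [rewrite nr0 ler01|rewrite /nr h sqrtr1].
Qed.

(** Two vectors are added: the normalised residual of [x], which puts [x] in the span, and a vector
    of type [P] made orthogonal to all the others. Smallness of its inner products, given by [ess],
    keeps this correction from spoiling the type. *)
Lemma extend_ons P (ess : forall (d : R) (ls : seq H), 0 < d ->
    exists h, [/\ nn h = 1, E P h <= d & forall l, l \in ls -> cmod << h, l>> <= d])
  O (x : H) (d : R) : ons O -> 0 < d ->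
  exists p : H * H, [/\ ons (p.1 :: p.2 :: O), nn p.1 = 1, E P p.1 <= d
    & x = spr (p.1 :: p.2 :: O) x].
Proof.
move=> OO d0; pose y := x - spr O x.
pose t := if y == 0 then 0 else (nrm y)^-1%:C *: y.
have t1 : t = 0 \/ nn t = 1.
  rewrite /t; case: (eqVneq y 0) => [_|y0]; first by left.
  right; rewrite n2ZR -nr_sq -exprMn mulVf ?expr1n// gt_eqF// nr_gt0//.
have tO p : p \in O -> << t, p>> = 0.
  move=> pO; rewrite /t; case: ifP => _; first by rewrite ip0l.
  by rewrite ipZl spr_orth// mulr0.
have OO1 : ons (t :: O) by split.
have xt : x = spr (t :: O) x.
  rewrite spr_cons -[LHS](subrK (spr O x)) -/y; congr (_ + _).
  rewrite /t; case: (eqVneq y 0) => [->|y0]; first by rewrite scaler0.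
  have yp := nr_gt0 (hH H) y0.
  have -> : << x, (nrm y)^-1%:C *: y>> = (nrm y)%:C.
    rewrite ipZr conjR -[x in << x, _>>](subrK (spr O x)) -/y ipDl ipxx.
    have -> : << spr O x, y>> = 0.
      rewrite /spr ip_suml big1_seq// => q /andP[_ qO].
      by rewrite ipZl (ipC (hH H) y q) spr_orth// rmorph0 mulr0.
    by rewrite addr0 -rmorphM -nr_sq /= expr2 mulKf// gt_eqF.
  by rewrite scalerA -rmorphM mulfV ?scale1r// gt_eqF.
pose O1 := t :: O; pose m : R := (size O1)%:R.
have m0 : 0 <= m by [].
have [Ce Ce0 hE] := EP_bd cM P.
(* The first bound keeps the part removed from [h] below one half; the second leaves a type error of
   [d / 2], at most doubled by the normalisation. *)
pose k := Num.min (1 / (2 * (m + 1))) (d / (2 * (1 + Ce * m))).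
have Cm : 0 <= Ce * m by rewrite mulr_ge0.
have [k0 [k1 k2]] : 0 < k /\ (k * (2 * (m + 1)) <= 1 /\ k * (2 * (1 + Ce * m)) <= d).
  have q1 : 0 < 2 * (m + 1) by lra.
  have q2 : 0 < 2 * (1 + Ce * m) by lra.
  split; first by rewrite lt_min !divr_gt0.
  by rewrite -!ler_pdivlMr// !ge_min !lexx !orbT.
move: k k0 k1 k2 => k k0 k1 k2.
have [h [nh Eh hO]] := ess k O1 k0.
pose r0 := h - spr O1 h.
have h1 : nrm h = 1 by rewrite /nr nh sqrtr1.
have sle : nrm (spr O1 h) <= m * k.
  apply: le_trans (nr_sum _ _ _ _) _; apply: (@le_trans _ _ (\sum_(o <- O1) k)).
    rewrite big_seq [leRHS]big_seq; apply: ler_sum => o oO; rewrite nrZ.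
    have := hO o oO; have := ons_le OO1 oO; have := cmod_ge0 << h, o>>; have := nr_ge0 (hH H) o; nra.
  by rewrite big_const_seq count_predT iter_addr_0 -mulr_natl.
have r0ge : 2^-1 <= nrm r0.
  have := nrD (hH H) r0 (spr O1 h); rewrite subrK h1; nra.
have r0p : 0 < nrm r0 by lra.
pose r := (nrm r0)^-1%:C *: r0.
have rO p : p \in O1 -> << r, p>> = 0 by move=> pO; rewrite ipZl spr_orth// mulr0.
have nr1 : nn r = 1 by rewrite n2ZR -nr_sq -exprMn mulVf ?expr1n// gt_eqF.
exists (r, t); split=> //=.
- by split=> //; right.
- rewrite (EPZ cM) cmodR ger0_norm ?invr_ge0 ?nr_ge0//.
  have Er0 : E P r0 <= k * (1 + Ce * m).
    have -> : r0 = h + (-1) *: spr O1 h by rewrite scaleN1r.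
    apply: le_trans (EPD cM _ _ _) _; rewrite (EPZ cM).
    have -> : cmod (-1 : R[i]) = 1 by rewrite cmodN /cmod /sqm /= expr0n /= addr0 expr1n sqrtr1.
    have := hE (spr O1 h); have := ler_wpM2l Ce0 sle; lra.
  rewrite ler_pdivrMl// mulrC; apply: (@le_trans _ _ (d * 2^-1)); first by lra.
  by rewrite ler_wpM2l// ltW.
- rewrite spr_cons -xt (_ : << x, r>> = 0) ?scale0r ?add0r//.
  rewrite xt /spr ip_suml big1_seq// => q /andP[_ qO].
  by rewrite ipZl (ipC (hH H) r q) rO// rmorph0 mulr0.
Qed.

(** The terms of a dense sequence are absorbed one by one, so the [r k] and [t k] together are
    complete; the geometric errors are summable, as [shift_mass] needs. *)
Lemma ons_sequence P (ess : forall (d : R) (ls : seq H), 0 < d ->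
    exists h, [/\ nn h = 1, E P h <= d & forall l, l \in ls -> cmod << h, l>> <= d])
  (eta : R) : 0 < eta ->
  exists (r t : nat -> H) (s : nat -> seq H), [/\
    forall k, nn (r k) = 1 /\ E P (r k) <= eta / 2 ^+ k,
    s 0%N = [::] /\ forall k, s k.+1 = r k :: t k :: s k, forall k, ons (s k) &
    forall z (e : R), 0 < e -> exists N, nrm (z - spr (s N) z) < e].
Proof.
move=> eta0; have [d hd] := dense_seq sepH.
have ex (q : nat * seq H) : exists p : H * H, ons q.2 -> [/\ ons (p.1 :: p.2 :: q.2), nn p.1 = 1,
    E P p.1 <= eta / 2 ^+ q.1 & d q.1 = spr (p.1 :: p.2 :: q.2) (d q.1)].
  have [O1|] := pselect (ons q.2); last by exists 0.
  have e0 : 0 < eta / 2 ^+ q.1 by rewrite divr_gt0// exprn_gt0.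
  by have [p hp] := extend_ons ess (d q.1) O1 e0; exists p.
have [F hF] := choice ex.
pose s := fix s k := if k is k'.+1 then (F (k', s k')).1 :: (F (k', s k')).2 :: s k' else [::].
have os k : ons (s k) by elim: k => [//|k IH]; have [] := hF (k, s k) IH.
exists (fun k => (F (k, s k)).1), (fun k => (F (k, s k)).2), s; split=> //.
  by move=> k; have [] := hF (k, s k) (os k).
move=> z e e0; have [k hk] := hd z e e0; exists k.+1.
have [_ _ _ dk] := hF (k, s k) (os k).
by apply: le_lt_trans hk; apply: spr_best => //; exact: os.
Qed.
End Comparable.

Section Shift.
Variables (R : realType) (H : hilbertType R).
Notation "<< x , y >>" := (ip (hH H) x y).
Notation nrm := (nr (hH H)).
Notation nn := (n2 (hH H)).
Notation re := (rip (hH H)).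
Variables (r t : nat -> H) (s : nat -> seq H).
Hypotheses (r1 : forall k, nn (r k) = 1) (s0 : s 0%N = [::])
  (sS : forall k, s k.+1 = r k :: t k :: s k) (os : forall k, ons (s k)).

Lemma r_mem k m : (k < m)%N -> r k \in s m.
Proof.
elim: m => [//|m IH]; rewrite ltnS leq_eqVlt sS !inE => /orP[/eqP->|/IH->].
  by rewrite eqxx.
by rewrite !orbT.
Qed.
Lemma t_mem k m : (k < m)%N -> t k \in s m.
Proof.
elim: m => [//|m IH]; rewrite ltnS leq_eqVlt sS !inE => /orP[/eqP->|/IH->].
  by rewrite eqxx orbT.
by rewrite !orbT.
Qed.
Lemma os1 k : (forall p, p \in s k -> << r k, p>> = 0) /\ << r k, t k>> = 0 /\
  (forall p, p \in s k -> << t k, p>> = 0) /\ (t k = 0 \/ nn (t k) = 1).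
Proof.
have := os k.+1; rewrite sS => -[_ h1 [h2 h3 _]]; split.
  by move=> p ps; apply: h1; rewrite inE ps orbT.
by split=> //; apply: h1; rewrite inE eqxx.
Qed.
Lemma conj0 z w : << z, w>> = 0 -> << w, z>> = 0.
Proof. by move=> h; rewrite ipC h rmorph0. Qed.
Lemma rr i j : << r i, r j>> = (i == j)%:R.
Proof.
have [ij|ij|->] := ltngtP i j.
- by apply: conj0; apply: (os1 j).1; exact: r_mem.
- by apply: (os1 i).1; exact: r_mem.
- by rewrite ipxx r1.
Qed.
Lemma rt i j : << r i, t j>> = 0.
Proof.
have [ij|ij|->] := ltngtP i j.
- by apply: conj0; apply: (os1 j).2.2.1; exact: r_mem.
- by apply: (os1 i).1; exact: t_mem.
- exact: (os1 j).2.1.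
Qed.
Lemma tt i j : i != j -> << t i, t j>> = 0.
Proof.
have [ij|ij|->] := ltngtP i j; last by [].
- by move=> _; apply: conj0; apply: (os1 j).2.2.1; exact: t_mem.
- by move=> _; apply: (os1 i).2.2.1; exact: t_mem.
Qed.
Lemma nn_s N z : nn (spr (s N) z) = \sum_(k < N) sqm << z, r k>> + \sum_(k < N) sqm << z, t k>>.
Proof.
rewrite nn_spr//; elim: N => [|N IH]; first by rewrite s0 big_nil !big_ord0 addr0.
by rewrite sS !big_cons IH !big_ord_recr/=; ring.
Qed.
Lemma nn_s_le N z : nn (spr (s N) z) <= nn z.
Proof. by rewrite (spr_pyth z (os N)) lerDl n2_ge0. Qed.

Lemma rsum_ip N (c : nat -> R[i]) j : << \sum_(k < N) c k *: r k, r j>> = if (j < N)%N then c j else 0.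
Proof.
rewrite ip_suml; case: ifP => jN.
  rewrite (bigD1 (Ordinal jN))//= big1 => [|i ij]; first by rewrite ipZl rr eqxx mulr1 addr0.
  by rewrite ipZl rr -(inj_eq val_inj) in ij *; rewrite (negbTE ij) mulr0.
by rewrite big1// => i _; rewrite ipZl rr ltn_eqF ?mulr0// (leq_trans (ltn_ord i))// leqNgt jN.
Qed.
Lemma rsum_rip N m (c : nat -> R[i]) : (m <= N)%N ->
  re (\sum_(k < N) c k *: r k) (\sum_(k < m) c k *: r k) = \sum_(k < m) sqm (c k).
Proof.
move=> mN; rewrite rip_sumr; apply: eq_bigr => k _.
by rewrite /rip ipZr rsum_ip (leq_trans (ltn_ord k) mN) mulrC sqmE.
Qed.

(** The strong sum of the [rk1 (r k) (t k)], convergent by Bessel. It squares to zero because every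
    [r i] is orthogonal to every [t j], so [1 + Y] has the inverse [1 - Y]. *)
Theorem shift_op : exists Y : 'B(H), [/\ Y * Y = 0, forall k, Y (r k) = 0,
  forall x, nrm (Y x) <= nrm x & forall x k, << Y x, r k>> = << x, t k>>].
Proof.
pose f N : 'B(H) := \sum_(k < N) rk1 (r k) (t k).
have fE N x : f N x = \sum_(k < N) << x, t k>> *: r k.
  by rewrite /f (big_morph (fun B : 'B(H) => B x) (fun B C => erefl) erefl).
pose a x N := \sum_(k < N) sqm << x, t k>>.
have aB x N : a x N <= nn x.
  apply: le_trans (nn_s_le N x); rewrite nn_s lerDr sumr_ge0// => k _; exact: sqm_ge0.
have aS x N : a x N <= a x N.+1 by rewrite /a big_ord_recr/= lerDl sqm_ge0.
have am x m k : (m <= k)%N -> a x m <= a x k.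
  by move=> /subnKC <-; elim: (k - m)%N => [|i IH]; rewrite ?addn0// addnS (le_trans IH).
have fdist x m k : (m <= k)%N -> nn (f k x - f m x) = a x k - a x m.
  move=> mk; rewrite n2B !fE (rsum_rip (fun i => << x, t i>>) mk).
  rewrite /n2 !(rsum_rip (fun i => << x, t i>>) (leqnn _)) /a; ring.
have bf N x : nrm (f N x) <= 1 * nrm x.
  rewrite mul1r ler_wsqrtr// /n2 fE (rsum_rip (fun i => << x, t i>>) (leqnn _)); exact: aB.
have [x e e0|Y hY bY] := op_lim bf.
  pose D : set R := range (a x).
  have hD : has_sup D by split; [exists (a x 0%N), 0%N|exists (nn x) => _ [k _ <-]].
  have e2 : 0 < e ^+ 2 by rewrite exprn_gt0.
  have [_ [N _ <-] hN] := sup_adherent e2 hD.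
  exists N.
  have key m k : (N <= m)%N -> (m <= k)%N -> nrm (f k x - f m x) <= e.
    move=> Nm mk; apply: ler_sq (ltW e0) _; rewrite nr_sq fdist//.
    have : a x k <= sup D by apply: sup_upper_bound => //; exists k.
    have := am x N m Nm; lra.
  move=> m k Nm Nk; have [mk|/ltnW km] := leqP m k; last exact: key.
  by rewrite nrBC; exact: key.
have Yr x k : << Y x, r k>> = << x, t k>>.
  have h : tends (hH H) (fun m => f (m + k.+1)%N x - << x, t k>> *: r k) (Y x - << x, t k>> *: r k).
    move=> e e0; have [N hN] := hY x e e0; exists N => m Nm.
    rewrite opprB addrA subrK; apply: hN; exact: leq_trans (leq_addr _ _).
  have : << Y x - << x, t k>> *: r k, r k>> = 0.
    apply: (tends_ip h) => m; rewrite ipBl fE (rsum_ip _ (fun i => << x, t i>>)).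
    by rewrite addnS ltnS leq_addl ipZl ipxx r1 mulr1 subrr.
  by rewrite ipBl ipZl ipxx r1 mulr1 => /eqP; rewrite subr_eq0 => /eqP.
have Yr0 k : Y (r k) = 0.
  apply: tends_uniq (hY (r k)) _; have := tends_const (hH H) (0 : H).
  congr (tends _ _ _); apply/funext => m; rewrite fE big1// => i _.
  by rewrite rt scale0r.
exists Y; split=> //; last by move=> x; have := bY x; rewrite mul1r.
apply/bop_eqP => x; apply: tends_uniq (tends_op Y (hY x)) _.
have := tends_const (hH H) (0 : H); congr (tends _ _ _); apply/funext => m.
by rewrite fE bop_sum big1// => i _; rewrite bopZ Yr0 scaler0.
Qed.

Lemma geo_sum N : \sum_(k < N) (2 ^+ k)^-1 <= 2 :> R.
Proof.
suff : \sum_(k < N) (2 ^+ k)^-1 <= 2 - 2 / 2 ^+ N :> R.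
  by move/le_trans; apply; rewrite gerBl divr_ge0// exprn_ge0.
elim: N => [|N IH]; first by rewrite big_ord0 expr0; lra.
by rewrite big_ord_recr/= exprS invfM; lra.
Qed.

(** The [<z, r k>] are small through [g], and the [<z, t k>] are close to them through [g']. The
    errors are summable in [k]: the [r]-part of the mass is at most [5 e] and the [t]-part at most
    [44 e / 3], together below [20 e]. *)
Lemma shift_mass N z g g' (e : R) : 0 <= e -> nn z = 1 -> nrm (g - z) <= e -> nrm (g' - z) <= e ->
  (forall k, cmod << g, r k>> <= 2 * e / 2 ^+ k) ->
  (forall k, cmod (<< g', r k>> - << g', t k>>) <= 2 * e / 2 ^+ k) ->
  nn (spr (s N) z) <= 20 * e.
Proof.
move=> e0 z1 gz g'z hg hg'; rewrite nn_s.
pose a k := << z, r k>>; pose b k := << z, t k>>.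
set SA := \sum_(k < N) sqm << z, r k>>; set SB := \sum_(k < N) sqm << z, t k>>.
have SA0 : 0 <= SA by rewrite sumr_ge0// => k _; exact: sqm_ge0.
have SB0 : 0 <= SB by rewrite sumr_ge0// => k _; exact: sqm_ge0.
have S1 : SA + SB <= 1 by rewrite -nn_s -z1 nn_s_le.
have le1 (F : nat -> R) : (forall k, 0 <= F k) -> \sum_(k < N) F k <= 1 -> forall k : 'I_N, F k <= 1.
  move=> F0 h k; apply: le_trans h; rewrite (bigD1 k)//= lerDl sumr_ge0//.
have a1 (k : 'I_N) : cmod (a k) <= 1.
  rewrite -[leRHS]sqrtr1 ler_wsqrtr//; apply: (le1 (fun k => sqm (a k))) => [j|]; first exact: sqm_ge0.
  by move: S1 SB0; rewrite -/SA; lra.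
have b1 (k : 'I_N) : cmod (b k) <= 1.
  rewrite -[leRHS]sqrtr1 ler_wsqrtr//; apply: (le1 (fun k => sqm (b k))) => [j|]; first exact: sqm_ge0.
  by move: S1 SA0; rewrite -/SB; lra.
pose A := \sum_(k < N) a k *: r k; pose Rr := \sum_(k < N) b k *: r k.
pose Bt := \sum_(k < N) b k *: t k.
have nA : nrm A <= 1.
  by rewrite -[leRHS]sqrtr1 ler_wsqrtr// /n2 (rsum_rip a (leqnn N)) -/SA; lra.
have nR : nrm Rr <= 1.
  by rewrite -[leRHS]sqrtr1 ler_wsqrtr// /n2 (rsum_rip b (leqnn N)) -/SB; lra.
have zA : re z A = SA.
  by rewrite rip_sumr; apply: eq_bigr => k _; rewrite /rip ipZr mulrC sqmE.
have zB : re z Bt = SB.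
  by rewrite rip_sumr; apply: eq_bigr => k _; rewrite /rip ipZr mulrC sqmE.
have nB : nrm Bt <= 1.
  rewrite -[leRHS]sqrtr1 ler_wsqrtr//; have -> : nn Bt = \sum_(k < N) sqm (b k) * nn (t k).
    rewrite /n2 {2}/Bt rip_sumr; apply: eq_bigr => k _.
    rewrite /rip ipZr ip_suml (bigD1 k)//= big1 => [|i ik]; last first.
      by rewrite ipZl tt ?mulr0.
    by rewrite addr0 ipZl ipxx mulrA (mulrC (_^*)) sqmE -rmorphM.
  apply: (@le_trans _ _ SB); last by lra.
  apply: ler_sum => k _; rewrite ler_piMr ?sqm_ge0//.
  by case: (os1 k).2.2.2 => [->|->//]; rewrite n2_0 ler01.
have esum (c F : nat -> R[i]) : (forall k : 'I_N, cmod (c k) <= 1) -> (forall k, cmod (F k) <= 2 * e / 2 ^+ k) ->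
    \sum_(k < N) Re ((c k)^* * F k) <= 4 * e.
  move=> hc hF; apply: (@le_trans _ _ (\sum_(k < N) 2 * e * (2 ^+ k)^-1)).
    apply: ler_sum => k _; apply: le_trans (ler_norm _) _; apply: le_trans (Re_le_cmod _) _.
    rewrite cmodM; have -> : cmod (c k)^* = cmod (c k) by rewrite /cmod sqmJ.
    by apply: le_trans (hF k); rewrite ler_piMl ?cmod_ge0.
  rewrite -mulr_sumr; have := ler_wpM2l (mulr_ge0 (ler0n R 2) e0) (geo_sum N); lra.
have SAe : SA <= 5 * e.
  have e1 : re g A <= 4 * e.
    rewrite rip_sumr; apply: le_trans (esum a (fun k => << g, r k>>) a1 hg).
    by apply: ler_sum => k _; rewrite /rip ipZr.
  have e2 : - re (g - z) A <= e.
    have := CSn (hH H) (g - z) A; rewrite ler_norml => /andP[h _].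
    have : nrm (g - z) * nrm A <= e by have := nr_ge0 (hH H) (g - z); nra.
    lra.
  by move: e2; rewrite -zA !ripE; lra.
have e1 : re g' (Bt - Rr) <= 4 * e.
  have -> : re g' (Bt - Rr) = \sum_(k < N) Re ((- b k)^* * (<< g', r k>> - << g', t k>>)).
    rewrite !ripE !rip_sumr -sumrB; apply: eq_bigr => k _.
    by rewrite /rip !ipZr rmorphN -cReN -cReD; congr Re; ring.
  by apply: (esum (fun k => - b k) (fun k => << g', r k>> - << g', t k>>) _ hg') => k; rewrite cmodN.
have e2 : - re (g' - z) (Bt - Rr) <= 2 * e.
  have := CSn (hH H) (g' - z) (Bt - Rr); rewrite ler_norml => /andP[h _].
  have := nrB (hH H) Bt Rr; have := nr_ge0 (hH H) (g' - z); have := nr_ge0 (hH H) (Bt - Rr).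
  nra.
have e3 : re z Rr <= SB / 4 + SA.
  rewrite rip_sumr mulr_suml -big_split/=; apply: ler_sum => k _.
  rewrite /rip ipZr -/(a k) -/(b k) /sqm cReM cReJ cImJ.
  have := sqr_ge0 (Re (b k) / 2 - Re (a k)); have := sqr_ge0 (Im (b k) / 2 - Im (a k)); nra.
move: e2 e1 e3; rewrite !ripE zB; lra.
Qed.
End Shift.

Section Compare.
Variables (R : realType) (H : hilbertType R).
Notation "<< x , y >>" := (ip (hH H) x y).
Notation nrm := (nr (hH H)).
Notation nn := (n2 (hH H)).
Variable (AA : set 'B(H)).
Hypotheses (sepH : separable H) (lpf : left_partial_factorization AA).
Variables (n : nat) (M : set ('I_n -> H)).
Hypotheses (cM : closed_lin (hT H n) M) (iM : ainv AA M).

(** For incomparable types both near-orthogonality lemmas apply: [S = 1 + Y] fixes each [r k], and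
    [S' = 1 - Y] ties the components along [r k] and [t k]. The image [U h] of a vector of type [P']
    would then be nearly orthogonal to a complete system. *)
Theorem types_comparable (P P' : 'M[R[i]]_n) : typ M setT P -> typ M setT P' ->
  P' *m P = P \/ P *m P' = P'.
Proof.
move=> tP tP'; apply: contrapT => /not_orP[n1 n2'].
have pP := typ_prj cM tP; have pP' := typ_prj cM tP'.
have [Ca Ca0 hA] := near_orth_image cM pP' n1.
have [Cb Cb0 hB] := near_orth_preimage cM pP n2'.
pose C := Ca + Cb + 1; have C0 : 0 < C by rewrite /C; lra.
(* [shift_mass] turns the error [1 / 40] into mass at most [1 / 2]. *)
have [eta [eta0 etaC]] : exists eta, 0 < eta /\ C * eta = 40^-1.
  by exists (C^-1 * 40^-1); rewrite mulrA mulfV ?mul1r ?gt_eqF//; split=> //; rewrite mulr_gt0 ?invr_gt0.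
have [Cae Cbe] : Ca * eta <= 40^-1 /\ Cb * eta <= 40^-1.
  have := mulr_ge0 Ca0 (ltW eta0); have := mulr_ge0 Cb0 (ltW eta0).
  by move: etaC; rewrite /C => ? ? ?; split; lra.
have [r [t [s [hr [s0 sS] os hd]]]] :=
  ons_sequence sepH cM (essential lpf cM iM tP tP' n1 n2') eta0.
have r1 k : nn (r k) = 1 by case: (hr k).
have Er k : EP M P (r k) <= eta / 2 ^+ k by case: (hr k).
have [Y [YY Yr bY Yrt]] := shift_op r1 s0 sS os.
have i1 : (1 + Y) * (1 - Y) = 1 by rewrite mulrDl mul1r mulrBr mulr1 YY subr0 subrK.
have i2 : (1 - Y) * (1 + Y) = 1 by rewrite mulrBl mul1r mulrDr mulr1 YY addr0 addrK.
have [U hU] := fac_rel_ex lpf iM i1 i2.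
have iU : isometry U by case: hU.
have bS x : nrm ((1 + Y) x) <= 2 * nrm x.
  by rewrite bopDE bop1E; have := nrD (hH H) x (Y x); have := bY x; lra.
have bS' x : nrm ((1 - Y) x) <= 2 * nrm x.
  by rewrite bopDE bopNE bop1E; have := nrB (hH H) x (Y x); have := bY x; lra.
have [h [_ nh Eh]] := tP' eta eta0.
have h1 : nrm h = 1 by rewrite /nr nh sqrtr1.
have [g [g1 g2]] := hA _ _ _ 2 hU (ler0n _ 2) bS h.
have [g' [g1' g2']] := hB _ _ _ 2 hU (ler0n _ 2) bS' h.
pose z := U h; have z1 : nn z = 1 by rewrite -nr_sq isom_nr// nr_sq.
(* Completeness leaves less than [1 / 16] of the mass of the unit vector [z] outside this span,
   against at most [1 / 2] inside. *)
have [N hN] := hd z 4^-1 ltac:(by rewrite invr_gt0).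
have e40 : 0 <= 40^-1 :> R by rewrite invr_ge0.
have p2 k : 0 <= (2 ^+ k)^-1 :> R by rewrite invr_ge0 exprn_ge0.
have key : nn (spr (s N) z) <= 20 * 40^-1.
  apply: (@shift_mass _ _ r t s r1 s0 sS os N z g g') => //.
  - by apply: le_trans g1 _; have := ler_wpM2l Ca0 Eh; lra.
  - by apply: le_trans g1' _; have := ler_wpM2l Cb0 Eh; lra.
  - move=> k; have := g2 (r k); rewrite bopDE bop1E Yr addr0 h1 mulr1 => hk.
    apply: le_trans hk _; have := ler_wpM2l Ca0 (Er k).
    by have := ler_wpM2r (p2 k) Cae; lra.
  - move=> k; have := g2' (r k); rewrite bopDE bopNE bop1E ipBl Yrt h1 mulr1 => hk.
    apply: le_trans hk _; have := ler_wpM2l Cb0 (Er k).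
    by have := ler_wpM2r (p2 k) Cbe; lra.
have := spr_pyth z (os N); rewrite z1 -(nr_sq _ (z - _)).
have := nr_ge0 (hH H) (z - spr (s N) z); nra.
Qed.
End Compare.

(** * The identity is not a type *)

Section SpectralSplit.
Variables (R : realType) (H : hilbertType R).
Notation "<< x , y >>" := (ip (hH H) x y).
Notation nrm := (nr (hH H)).
Notation nn := (n2 (hH H)).
Notation re := (rip (hH H)).
Implicit Types (A B T X Y : 'B(H)) (x : H).

(** The iteration [Yop] for the scalar [X = 1]; it majorises the norms of [Yop X k] and of their
    increments. *)
Fixpoint ysc (k : nat) : R := if k is k'.+1 then 2^-1 * (1 + ysc k' ^+ 2) else 0.
Lemma ysc_bd k : 0 <= ysc k <= 1.
Proof. by elim: k => [|k /andP[h0 h1]] /=; [rewrite lexx ler01|apply/andP; split; nra]. Qed.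
Lemma ysc_mono k : ysc k <= ysc k.+1.
Proof.
by have /andP[h0 h1] := ysc_bd k; rewrite /=; have := sqr_ge0 (1 - ysc k); nra.
Qed.
Lemma ysc_cauchy (e : R) : 0 < e -> exists N, forall m k, (N <= m)%N -> (m <= k)%N -> ysc k - ysc m <= e.
Proof.
move=> e0; have hD : has_sup (range ysc).
  by split; [exists (ysc 0%N), 0%N|exists 1 => _ [k _ <-]; case/andP: (ysc_bd k)].
have [_ [N _ <-] hN] := sup_adherent e0 hD; exists N => m k Nm mk.
have mono i j : (i <= j)%N -> ysc i <= ysc j.
  by move=> /subnKC <-; elim: (j - i)%N => [|l IH]; rewrite ?addn0// addnS (le_trans IH)// ysc_mono.
have : ysc k <= sup (range ysc) by apply: sup_upper_bound => //; exists k.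
have := mono N m Nm; lra.
Qed.

(** The classical square root iteration: a limit [Y] satisfies [2 Y = X + Y^2], that is
    [(1 - Y)^2 = 1 - X]. The iterates are polynomials in [X], whence the commutation clause of
    [Yop_lim]. *)
Fixpoint Yop X (k : nat) : 'B(H) := if k is k'.+1 then (2^-1)%:C *: (X + Yop X k' * Yop X k') else 0.

Section Iter.
Variable X : 'B(H).
Hypothesis bX : forall x, nrm (X x) <= nrm x.
Lemma Yop_comm T k : T * X = X * T -> T * Yop X k = Yop X k * T.
Proof.
move=> TX; elim: k => [|k IH] /=; first by rewrite mulr0 mul0r.
have e : T * (X + Yop X k * Yop X k) = (X + Yop X k * Yop X k) * T.
  by rewrite mulrDr mulrDl TX mulrA IH -!mulrA IH.
by apply/bop_eqP => x; have /bop_eqP/(_ x) := e; rewrite !bopME !bopZE bopZ => ->.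
Qed.
Lemma Yop_bd k x : nrm (Yop X k x) <= ysc k * nrm x.
Proof.
elim: k x => [|k IH] x; first by rewrite nr0 mul0r.
rewrite -[Yop X k.+1 x]/((2^-1)%:C *: (X x + Yop X k (Yop X k x))) /=.
rewrite nrZR ger0_norm ?invr_ge0// -mulrA ler_wpM2l ?invr_ge0//.
rewrite mulrDl mul1r; apply: le_trans (nrD _ _ _) _; apply: lerD => //.
apply: le_trans (IH _) _; rewrite expr2 -mulrA ler_wpM2l//; by case/andP: (ysc_bd k).
Qed.
Lemma Yop_step k x : nrm (Yop X k.+1 x - Yop X k x) <= (ysc k.+1 - ysc k) * nrm x.
Proof.
elim: k x => [|k IH] x.
  rewrite -[Yop X 1 x]/((2^-1)%:C *: (X x + 0)) -[Yop X 0 x]/(0 : H) addr0 subr0.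
  rewrite nrZR ger0_norm ?invr_ge0// /=.
  by have := bX x; have := nr_ge0 (hH H) x; rewrite expr0n /=; nra.
have e : Yop X k.+2 x - Yop X k.+1 x = (2^-1)%:C *:
    (Yop X k.+1 ((Yop X k.+1 - Yop X k) x) + (Yop X k.+1 - Yop X k) (Yop X k x)).
  transitivity ((2^-1)%:C *: (X x + Yop X k.+1 (Yop X k.+1 x)) -
      (2^-1)%:C *: (X x + Yop X k (Yop X k x))); first by [].
  rewrite -scalerBr; congr (_ *: _).
  rewrite !bopBE bopB addrA subrK opprD addrACA subrr add0r//.
rewrite e nrZR ger0_norm ?invr_ge0//.
have h1 := nrD (hH H) (Yop X k.+1 ((Yop X k.+1 - Yop X k) x)) ((Yop X k.+1 - Yop X k) (Yop X k x)).
have h2 := Yop_bd k.+1 ((Yop X k.+1 - Yop X k) x).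
have h3 := IH x; have h4 := IH (Yop X k x); have h5 := Yop_bd k x.
have /andP[y0 y1] := ysc_bd k; have /andP[z0 z1] := ysc_bd k.+1; have mo := ysc_mono k.
have h6 := ler_wpM2l z0 h3.
have d0 : 0 <= ysc k.+1 - ysc k by lra.
have h7 := ler_wpM2l d0 h5.
have -> : (ysc k.+2 - ysc k.+1) = 2^-1 * (ysc k.+1 ^+ 2 - ysc k ^+ 2).
  have -> : ysc k.+2 = 2^-1 * (1 + ysc k.+1 ^+ 2) by [].
  have -> : ysc k.+1 = 2^-1 * (1 + ysc k ^+ 2) by [].
  by ring.
move: h1 h2 h4 h6 h7; rewrite -![(_ - _ : 'B(H)) _]/(_ - _).
by move: (ysc k.+1) (ysc k) (nrm x) => *; lra.
Qed.
Lemma Yop_dist m k x : (m <= k)%N -> nrm (Yop X k x - Yop X m x) <= (ysc k - ysc m) * nrm x.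
Proof.
move=> /subnKC <-; elim: (k - m)%N => [|j IH]; first by rewrite addn0 !subrr nr0 mul0r.
rewrite addnS; have := Yop_step (m + j) x.
have := nrD (hH H) (Yop X (m + j).+1 x - Yop X (m + j) x) (Yop X (m + j) x - Yop X m x).
rewrite addrA subrK; move: IH; rewrite !mulrBl; lra.
Qed.
Lemma Yop_lim : exists Y, [/\ forall x, nrm (Y x) <= nrm x, Y + Y = X + Y * Y &
  forall T, T * X = X * T -> T * Y = Y * T].
Proof.
have b1 k x : nrm (Yop X k x) <= 1 * nrm x.
  apply: le_trans (Yop_bd k x) _; rewrite ler_wpM2r ?nr_ge0//; by case/andP: (ysc_bd k).
have [x e e0|Y hY bY] := op_lim b1.
  have xp : 0 < nrm x + 1 by have := nr_ge0 (hH H) x; lra.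
  have [N hN] := ysc_cauchy (divr_gt0 e0 xp); exists N.
  have key m k : (N <= m)%N -> (m <= k)%N -> nrm (Yop X k x - Yop X m x) <= e.
    move=> Nm mk; apply: le_trans (Yop_dist x mk) _; have := hN m k Nm mk.
    rewrite ler_pdivlMr// => h; apply: le_trans h; rewrite ler_wpM2l ?lerDl//.
    rewrite subr_ge0; move: mk => /subnKC <-; elim: (k - m)%N => [|l IH]; rewrite ?addn0// addnS.
    exact: le_trans IH (ysc_mono _).
  move=> m k Nm Nk; have [mk|/ltnW km] := leqP m k; last exact: key.
  by rewrite nrBC; exact: key.
exists Y; split.
- by move=> x; have := bY x; rewrite mul1r.
- apply/bop_eqP => x; apply: (@tends_uniq _ _ (hH H) (fun k => Yop X k.+1 x + Yop X k.+1 x)).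
    move=> e e0; have [N hN] := hY x (e / 2) (divr_gt0 e0 (ltr0Sn _ 1)); exists N => m Nm.
    have := hN m.+1 (leqW Nm) => h.
    rewrite bopDE opprD addrACA; apply: le_trans (nrD _ _ _) _; lra.
  have -> : (fun k => Yop X k.+1 x + Yop X k.+1 x) = (fun k => X x + Yop X k (Yop X k x)).
    apply/funext => k; rewrite -[Yop X k.+1 x]/((2^-1)%:C *: (X x + Yop X k (Yop X k x))).
    rewrite -scalerDl -rmorphD/= (_ : 2^-1 + 2^-1 = 1) ?scale1r//; by field.
  move=> e e0; have e2 := divr_gt0 e0 (ltr0Sn R 1).
  have [N1 h1] := hY x _ e2; have [N2 h2] := hY (Y x) _ e2.
  exists (maxn N1 N2) => m; rewrite geq_max => /andP[/h1 a1 /h2 a2].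
  have -> : X x + Yop X m (Yop X m x) - (X + Y * Y) x =
     Yop X m (Yop X m x - Y x) + (Yop X m (Y x) - Y (Y x)).
    rewrite bopDE bopME bopB addrA subrK opprD addrACA subrr add0r//.
  apply: le_trans (nrD _ _ _) _; have := b1 m (Yop X m x - Y x); rewrite mul1r; lra.
- move=> T TX; apply/bop_eqP => x; apply: tends_uniq (tends_op T (hY x)) _.
  have := hY (T x); congr (tends _ _ _); apply/funext => k.
  by have /bop_eqP/(_ x) := Yop_comm k TX.
Qed.
End Iter.

(** [G] is the absolute value of [B = A - eta], the square root of [B^2] obtained from [Yop_lim]
    after scaling. On the complement [F] of the range of [B + G] the form of [B] is that of
    [- G <= 0]; on the closure of that range [(G - B) (B + G) = 0] gives [B = G >= 0]. *)
Theorem spectral_split A (eta : R) : adjoint A = A ->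
  exists F : set H, [/\ closed_lin (hH H) F, forall x, F x -> re (A x) x <= eta * nn x &
    forall x, perp (hH H) F x -> eta * nn x <= re (A x) x].
Proof.
move=> sA; pose B : 'B(H) := A - eta%:C *: (1 : 'B(H)).
have sB : adjoint B = B by rewrite /B bop_adjD bop_adjN bop_adjZ bop_adj1 conjR sA.
have BE x : B x = A x - eta%:C *: x by [].
clearbody B.
have [b0 b00 hb0] := bop_bd B.
pose b := b0 + 1; have bp : 0 < b by rewrite /b; lra.
have hb x : nrm (B x) <= b * nrm x.
  by apply: le_trans (hb0 x) _; rewrite ler_wpM2r ?nr_ge0// /b; lra.
pose c := (b ^+ 2)^-1; have c0 : 0 < c by rewrite invr_gt0 exprn_gt0.
have cb : c * b ^+ 2 = 1 by rewrite mulVf// gt_eqF// exprn_gt0.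
pose X : 'B(H) := 1 - c%:C *: (B * B).
have bX x : nrm (X x) <= nrm x.
  rewrite ler_wsqrtr// /X bopDE bopNE bop1E bopZE bopME n2B n2ZR ripZr.
  have -> : re x (B (B x)) = nn (B x) by rewrite /n2 radjE sB.
  have h : nn (B (B x)) <= b ^+ 2 * nn (B x).
    by rewrite -!nr_sq -exprMn ler_pXn2r ?nnegrE ?mulr_ge0 ?nr_ge0// ltW.
  have h2 := ler_wpM2l (sqr_ge0 c) h.
  have e : c ^+ 2 * (b ^+ 2 * nn (B x)) = c * nn (B x) by rewrite expr2 -mulrA (mulrA c (b ^+ 2)) cb mul1r.
  have := mulr_ge0 (ltW c0) (n2_ge0 (hH H) (B x)); rewrite e in h2; lra.
have [Y [bY YX Yc]] := Yop_lim bX.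
have BX : B * X = X * B.
  by apply/bop_eqP => x; rewrite !bopME /X !bopBE !bop1E !bopZE !bopME bopB bopZ.
have BY := Yc B BX.
pose G : 'B(H) := b%:C *: (1 - Y).
have GE x : G x = b%:C *: (x - Y x) by [].
have GG : G * G = B * B.
  apply/bop_eqP => x; rewrite !bopME !GE bopZ bopB.
  have /bop_eqP/(_ x) := YX; rewrite /X !bopE => e.
  have cbC : b%:C * b%:C * c%:C = 1 :> R[i] by rewrite -!rmorphM /= -expr2 mulrC cb.
  have -> : B (B x) = (b%:C * b%:C) *: (c%:C *: B (B x)) by rewrite scalerA cbC scale1r.
  have -> : c%:C *: B (B x) = x + Y (Y x) - (Y x + Y x).
    by rewrite e; apply: (@rip_inj _ _ (hH H)) => z; rewrite !ripE; ring.
  rewrite -scalerBr scalerA; congr (_ *: _).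
  by apply: (@rip_inj _ _ (hH H)) => z; rewrite !ripE; ring.
have BG : B * G = G * B.
  apply/bop_eqP => x; rewrite !bopME !GE bopZ bopB; congr (_ *: (_ - _)).
  by have /bop_eqP/(_ x) := BY.
have G0 x : 0 <= re (G x) x.
  rewrite GE ripZl mulr_ge0 ?(ltW bp)// ripDl ripNl subr_ge0 -/(nn x).
  apply: le_trans (rip_le _ _ _) _; rewrite -nr_sq expr2 ler_wpM2r ?nr_ge0//.
clearbody G.
pose W0 : set H := [set (B + G) x | x in setT].
have lW : lin_set W0.
  split; first by exists 0 => //; rewrite bop0.
  by move=> a _ _ [x _ <-] [y _ <-]; exists (a *: x + y) => //; rewrite bop_lin.
have cW := @cl_lin _ _ (hH H) _ lW.
exists (perp (hH H) (cl (hH H) W0)); split; first exact: perp_closed.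
  move=> x px; have : ip (hH H) ((B + G) x) x = 0 by apply: px; apply: sub_cl; exists x.
  move=> px0; have : re ((B + G) x) x = 0 by rewrite /rip px0.
  by rewrite bopDE BE !ripE -/(nn x); have := G0 x; lra.
move=> x /(perp_perp cW) Wx.
have e : G x = B x.
  apply/eqP; rewrite -subr_eq0; apply/eqP/(@nr_eq0 _ _ (hH H)).
  have [D D0 hD] := bop_bd (G - B).
  apply: (@eq0_arbitrarily_small _ _ D) => //; first exact: nr_ge0.
  move=> d d0; have [_ [y _ <-] xy] := Wx d d0.
  have GB : (G - B) ((B + G) y) = 0.
    rewrite -bopME mulrDr !mulrBl GG BG -[X in _ = X]/((0 : 'B(H)) y).
    by congr (bop_fun _ y); rewrite addrC addrA subrK subrr.
  have -> : G x - B x = (G - B) (x - (B + G) y) by rewrite bopB GB subr0.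
  by apply: le_trans (hD _) _; rewrite ler_wpM2l.
by have := G0 x; rewrite e BE !ripE -/(nn x); lra.
Qed.
End SpectralSplit.

Section Gap.
Variables (R : realType) (H : hilbertType R).
Notation "<< x , y >>" := (ip (hH H) x y).
Notation nrm := (nr (hH H)).
Notation nn := (n2 (hH H)).
Notation re := (rip (hH H)).
Variable (AA : set 'B(H)).
Hypothesis lpf : left_partial_factorization AA.
Variables (n : nat) (M : set ('I_n -> H)).
Hypotheses (cM : closed_lin (hT H n) M) (iM : ainv AA M).
Notation QM := (hproj (hT H n) M).
Notation K := (hcocore M).
Notation nrT := (nr (hT H n)).
Implicit Types (x h : H).

Let dist k x : R := nrT (tens x (dl R k) - QM (tens x (dl R k))).

(** One self-adjoint operator for all coordinates, so that a single spectral splitting controls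
    every [dist k] at once. *)
Lemma dist_op : exists A : 'B(H), adjoint A = A /\ forall x, re (A x) x = \sum_k (dist k x) ^+ 2.
Proof.
pose A : 'B(H) := \sum_k (1 - qop cM (dl R k) (dl R k)).
have AE x : A x = \sum_k (x - qop cM (dl R k) (dl R k) x).
  by rewrite /A (big_morph (fun B : 'B(H) => B x) (fun B C => erefl) erefl).
exists A; split.
  apply: adj_uniq => x y; rewrite !AE ip_suml ip_sumr; apply: eq_bigr => k _.
  by rewrite ipBl ipBr adjE qop_adj.
move=> x; rewrite AE rip_suml; apply: eq_bigr => k _.
rewrite /dist nr_sq ripDl ripNl -(phiE cM) /phi.
have := proj_n2 cM (tens x (dl R k)); rewrite -!nr_sq nr_tens_dl => e.
by rewrite -/(nn x) -(nr_sq _ x) e; ring.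
Qed.

Lemma dist_M k x (X : 'I_n -> H) : M X -> dist k x <= nrT (tens x (dl R k) - X).
Proof.
move=> MX; have -> : dist k x = nrT ((tens x (dl R k) - X) - QM (tens x (dl R k) - X)).
  rewrite projB// (proj_id cM MX) opprB addrA subrK//.
exact: projC_nr.
Qed.

Section ScaledProjection.
Variables (F : set H) (eps : R).
Hypotheses (cF : closed_lin (hH H) F) (e0 : 0 < eps).
Lemma scaled_projection : exists f S S' : 'B(H), [/\ S * S' = 1, S' * S = 1, adjoint S = S,
  forall x, [/\ F (f x), perp (hH H) F (x - f x), S x = f x + eps%:C *: (x - f x) &
     S' x = f x + eps^-1%:C *: (x - f x)] & forall x, nn x = nn (f x) + nn (x - f x)].
Proof.
have [f hf] := projop_ex cF.
have ff x : f (f x) = f x by rewrite !hf proj_id//; exact: proj_in.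
have fip x y : << f x, y>> = << x, f y>> by rewrite !hf proj_ip.
have sf : adjoint f = f by exact: adj_uniq.
have inv (a b : R) x : a * b = 1 -> (f + a%:C *: (1 - f)) ((f + b%:C *: (1 - f)) x) = x.
  move=> ab; rewrite !bopE !(bopD, bopZ, bopN) ff subrr scaler0 addr0.
  apply: (@rip_inj _ _ (hH H)) => z; rewrite !ripE.
  have ab' (w : R) : a * (b * w) = w by rewrite mulrA ab mul1r.
  have -> : a * (re z (f x) + b * (re z x - re z (f x)) - re z (f x)) =
      a * (b * (re z x - re z (f x))) by ring.
  by rewrite ab'; ring.
exists f, (f + eps%:C *: (1 - f)), (f + eps^-1%:C *: (1 - f)); split.
- by apply/bop_eqP => x; rewrite bopME inv// mulfV// gt_eqF.
- by apply/bop_eqP => x; rewrite bopME inv// mulVf// gt_eqF.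
- by rewrite bop_adjD bop_adjZ bop_adjD bop_adjN bop_adj1 conjR sf.
- move=> x; split=> //; rewrite hf; [exact: proj_in|exact: proj_perp].
- by move=> x; rewrite hf (proj_n2 cF x).
Qed.
End ScaledProjection.

(* With [S = eps] on [F^perp] and [S = 1] on [F], the image [U h] of a near-type vector [h] has almost
   no component in [F], while [U h - f (U h)] is almost annihilated by [A], against [A >= s^2] there. *)
Theorem identity_not_type : ~ typ M K 1%:M.
Proof.
move=> tK.
pose N : R := n%:R + 1; have N1 : 1 <= N by rewrite lerDr.
have nN : n%:R <= N by rewrite lerDl.
clearbody N; have N0 : 0 < N by lra.
(* Sized so that [n] distances of relative size [s] add up to at most one half, which closes the
   estimate [b3]. *)
pose s := (2 * N)^-1; have s0 : 0 < s by rewrite invr_gt0; lra.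
have sN : s * N = 2^-1 by rewrite /s; field; rewrite gt_eqF.
clearbody s.
have [A [sA AE]] := dist_op.
have [F [cF hF hF']] := spectral_split (s ^+ 2) sA.
have dF k x : F x -> dist k x <= s * nrm x.
  move=> Fx; apply: ler_sq; first by rewrite mulr_ge0 ?nr_ge0// ltW.
  rewrite exprMn (nr_sq (hH H) x); apply: le_trans (hF x Fx); rewrite AE (bigD1 k)//= lerDl.
  by rewrite sumr_ge0// => i _; exact: sqr_ge0.
(* Makes [N * (2 * c) ^+ 2 = c * s <= s ^+ 2 / 4], below the [3 / 4 * s ^+ 2] that [hF'] forces at
   [p]. *)
pose c := s / (4 * N); have c0 : 0 < c by rewrite divr_gt0//; lra.
have cN : 4 * (c * N) = s by rewrite /c; field; rewrite gt_eqF.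
clearbody c.
have [h [Kh nh Eh]] := tK c c0.
have h1 : nrm h = 1 by rewrite /nr nh sqrtr1.
(* [C] may depend on [x] but not on the scale [e] nor on [U], so the scale can be chosen after an
   approximation of [h] in [D]. *)
pose D : set H := [set x | exists2 C : R, 0 <= C & forall (e : R) (f S S' U : 'B(H)), 0 < e ->
  (forall x, [/\ F (f x), perp (hH H) F (x - f x) & S x = f x + e%:C *: (x - f x)]) ->
  fac_rel M S S' U -> adjoint S = S -> nrm (f (U x)) <= C * e].
have lD : lin_set D.
  split; first by exists 0 => // e f S S' U *; rewrite !bop0 nr0 mul0r.
  move=> a x y [C1 C10 h1'] [C2 C20 h2]; exists (cmod a * C1 + C2).
    by rewrite addr_ge0// mulr_ge0// cmod_ge0.
  move=> e f S S' U p0 p1 p2 p3; rewrite !bop_lin; apply: le_trans (nrD _ _ _) _.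
  rewrite nrZ mulrDl -mulrA; apply: lerD; last exact: (h2 e f S S').
  by rewrite ler_wpM2l ?cmod_ge0//; exact: (h1' e f S S').
have Dy Y k : perp (hT H n) M Y -> D (Y k).
  move=> pY; exists (nrT Y); first exact: nr_ge0.
  move=> e f S S' U p0 p1 [iU _ hMp] p3.
  pose xi := amp (adjoint S * U) Y.
  have pxi : perp (hT H n) M xi by exact: hMp.
  have xiE : xi = amp f (amp U Y) + e%:C *: (amp U Y - amp f (amp U Y)).
    by rewrite /xi p3; apply/funext => i; have [_ _] := p1 (U (Y i)).
  have ffx x : f (f x) = f x.
    have [h2 h3 _] := p1 x; have [h4 h5 _] := p1 (f x).
    apply/eqP; rewrite eq_sym -subr_eq0; apply/eqP/(@n2_eq0 _ _ (hH H)).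
    have Fd : F (f x - f (f x)) by apply: lin_setB => //; exact: cF.1.
    by rewrite /n2 /rip h5.
  have fxi : amp f xi = amp f (amp U Y).
    by rewrite xiE; apply/funext => i; rewrite /amp bopD bopZ bopB ffx subrr scaler0 addr0.
  pose w := amp f xi.
  have nw : n2 (hT H n) w = rip (hT H n) w xi.
    rewrite n2TE ripTE; apply: eq_bigr => i _; have [h2 h3 _] := p1 (xi i).
    have : re (w i) (xi i - w i) = 0 by rewrite /rip h3.
    by rewrite /w /amp !ripE /n2; lra.
  (* [xi] is orthogonal to [M], so only the distances of the [w i (x) e_i] to [M] contribute, and
     these are small as [w] has its entries in [F]. *)
  have b1 : rip (hT H n) w xi <= (\sum_i dist i (w i)) * nrT xi.
    rewrite [w in X in X <= _]tuple_sum rip_suml mulr_suml; apply: ler_sum => i _.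
    have -> : rip (hT H n) (tens (w i) (dl R i)) xi = rip (hT H n) (tens (w i) (dl R i) - QM (tens (w i) (dl R i))) xi.
      by rewrite ripDl ripNl {3}/rip pxi ?subr0//; exact: proj_in.
    exact: rip_le.
  have b2 : \sum_i dist i (w i) <= 2^-1 * nrT w.
    apply: (@le_trans _ _ (\sum_(i < n) s * nrT w)).
      apply: ler_sum => i _; have [h2 _ _] := p1 (xi i).
      apply: le_trans (dF i _ h2) _; rewrite ler_wpM2l ?(ltW s0)//; exact: nr_coord.
    rewrite sumr_const card_ord -[leLHS]mulr_natl mulrA ler_wpM2r ?nr_ge0//.
    by rewrite -sN mulrC ler_wpM2l// ltW.
  have b3 : nrT w <= 2^-1 * nrT xi.
    have [w0|w0] := eqVneq w 0; first by rewrite w0 nr0 mulr_ge0 ?nr_ge0// invr_ge0.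
    rewrite -(ler_pM2l (nr_gt0 (hT H n) w0)) -expr2 nr_sq nw; apply: le_trans b1 _.
    have := ler_wpM2r (nr_ge0 (hT H n) xi) b2; lra.
  have b4 : nrT xi <= nrT w + e * nrT Y.
    rewrite xiE; apply: le_trans (nrD _ _ _) _; rewrite /w fxi lerD2l nrZR ger0_norm ?(ltW p0)//.
    rewrite ler_wpM2l ?(ltW p0)//; apply: (@le_trans _ _ (nrT (amp U Y))); last by rewrite (amp_isom iU).
    rewrite ler_wsqrtr// !n2TE; apply: ler_sum => i _; have [h2 h3 _] := p1 (amp U Y i).
    have := n2D (hH H) (amp U Y i - f (amp U Y i)) (f (amp U Y i)).
    rewrite subrK => ->; have -> : re (amp U Y i - f (amp U Y i)) (f (amp U Y i)) = 0.
      by rewrite ripC /rip h3.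
    by rewrite mulr0 addr0 lerDl n2_ge0.
  apply: (@le_trans _ _ (nrT w)); last by rewrite mulrC; lra.
  by rewrite /w fxi; exact: (nr_coord (amp f (amp U Y)) k).
(* A vector orthogonal to all coordinates of the complement of [M] lies in [hcore], hence is
   orthogonal to [K]. *)
have KD x : K x -> cl (hH H) D x.
  move=> Kx; suff pp : perp (hH H) (perp (hH H) (cl (hH H) D)) x by exact: (perp_perp (cl_lin (hH H) lD) pp).
  move=> e He.
  rewrite (Kx e)// => k; apply: (perp_perp cM) => Y pY.
  rewrite ip_tens slice_dl; apply: He; apply: sub_cl; exact: Dy.
have q4 : 0 < 4^-1 :> R by rewrite invr_gt0.
have [x [C C0 hx] hdx] := KD h Kh 4^-1 q4.
have [eps [e0 [e1 [eC ec]]]] : exists e : R, 0 < e /\ (e <= 1 /\ (C * e <= 4^-1 /\ e <= c)).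
  exists (Num.min 1 (Num.min (4^-1 / (C + 1)) c)); split.
    by rewrite !lt_min ltr01 c0 divr_gt0//; lra.
  split; first by rewrite ge_min lexx.
  split; last by rewrite !ge_min lexx !orbT.
  apply: (@le_trans _ _ (C * (4^-1 / (C + 1)))); first by rewrite ler_wpM2l// !ge_min lexx !orbT.
  by rewrite mulrA ler_pdivrMr; lra.
have [f [S [S' [i1 i2 sS fS pyth]]]] := scaled_projection cF e0.
have [U hU] := fac_rel_ex lpf iM i1 i2.
have iU : isometry U by case: hU.
have bf y : nrm (f y) <= nrm y by rewrite ler_wsqrtr// (pyth y) lerDl n2_ge0.
have fUh : nrm (f (U h)) <= 2^-1.
  have hx2 : nrm (f (U x)) <= C * eps.
    by apply: (hx eps f S S' U) => // y; have [p1 p2 p3 _] := fS y.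
  have := nrD (hH H) (f (U (h - x))) (f (U x)); rewrite -!bopD subrK.
  by have := bf (U (h - x)); rewrite (isom_nr iU); lra.
pose p := U h - f (U h).
have np : 3 / 4 <= nn p.
  have := pyth (U h); rewrite -[nn (U h)]nr_sq (isom_nr iU) h1 -/p -(nr_sq _ (f _)).
  have := nr_ge0 (hH H) (f (U h)); nra.
have pF : perp (hH H) F p by have [_ ? _ _] := fS (U h).
(* The competitor in [M] is [eps S' U m]: on the complement of [F] the factor [eps] undoes [S'], so
   [eps S' U h = p + eps f (U h)]. *)
have dp k : dist k p <= 2 * c.
  pose m := QM (tens h (dl R k)); have Mm : M m by exact: proj_in.
  have [_ hM _] := hU.
  have Mm' : M (eps%:C *: amp (S' * U) m) by apply: lin_setZ; [exact: cM.1|exact: hM].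
  apply: le_trans (dist_M k p Mm') _.
  have -> : tens p (dl R k) - eps%:C *: amp (S' * U) m =
     eps%:C *: amp (S' * U) (tens h (dl R k) - m) - tens (eps%:C *: f (U h)) (dl R k).
    have e : eps%:C *: S' (U h) = eps%:C *: f (U h) + p.
      have [_ _ _ ->] := fS (U h).
      by rewrite scalerDr scalerA -rmorphM/= mulfV ?gt_eqF// scale1r.
    have -> : p = eps%:C *: S' (U h) - eps%:C *: f (U h) by rewrite e addrC addKr.
    rewrite ampB amp_tens bopME tensBl !tensZl.
    by apply: (@rip_inj _ _ (hT H n)) => z; rewrite !ripE; ring.
  apply: le_trans (nrB _ _ _) _; rewrite nr_tens_dl !nrZR ger0_norm ?(ltW e0)//.
  have bS' y : nrm (S' y) <= eps^-1 * nrm y.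
    have ie : 1 <= eps^-1 by rewrite invf_ge1.
    have [_ h3 _ hS'] := fS y; apply: ler_sq; first by rewrite mulr_ge0 ?nr_ge0// ltW// invr_gt0.
    rewrite exprMn !nr_sq hS' (pyth y) n2D n2ZR ripZr.
    have -> : re (f y) (y - f y) = 0 by rewrite /rip h3//; have [] := fS y.
    have := n2_ge0 (hH H) (f y); have := n2_ge0 (hH H) (y - f y); have : 1 <= eps^-1 ^+ 2 by rewrite exprn_ege1.
    nra.
  have ie0 : 0 <= eps^-1 by rewrite ltW// invr_gt0.
  have := amp_bd bS' ie0 (amp U (tens h (dl R k) - m)).
  rewrite (amp_isom iU) -ampM => hb.
  have hb2 := ler_wpM2l (ltW e0) hb; rewrite mulrA mulfV ?gt_eqF// mul1r in hb2.
  have er : nrT (tens h (dl R k) - m) <= c.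
    apply: le_trans Eh; apply: le_trans (errT_le M 1%:M k h).
    have pk : pcol 1%:M k = dl R k by apply/funext => j; rewrite /pcol /dl mxE.
    by rewrite /errT pk nrBC.
  have : eps * nrm (f (U h)) <= c by have := nr_ge0 (hH H) (f (U h)); nra.
  lra.
have := hF' p pF; rewrite AE.
have : \sum_k dist k p ^+ 2 <= N * (2 * c) ^+ 2.
  apply: (@le_trans _ _ (\sum_(k < n) (2 * c) ^+ 2)).
    by apply: ler_sum => k _; rewrite ler_pXn2r ?nnegrE ?nr_ge0// mulr_ge0// ltW.
  by rewrite sumr_const card_ord -[leLHS]mulr_natl ler_wpM2r ?sqr_ge0.
have e1' : N * (2 * c) ^+ 2 <= s ^+ 2 / 4.
  have -> : N * (2 * c) ^+ 2 = c * (4 * (c * N)) by ring.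
  rewrite cN; have : c <= s / 4.
    rewrite -cN; have : c * 1 <= c * N by rewrite ler_wpM2l// ltW.
    lra.
  by nra.
have s2 : 0 < s ^+ 2 by rewrite exprn_gt0.
nra.
Qed.
End Gap.

(** * Reduction of the number of coordinates *)

Section Prj.
Variables (R : realType) (n : nat).
Implicit Types (P : 'M[R[i]]_n) (w : 'I_n -> R[i]).

Lemma prj_mul_adj P P' j k : hermproj P -> hermproj P' -> (P *m P') j k = ((P' *m P) k j)^*.
Proof.
move=> [hP _] [hP' _]; rewrite !mxE rmorph_sum; apply: eq_bigr => l _.
by rewrite rmorphM/= -hP -hP' mulrC.
Qed.
Lemma prj_mulC P P' Q : hermproj P -> hermproj P' -> hermproj Q -> P' *m P = Q -> P *m P' = Q.
Proof.
move=> hP hP' hQ e; apply/matrixP => j k.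
by rewrite prj_mul_adj// e (hQ.1 k j).
Qed.
Lemma qdB P P' w : qd (P - P') w = qd P w - qd P' w.
Proof.
rewrite /qd -cReN -cReD -sumrN -big_split/=; congr Re; apply: eq_bigr => j _.
rewrite -sumrN -big_split/=; apply: eq_bigr => k _; rewrite !mxE; ring.
Qed.
Lemma qd1 w : qd 1%:M w = c2 w.
Proof.
rewrite qdE; have -> : pv 1%:M w = w.
  apply/funext => j; rewrite /pv (bigD1 j)//= mxE eqxx mul1r big1 ?addr0// => k kj.
  by rewrite mxE eq_sym (negbTE kj) mul0r.
by rewrite cipxx.
Qed.
Lemma qd_prj P w : hermproj P -> qd P w = c2 (pv P w).
Proof.
move=> [hP PP]; rewrite qdE.
have {1}-> : pv P w = pv P (pv P w).
  apply/funext => j; rewrite /pv -{1}PP; under eq_bigr do rewrite mxE mulr_suml.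
  rewrite exchange_big; apply: eq_bigr => l _; rewrite mulr_sumr.
  by apply: eq_bigr => k _; rewrite mulrA.
set v := pv P w.
have -> : cip (pv P v) w = cip v v.
  rewrite /cip /v /pv; under eq_bigr do rewrite mulr_suml.
  rewrite exchange_big; apply: eq_bigr => l _; rewrite rmorph_sum mulr_sumr.
  by apply: eq_bigr => k _; rewrite rmorphM/= -hP mulrCA mulrA.
by rewrite cipxx.
Qed.
Lemma qd_ge0 P w : hermproj P -> 0 <= qd P w.
Proof. by move=> hP; rewrite qd_prj// c2_ge0. Qed.
Lemma prj_sub P P' : hermproj P -> hermproj P' -> P' *m P = P -> hermproj (P' - P).
Proof.
move=> hP hP' e; split=> [j k|]; first by rewrite !mxE hP.1 hP'.1 rmorphB.
have e' : P *m P' = P by exact: prj_mulC e.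
by rewrite mulmxBl !mulmxBr hP.2 hP'.2 e e' subrr subr0.
Qed.
Lemma prj1 : hermproj (1%:M : 'M[R[i]]_n).
Proof.
split; last by rewrite mulmx1.
by move=> j k; rewrite !mxE eq_sym; case: eqP => _; rewrite ?rmorph1 ?rmorph0.
Qed.
Lemma qd_le P w : hermproj P -> qd P w <= c2 w.
Proof.
move=> hP; rewrite -qd1 -subr_ge0 -qdB; apply: qd_ge0.
by apply: prj_sub => //; [exact: prj1|rewrite mul1mx].
Qed.
Lemma qd_eq0 P : hermproj P -> (forall k, qd P (tw (fun=> 0) (Some (k, k, false))) = 0) -> P = 0.
Proof.
move=> hP h; apply/matrixP => j k; have := h k; rewrite qd_prj// /c2.
have pvE i : pv P (tw (fun=> 0) (Some (k, k, false))) i = P i k + P i k.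
  rewrite /pv (bigD1 k)//= big1 => [|l lk].
    by rewrite /tw scale1r addr0 -[(dl R k + _) k]/(dl R k k + dl R k k) /dl eqxx mulrDr mulr1.
  by rewrite /tw scale1r -[(dl R k + _) l]/(dl R k l + dl R k l) /dl (negbTE lk) addr0 mulr0.
move=> /eqP; rewrite psumr_eq0 => [|i _]; last exact: sqm_ge0.
move=> /allP/(_ j); rewrite mem_index_enum => /(_ isT)/eqP/sqm_eq0; rewrite pvE.
by move/eqP; rewrite -mulr2n mulrn_eq0/= => /eqP ->; rewrite mxE.
Qed.
End Prj.

Section Claim.
Variables (R : realType) (H : hilbertType R).
Notation "<< x , y >>" := (ip (hH H) x y).
Notation nrm := (nr (hH H)).
Notation nn := (n2 (hH H)).
Variable (AA : set 'B(H)).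
Hypothesis sepH : separable H.
Hypothesis lpf : left_partial_factorization AA.
Variables (n : nat) (M : set ('I_n -> H)).
Hypotheses (cM : closed_lin (hT H n) M) (iM : ainv AA M).
Notation QM := (hproj (hT H n) M).
Notation K := (hcocore M).
Implicit Types (P : 'M[R[i]]_n) (x h : H).

(** By comparability the alternative is [P0 <= P]. Then every term of [PhiP] at [P] is at least the
    one at [P0], while maximality gives the reverse for the sum; equality of all the forms forces
    [P = P0]. *)
Lemma max_type_absorbs (u : 'I_n -> R[i]) (L : R) P0 P : 0 <= L -> typ M K P0 ->
  (forall x, K x -> nn x = 1 -> Phi M (tw u) (tgam L) x <= PhiP u L P0) ->
  typ M K P -> P0 *m P = P.
Proof.
move=> L0 t0 mx0 tP.
have h0 : hermproj P0 by exact: typ_prj t0.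
have hP : hermproj P by exact: typ_prj tP.
have tT Q : typ M K Q -> typ M setT Q by move=> t d /t[h [_ nh Eh]]; exists h.
have [e|//] := types_comparable sepH lpf cM iM (tT _ t0) (tT _ tP).
have hD : hermproj (P - P0) by exact: prj_sub.
have le_qd w : qd P0 w <= qd P w by rewrite -subr_ge0 -qdB qd_ge0.
have term b : tgam L b * qd P0 (tw u b) + qd P0 (tw u b) ^+ 2 <=
    tgam L b * qd P (tw u b) + qd P (tw u b) ^+ 2.
  have g1 := tgam1 L0 b; have q0 := qd_ge0 (tw u b) h0.
  have := le_qd (tw u b) => hq; apply: lerD.
    by rewrite ler_wpM2l// (le_trans _ g1).
  by rewrite ler_pXn2r// nnegrE// (le_trans q0).
have le := PhiP_near cM L0 tP mx0.
have eqs b : qd P (tw u b) = qd P0 (tw u b).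
  have g1 := tgam1 L0 b; have q0 := qd_ge0 (tw u b) h0.
  have hq := le_qd (tw u b); have tb := term b.
  have : tgam L b * qd P (tw u b) + qd P (tw u b) ^+ 2 <=
      tgam L b * qd P0 (tw u b) + qd P0 (tw u b) ^+ 2.
    move: le; rewrite /PhiP (bigD1 b)//= [X in _ <= X](bigD1 b)//= => le.
    have : \sum_(c | c != b) (tgam L c * qd P0 (tw u c) + qd P0 (tw u c) ^+ 2) <=
      \sum_(c | c != b) (tgam L c * qd P (tw u c) + qd P (tw u c) ^+ 2) by apply: ler_sum => c _.
    by move=> hs; lra.
  nra.
suff D0 : P - P0 = 0 by move/eqP: D0; rewrite subr_eq0 => /eqP ->; exact: h0.2.
apply: qd_eq0 => // k; have := eqs (Some (k, k, false)); rewrite qdB.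
by rewrite -[tw u _]/(tw (fun=> 0) (Some (k, k, false))) => ->; rewrite subrr.
Qed.

(** A maximal type [P0] is not the identity, so [1 - P0] has a nonzero column; every type satisfies
    [P = P P0] and kills it. *)
Lemma type_column : (exists2 x, K x & x != 0) -> exists u : 'I_n -> R[i],
  (exists k, u k != 0) /\ forall P, typ M K P -> pv P u = fun=> 0.
Proof.
move=> K0; have [P0 [t0 mx0]] := max_type lpf cM iM (fun=> 0) (lexx 0) K0.
have h0 : hermproj P0 by exact: typ_prj t0.
have P01 : 1%:M - P0 != 0.
  by rewrite subr_eq0; apply/eqP => e; rewrite -e in t0; exact: (identity_not_type lpf cM iM t0).
have [j [k jk]] : exists j k, (1%:M - P0) k j != 0.
  apply: contrapT => hn; move/eqP: P01; apply; apply/matrixP => k j.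
  by rewrite [RHS]mxE; apply/eqP/negPn/negP => h; apply: hn; exists j, k.
exists (fun i => (1%:M - P0) i j); split; first by exists k.
move=> P tP; have hP : hermproj P by exact: typ_prj tP.
have e : P *m P0 = P.
  by apply: prj_mulC => //; exact: (max_type_absorbs (lexx 0) t0 mx0 tP).
apply/funext => i; rewrite /pv; transitivity ((P *m (1%:M - P0)) i j); first by rewrite mxE.
by rewrite mulmxBr mulmx1 e subrr mxE.
Qed.

(** The vector [u] is killed only by types, that is at special vectors. The weight [L] on [u]
    extends this to all of [K]: a maximal type for the weight [L] kills [u] as well, so [Phi] is
    bounded by a [C] independent of [L], and [phi M u] must vanish on [K]. *)
Lemma common_slice (k0 : 'I_n) : exists u : 'I_n -> R[i],
  (exists k, u k != 0) /\ forall m, M m -> hcore M (slice u m).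
Proof.
have [K0|K0] := pselect (exists2 x, K x & x != 0); last first.
  exists (dl R k0); split; first by exists k0; rewrite /dl eqxx oner_eq0.
  move=> m _; apply: (perp_perp (hcore_closed cM)) => x Kx.
  have -> : x = 0 by apply/eqP/negPn/negP => x0; apply: K0; exists x.
  by rewrite ip0l.
have [u [u0 hu]] := type_column K0; exists u; split=> // m Mm.
pose C := \sum_(b : tI n) (c2 (tw u b) + c2 (tw u b) ^+ 2).
have bd x (L : R) : 0 <= L -> K x -> nn x = 1 -> Phi M (tw u) (tgam L) x <= C.
  move=> L0 Kx nx; have [P [tP mxP]] := max_type lpf cM iM u L0 K0.
  have hP : hermproj P by exact: typ_prj tP.
  apply: le_trans (mxP x Kx nx) _; apply: ler_sum => b _; apply: lerD; last first.
    by rewrite ler_pXn2r ?nnegrE ?c2_ge0 ?qd_ge0 ?qd_le.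
  case: b => [b|]; first by rewrite -[tgam _ _]/1 mul1r qd_le.
  rewrite -[tw _ _]/u qd_prj// hu// /c2 big1 ?mulr0 ?c2_ge0// => i _.
  by rewrite /sqm expr0n addr0.
have phi0 x : K x -> nn x = 1 -> phi M u x = 0.
  move=> Kx nx; have f0 := phi_ge0 M u x; apply/eqP/negPn/negP => fx.
  have fp : 0 < phi M u x by rewrite lt_def fx.
  have C0 : 0 <= C by rewrite sumr_ge0// => b _; rewrite addr_ge0 ?c2_ge0 ?sqr_ge0.
  (* For this weight the term of [u] in [Phi] is at least [C + phi M u x], above the bound. *)
  have L0 : 0 <= C / phi M u x by rewrite divr_ge0.
  have := bd x _ L0 Kx nx; rewrite /Phi (bigD1 None)//= mulrDl mul1r divfK//.
  have : 0 <= \sum_(b : tI n | b != None) (tgam (C / phi M u x) b * phi M (tw u b) x + phi M (tw u b) x ^+ 2).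
    rewrite sumr_ge0// => b _; rewrite addr_ge0 ?sqr_ge0// mulr_ge0 ?phi_ge0//.
    exact: le_trans (tgam1 L0 b).
  have := sqr_ge0 (phi M u x); lra.
have Q0 x : K x -> QM (tens x u) = 0.
  move=> Kx; apply: (@n2_eq0 _ _ (hT H n)); rewrite -/(phi M u x).
  have [->|x0] := eqVneq x 0; first by rewrite /phi tens0l (proj_id cM cM.1.1) n2_0.
  have nx0 : nrm x != 0 by rewrite gt_eqF// nr_gt0.
  have sq : sqm (nrm x)^-1%:C = (nrm x)^-1 ^+ 2 by rewrite sqmR.
  have h : phi M u ((nrm x)^-1%:C *: x) = 0.
    apply: phi0; first exact: lin_setZ (hcocore_closed M).1 Kx.
    by rewrite n2ZR -nr_sq -exprMn mulVf// expr1n.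
  move/eqP: h; rewrite (phiZ cM) sq mulf_eq0 expf_eq0/= invr_eq0 (negbTE nx0) /=.
  by move/eqP.
apply: (perp_perp (hcore_closed cM)) => x Kx.
by rewrite -ip_tens' -(proj_id cM Mm) -proj_ip// Q0// ip0l.
Qed.
End Claim.
Section LeftCase.
Variables (R : realType) (H : hilbertType R).
Notation nrm := (nr (hH H)).
Variable (AA : set 'B(H)).

Section Fill.
Variables (n m : nat) (v : 'I_n -> 'I_m -> R[i]).
Definition fill (x : 'I_n -> H) : 'I_m -> H := \sum_j tens (x j) (v j).
Lemma fill_lin a x y : fill (a *: x + y) = a *: fill x + fill y.
Proof.
by rewrite /fill scaler_sumr -big_split/=; apply: eq_bigr => j _; rewrite -tensZl -tensDl.
Qed.
Lemma fill_amp (T : 'B(H)) x : amp T (fill x) = fill (amp T x).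
Proof.
rewrite /fill (big_morph (amp T) (ampD T) (_ : amp T 0 = 0)).
  by apply: eq_bigr => j _; rewrite amp_tens.
by apply/funext => i; rewrite /amp bop0.
Qed.
Lemma fill_bd : exists2 C : R, 0 <= C & forall x, nr (hT H m) (fill x) <= C * nr (hT H n) x.
Proof.
exists (\sum_j Num.sqrt (c2 (v j))); first by rewrite sumr_ge0// => j _; exact: sqrtr_ge0.
move=> x; apply: le_trans (nr_sum _ _ _ _) _; rewrite mulr_suml; apply: ler_sum => j _.
by rewrite nr_tens ler_wpM2l ?sqrtr_ge0//; exact: nr_coord.
Qed.
Lemma fill_closed M : closed_lin (hT H m) M -> closed_lin (hT H n) [set x | M (fill x)].
Proof.
move=> cM; have fill0 : fill 0 = 0 by have := fill_lin (-1) 0 0; rewrite scaler0 addr0 scaleN1r addNr.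
split; first split.
- by rewrite /= fill0; exact: cM.1.1.
- by move=> a x y hx hy; rewrite /= fill_lin; exact: cM.1.2.
have [C C0 hC] := fill_bd; have C1 : 0 < C + 1 by lra.
move=> x hx; apply: cM.2 => e e0; have d0 : 0 < e / (C + 1) by rewrite divr_gt0.
have [y My xy] := hx _ d0; exists (fill y) => //.
have -> : fill x - fill y = fill (x - y).
  by rewrite [x - y]addrC -scaleN1r fill_lin scaleN1r addrC.
apply: le_trans (hC _) _; apply: (@le_trans _ _ (C * (e / (C + 1)))).
  by rewrite ler_wpM2l.
by rewrite mulrA ler_pdivrMr//; nra.
Qed.
Lemma fill_inv M : ainv AA M -> ainv AA [set x | M (fill x)].
Proof. by move=> iM A x AAA /= Mx; rewrite -fill_amp; exact: iM. Qed.
End Fill.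

(** The kernel of [slice u] is a copy of [H^n]: as [u k] is nonzero, coordinate [k] is determined by
    the others. *)
Lemma slice0_fill n (u : 'I_n.+1 -> R[i]) k X : u k != 0 -> slice u X = 0 ->
  X = fill (fun j => dl R (lift k j) - (u (lift k j) / u k)^* *: dl R k)
        (fun j => X (lift k j)) :> ('I_n.+1 -> H).
Proof.
move=> uk; rewrite /slice (bigD1_ord k)//= => /eqP; rewrite addr_eq0 => /eqP e.
have uk' : (u k)^* != 0 by rewrite conjC_eq0.
have Xk : X k = - \sum_j (u (lift k j) / u k)^* *: X (lift k j).
  rewrite -[X k]scale1r -(mulVf uk') -scalerA e scalerN scaler_sumr; congr (- _).
  by apply: eq_bigr => j _; rewrite scalerA rmorphM/= fmorphV mulrC.
rewrite {1}[X]tuple_sum (bigD1_ord k)//= {1}Xk /fill.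
have -> : tens (- \sum_j (u (lift k j) / u k)^* *: X (lift k j)) (dl R k) =
   - \sum_j tens (X (lift k j)) ((u (lift k j) / u k)^* *: dl R k).
  rewrite -scaleN1r tensZl scaleN1r; congr (- _).
  rewrite (big_morph (fun x => tens x (dl R k)) (fun x y => tensDl x y _) (tens0l H _)).
  by apply: eq_bigr => j _; rewrite tensZl tensZr.
rewrite addrC -sumrB; apply: eq_bigr => j _.
by rewrite tensDr -[- (_ *: dl R k)]scaleN1r [tens _ (-1 *: _)]tensZr scaleN1r.
Qed.

(** By induction on [n]: [y] is normalised so that [X - y (x) e_k] lies in the kernel of [slice u],
    which [fill] parametrises by a smaller power of [H], while [y] lies in the invariant subspace
    [hcore], where [T] acts directly. *)
Theorem left_case (sepH : separable H) (lpf : left_partial_factorization AA) (T : 'B(H)) :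
  lat_inv AA T -> forall n (M : set ('I_n -> H)), closed_lin (hT H n) M ->
  ainv AA M -> forall X, M X -> M (amp T X).
Proof.
move=> lT; elim=> [|n IH] M cM iM X MX.
  by have -> : amp T X = X by apply/funext; case.
have [u [[k uk] hu]] := common_slice sepH lpf cM iM ord0.
have uk' : (u k)^* != 0 by rewrite conjC_eq0.
pose y := ((u k)^*)^-1 *: slice u X.
have Ey : hcore M y by apply: lin_setZ (hu X MX); exact: (hcore_closed cM).1.
have MD := lin_setD cM.1; have MB := lin_setB cM.1.
have Me : M (tens y (dl R k)) by exact: hcore_tens.
have s0 : slice u (X - tens y (dl R k)) = 0.
  rewrite sliceB slice_tens /cip (bigD1 k)//= big1 => [|i ik].
    by rewrite /dl eqxx mul1r addr0 scalerA mulfV// scale1r subrr.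
  by rewrite /dl (negbTE ik) mul0r.
have h1 : M (amp T (X - tens y (dl R k))).
  have := slice0_fill uk s0; set v := (fun j => dl R _ - _); set x := (fun j => _) => XE.
  rewrite XE fill_amp; apply: (IH _ (fill_closed v cM) (fill_inv (v := v) iM) x).
  by rewrite /= -XE; exact: MB.
have h2 : M (amp T (tens y (dl R k))).
  rewrite amp_tens; apply: (hcore_tens cM); apply: (lT _ (hcore_closed cM)) Ey.
  by move=> A AAA x Ex; exact: (hcore_inv iM AAA Ex).
by rewrite -[X](subrK (tens y (dl R k))) ampD; exact: MD.
Qed.
End LeftCase.

Theorem theorem2p2 (R : realType) (H : hilbertType R) (AA : set 'B(H)) :
  separable H -> ~ finite_dimensional H ->
  unital_subalgebra AA -> wot_closed AA ->
  (left_partial_factorization AA -> AA = Alg (Lat AA) /\ reflexive_algebra AA) /\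
  (right_partial_factorization AA -> AA = Alg (Lat AA) /\ reflexive_algebra AA).
Proof.
move=> sepH _ uA cA; split=> pf.
  have e : AA = Alg (Lat AA).
    by apply: reflexive_reduction => // T lT; exact: left_case.
  by split.
have e : AA = Alg (Lat AA).
  by apply: reflexive_reduction => // T lT; exact: right_case.
by split.
Qed.
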